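(* Let $(p_n)$ be a sequence of integers diverging to infinity and $(\kappa_n)$ an arbitrary sequence in $(0,\infty)$. Let $(\theta_{n0})$, $(\nu_n)$, $(\tau_n)$ be sequences such that $\theta_{n0}\in\mathcal S^{p_n-1}$ and $\theta_n:=\theta_{n0}+\nu_n\tau_n\in\mathcal S^{p_n-1}$ for every $n$, with $(\tau_n)$ bounded (i.e. $\tau_n\in\mathbb R^{p_n}$, $\|\tau_n\|=O(1)$), $\nu_n>0$, and $$\nu_n^2=O\Big(\frac{\sqrt{p_n}}{n\kappa_n e_{n1}}\Big).$$ Then, as $n\to\infty$ under $\mathrm P^{(n)}_{\theta_{n0},\kappa_n}$, $$\Lambda^{(n)\mathrm{inv}}_{\theta_n/\theta_{n0};\kappa_n}=-\tfrac12\sqrt n\,\kappa_n\nu_n^2\sqrt{\tilde e_{n2}}\,\|\tau_n\|^2 Z_n+\frac{n\kappa_n\nu_n^2e_{n1}}{\sqrt2\,p_n^{1/2}}\|\tau_n\|^2\Big(1-\tfrac14\nu_n^2\|\tau_n\|^2\Big)\widetilde W_n-\tfrac18 n\kappa_n\nu_n^4e_{n1}\|\tau_n\|^4-\frac{n^2\kappa_n^2\nu_n^4e_{n1}^2}{4p_n}\|\tau_n\|^4\Big(1-\tfrac14\nu_n^2\|\tau_n\|^2\Big)^2+o_{\mathrm P}(1).$$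
   Context: $\mathcal S^{p-1}=\{x\in\mathbb R^p:\|x\|=1\}$. For $\theta\in\mathcal S^{p-1}$, $\kappa>0$, the FvML distribution $\mathrm{FvML}_p(\theta,\kappa)$ has density $x\mapsto \frac{c_{p,\kappa}}{\omega_{p-1}}\exp(\kappa x^\top\theta)$ w.r.t. surface area on $\mathcal S^{p-1}$, where $\omega_{p-1}=2\pi^{(p-1)/2}/\Gamma(\frac{p-1}2)$ and $c_{p,\kappa}=1/\int_{-1}^1(1-t^2)^{(p-3)/2}e^{\kappa t}\,dt$. For each $n$, $X_{n1},\dots,X_{nn}$ are random vectors in $\mathcal S^{p_n-1}$; $\mathrm P^{(n)}_{\theta_n,\kappa}$ is the hypothesis that they are i.i.d. $\mathrm{FvML}_{p_n}(\theta_n,\kappa)$; $\bar X_n=\frac1n\sum_i X_{ni}$. Moments: $e_{n\ell}=E[U^\ell]$, $\tilde e_{n\ell}=E[(U-e_{n1})^\ell]$, $f_{n\ell}=E[(1-U^2)^{\ell/2}]$, where $U$ has density $u\mapsto c_{p_n,\kappa_n}(1-u^2)^{(p_n-3)/2}e^{\kappa_nu}$ on $[-1,1]$ (law of $X_{ni}^\top\theta_{n0}$ under $\mathrm P^{(n)}_{\theta_{n0},\kappa_n}$). Statistics: $Z_n=\sqrt n(\bar X_n^\top\theta_{n0}-e_{n1})/\sqrt{\tilde e_{n2}}$; $W_n=\dfrac{n(p_n-1)\bar X_n^\top(I_{p_n}-\theta_{n0}\theta_{n0}^\top)\bar X_n}{1-\frac1n\sum_{i=1}^n(X_{ni}^\top\theta_{n0})^2}$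 (Watson statistic); $\widetilde W_n=(W_n-(p_n-1))/\sqrt{2(p_n-1)}$. Invariant log-likelihood ratio: let $SO_{p}(\theta_0)$ be the group of rotations $O$ of $\mathbb R^p$ with $O\theta_0=\theta_0$, with normalized Haar measure $dO$. For $\theta_n\in\mathcal S^{p_n-1}$ and $\kappa,\kappa'>0$, $$\Lambda^{(n)\mathrm{inv}}_{\theta_n,\kappa'/\theta_{n0},\kappa}:=n\log\frac{c_{p_n,\kappa'}}{c_{p_n,\kappa}}+\log\int_{SO_{p_n}(\theta_{n0})}\exp\big(n\kappa'\bar X_n^\top O^\top\theta_n\big)\,dO-n\kappa\,\bar X_n^\top\theta_{n0},$$ which is the log-likelihood ratio of the maximal invariant under this group; $\Lambda^{(n)\mathrm{inv}}_{\theta_n/\theta_{n0};\kappa}:=\Lambda^{(n)\mathrm{inv}}_{\theta_n,\kappa/\theta_{n0},\kappa}$. *)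

(* Defs.v *)
From HB Require Import structures.
From mathcomp Require Import all_boot all_order all_algebra.
From mathcomp Require Import all_classical all_reals all_analysis.
Import Order.TTheory GRing.Theory Num.Theory.
Import numFieldNormedType.Exports.

Set Implicit Arguments.
Unset Strict Implicit.
Unset Printing Implicit Defensive.

Local Open Scope classical_set_scope.
Local Open Scope ring_scope.

Section FvMLDefs.
Variable R : realType.

Definition vecT (p : nat) := g_sigma_algebraType (@open 'cV[R]_p).
Definition matT (p : nat) := g_sigma_algebraType (@open 'M[R]_p).

Definition dotv p (x y : 'cV[R]_p) : R := (x^T *m y) 0 0.
Definition enorm p (x : 'cV[R]_p) : R := Num.sqrt (dotv x x).

Definition sphere p : set 'cV[R]_p := [set x | enorm x = 1].

Definition GammaR (s : R) : R :=
  Rintegral lebesgue_measure [set` `]0%R, +oo[]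
    (fun t => t `^ (s - 1) * expR (- t)).

(** omega k = 2 pi^(k/2) / Gamma(k/2); the paper's omega_{p-1} is omega (p-1)
    (surface area of S^{p-2}); the surface area of S^{p-1} is omega p. *)
Definition omega (k : nat) : R := 2 * pi `^ (k%:R / 2) / GammaR (k%:R / 2).

Definition cpk (p : nat) (k : R) : R :=
  (Rintegral lebesgue_measure [set` `[(-1)%R, 1%R]]
    (fun t => (1 - t ^+ 2) `^ ((p%:R - 3) / 2) * expR (k * t)))^-1.

Definition fvml_density p (theta : 'cV[R]_p) (k : R) (x : 'cV[R]_p) : R :=
  cpk p k / omega p.-1 * expR (k * dotv x theta).

(** Surface area measure on S^{p-1}: the Borel measure on R^p concentrated on
    the sphere, invariant under all orthogonal transformations, with total
    mass equal to the surface area 2 pi^(p/2)/Gamma(p/2) (uniqueness of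
    invariant measures on the sphere makes this the surface area measure). *)
Definition is_surface_measure p (sigma : {measure set (vecT p) -> \bar R}) :=
  [/\ sigma (~` (@sphere p : set (vecT p))) = 0%E,
      sigma setT = (omega p)%:E &
      forall O : 'M[R]_p, O *m O^T = 1%:M ->
        forall B : set (vecT p), measurable B ->
          sigma ((fun x : vecT p => (O *m x : vecT p)) @^-1` B) = sigma B].

Definition SOfix p (theta0 : 'cV[R]_p) : set 'M[R]_p :=
  [set O | O *m O^T = 1%:M /\ \det O = 1 /\ O *m theta0 = theta0].

Definition is_haar p (theta0 : 'cV[R]_p) (H : probability (matT p) R) :=
  H (~` (SOfix theta0 : set (matT p))) = 0%E /\
  forall U : 'M[R]_p, SOfix theta0 U ->
    forall B : set (matT p), measurable B ->
      H ((fun O : matT p => (U *m O : matT p)) @^-1` B) = H B.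

Definition iid_FvML d (Omega : measurableType d) (P : probability Omega R)
    n p (X : 'I_n -> Omega -> vecT p) (sigma : {measure set (vecT p) -> \bar R})
    (theta : 'cV[R]_p) (k : R) :=
  [/\ forall i, measurable_fun setT (X i),
      forall B : 'I_n -> set (vecT p), (forall i, measurable (B i)) ->
        P (\bigcap_i (X i @^-1` B i)) = (\prod_i P (X i @^-1` B i))%E &
      forall i (B : set (vecT p)), measurable B ->
        P (X i @^-1` B) = (\int[sigma]_(x in B) (fvml_density theta k x)%:E)%E].

Definition umom (p : nat) (k : R) (g : R -> R) : R :=
  cpk p k * Rintegral lebesgue_measure [set` `[(-1)%R, 1%R]]
    (fun u => g u * (1 - u ^+ 2) `^ ((p%:R - 3) / 2) * expR (k * u)).
Definition e1 p k : R := umom p k id.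
Definition et2 p k : R := umom p k (fun u => (u - e1 p k) ^+ 2).

Definition Xbar n p (x : 'I_n -> 'cV[R]_p) : 'cV[R]_p :=
  n%:R^-1 *: \sum_(i < n) x i.

Definition Zstat n p (theta0 : 'cV[R]_p) (k : R) (x : 'I_n -> 'cV[R]_p) : R :=
  Num.sqrt n%:R * (dotv (Xbar x) theta0 - e1 p k) / Num.sqrt (et2 p k).

Definition Wstat n p (theta0 : 'cV[R]_p) (x : 'I_n -> 'cV[R]_p) : R :=
  n%:R * (p%:R - 1) * ((Xbar x)^T *m (1%:M - theta0 *m theta0^T) *m Xbar x) 0 0
  / (1 - n%:R^-1 * \sum_(i < n) dotv (x i) theta0 ^+ 2).

Definition Wtilde n p (theta0 : 'cV[R]_p) (x : 'I_n -> 'cV[R]_p) : R :=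
  (Wstat theta0 x - (p%:R - 1)) / Num.sqrt (2 * (p%:R - 1)).

(** Invariant log-likelihood ratio Lambda^{inv}_{theta,kappa'/theta0,kappa};
    H is the normalized Haar measure on SO_p(theta0). *)
Definition Lambda_inv n p (H : probability (matT p) R) (theta : 'cV[R]_p) (k' : R)
    (theta0 : 'cV[R]_p) (k : R) (x : 'I_n -> 'cV[R]_p) : R :=
  n%:R * ln (cpk p k' / cpk p k)
  + ln (Rintegral H setT
          (fun O : matT p => expR (n%:R * k' * dotv (Xbar x) (O^T *m theta))))
  - n%:R * k * dotv (Xbar x) theta0.

Definition Lambda_inv1 n p (H : probability (matT p) R) (theta theta0 : 'cV[R]_p)
    (k : R) (x : 'I_n -> 'cV[R]_p) : R :=
  Lambda_inv H theta k theta0 k x.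

End FvMLDefs.

(* Main.v *)
Require Import Defs.
From HB Require Import structures.
From mathcomp Require Import all_boot all_order all_algebra.
From mathcomp Require Import all_classical all_reals all_analysis.
From mathcomp Require Import measurable_realfun simple_functions measurable_fun_approximation.
From mathcomp Require Import zify ring lra.

(** Averaging over the rotations that fix [theta0] turns the invariant likelihood
    ratio into [- n kappa nu^2 |tau|^2 (Xbar . theta0) / 2] plus the logarithm of
    a 0F1 function of
      [n^2 kappa^2 nu^2 |tau|^2 (1 - nu^2 |tau|^2 / 4) |(I - theta0 theta0^T) Xbar|^2].
    The contiguity relations of 0F1 give the logarithm up to third order in
    [1 / p], and also [f2 := E (1 - U^2) = (p - 1) e1 / kappa], so that the
    argument is of the order that the rate of [nu] allows exactly when
    [n |(I - theta0 theta0^T) Xbar|^2 / f2] is close to one.  This statistic is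
    [1 + delta + epsilon], where [delta], the fluctuation of the empirical mean
    of [1 - U^2], has second moment O(1 / (n p)) by a bound of Turan type on
    [E (1 - U^2)^2 / f2^2], and [epsilon], the sum of the scalar products of
    distinct projected observations, has second moment O(1 / p).  Chebyshev's
    inequality then controls the error terms of the expansion. *)

(** The sequence kappa is arbitrary, so every estimate has to be uniform in kappa: instead of Bessel
    asymptotics, the proof uses exact identities and inequalities between 0F1 at parameters that
    differ by integers. With r = sqrt p, the rate of nu says a = O(r), where a = n kappa nu^2 e1
    |tau|^2 (1 - nu^2 |tau|^2 / 4). The linear term of the logarithm is a (1 + delta + epsilon) / 2:
    a epsilon is O_P(1) and gives the Watson term, a delta is O_P(n^(-1/2)) and disappears. The
    quadratic term leaves a^2 / (4 p) = O(1), and the cubic one is O(1 / r). No coordinates are put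
    on the sphere or on the rotation group. Invariance alone yields a two-step recursion for the
    moments of a linear form, and integration by parts yields the same recursion for the density on
    [-1, 1]; this is how [e1], an integral on the line, meets averages over the sphere. The
    normalising constant on the sphere is read off from total probability one. The observations lie
    on the sphere only almost surely, so an indicator of the sphere is built into the variables
    whose expectations are taken, which keeps them bounded. *)

Import Order.TTheory GRing.Theory Num.Theory.
Import numFieldNormedType.Exports HBNNSimple.
Set Implicit Arguments.
Unset Strict Implicit.
Unset Printing Implicit Defensive.
Local Open Scope classical_set_scope.
Local Open Scope ring_scope.

(** * The hypergeometric function 0F1 *)

Section Hypergeometric.
Variable R : realType.
Implicit Types (q k : nat) (s : R).

(** These are the coefficients of 0F1(; q/2; s/4) in powers of s. The scaling keeps the factors
    integral and makes [hyp q (k ^+ 2)] the average of exp (k u), where u is a coordinate of a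
    uniform point of the unit sphere of R^q. *)
Definition hyp_coef q k : R :=
  (\prod_(j < k) ((2 * j.+1)%:R * (q + 2 * j)%:R))^-1.

Definition hyp q s : R := limn (pseries (hyp_coef q) s).

Lemma hyp_coef0 q : hyp_coef q 0 = 1.
Proof. by rewrite /hyp_coef big_ord0 invr1. Qed.

Lemma hyp_coefS q k :
  hyp_coef q k.+1 = hyp_coef q k / ((2 * k.+1)%:R * (q + 2 * k)%:R).
Proof. by rewrite /hyp_coef big_ord_recr /= invfM. Qed.

Lemma hyp_coef_gt0 q k : (0 < q)%N -> 0 < hyp_coef q k.
Proof.
move=> q0; rewrite /hyp_coef invr_gt0; apply: prodr_gt0 => i _.
by rewrite mulr_gt0 // ltr0n ?muln_gt0 // addn_gt0 q0.
Qed.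

(** The factors [q + 2 * j] telescope when [q] grows by two. *)
Lemma hyp_coef_shift q k : (0 < q)%N ->
  hyp_coef q.+2 k = hyp_coef q k * q%:R / (q + 2 * k)%:R.
Proof.
move=> q0; have qn0 j : (q + j)%:R != 0 :> R by rewrite pnatr_eq0 addn_eq0; case: q q0.
elim: k => [|k IH].
  by rewrite !hyp_coef0 mul1r muln0 addn0 divff // -[q]addn0.
rewrite !hyp_coefS IH.
have -> : (q.+2 + 2 * k)%N = (q + 2 * k.+1)%N by rewrite mulnS; lia.
have h1 := qn0 (2 * k)%N; have h2 := qn0 (2 * k.+1)%N.
have h3 : (2 * k.+1)%:R != 0 :> R by rewrite pnatr_eq0.
move: (hyp_coef q k) (_%:R) (_%:R) (_%:R) (_%:R) h1 h2 h3 => *; field; by apply/and3P.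
Qed.

Lemma hyp_coefS_shift q k : (0 < q)%N ->
  hyp_coef q k.+1 = hyp_coef q.+2 k / ((2 * k.+1)%:R * q%:R).
Proof.
move=> q0; have qn0 j : (q + j)%:R != 0 :> R by rewrite pnatr_eq0 addn_eq0; case: q q0.
rewrite hyp_coefS hyp_coef_shift //.
have h1 := qn0 (2 * k)%N; have := qn0 0%N; rewrite addn0 => h2.
have h3 : (2 * k.+1)%:R != 0 :> R by rewrite pnatr_eq0.
move: (hyp_coef q k) (_%:R) (_%:R) (_%:R) h1 h2 h3 => *; field; by apply/and3P.
Qed.

Lemma hyp_coef_contiguous q k : (0 < q)%N ->
  hyp_coef q k.+1 =
    hyp_coef q.+2 k.+1 + hyp_coef q.+4 k / (q%:R * q.+2%:R).
Proof.
move=> q0; have qn0 j : (q + j)%:R != 0 :> R by rewrite pnatr_eq0 addn_eq0; case: q q0.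
rewrite (@hyp_coefS_shift q) // hyp_coefS (@hyp_coef_shift q.+2) //.
have -> : (q.+2 + 2 * k)%:R = q%:R + 2 + 2 * k%:R :> R by rewrite natrD natrM -addn2 natrD; ring.
have h1 := qn0 (2 * k.+1)%N.
have {}h1 : q%:R + 2 + 2 * k%:R != 0 :> R.
  by move: h1; congr (_ != 0); rewrite natrD natrM -(natr1 k); ring.
have := qn0 0%N; rewrite addn0 => h2.
have h3 : (2 * k.+1)%:R != 0 :> R by rewrite pnatr_eq0.
have h4 : q.+2%:R != 0 :> R by rewrite pnatr_eq0.
have E : (2 * k.+1)%:R = 2 * (k%:R + 1) :> R by rewrite natrM natr1.
have E' : q.+2%:R = q%:R + 2 :> R by rewrite -addn2 natrD.
rewrite !E !E' in h3 h4 *.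
have h5 : k%:R + 1 != 0 :> R by rewrite natr1 pnatr_eq0.
by field; rewrite h2 h4 h1 h5.
Qed.

(** Domination by the exponential series makes the radius of convergence infinite. *)
Lemma hyp_coef_le q k : (0 < q)%N -> hyp_coef q k <= k`!%:R^-1.
Proof.
move=> q0; elim: k => [|k IH]; first by rewrite hyp_coef0 fact0 invr1.
rewrite hyp_coefS factS [in leRHS]natrM [in leRHS]invfM mulrC.
apply: ler_pM => //.
  exact/ltW/hyp_coef_gt0.
rewrite -natrM lef_pV2 ?posrE ?ltr0n // ?ler_nat.
- by rewrite -mulnA mulnCA leq_pmulr // muln_gt0 addn_gt0 q0.
- by rewrite muln_gt0 addn_gt0 q0.
Qed.

Lemma is_cvg_hyp q s : (0 < q)%N -> cvgn (pseries (hyp_coef q) s).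
Proof.
move=> q0; apply: (@is_cvg_pseries_inside _ _ (`|s| + 1)); last first.
  by rewrite [ltRHS]ger0_norm ?addr_ge0 // ltrDl.
apply: (@series_le_cvg _ _ (exp_coeff (`|s| + 1))) => [n|n|n|].
- by rewrite mulr_ge0 ?exprn_ge0 ?addr_ge0 // ltW // hyp_coef_gt0.
- by rewrite exp_coeff_ge0 // addr_ge0.
- rewrite exp_coeffE; apply: ler_wpM2r; first by rewrite exprn_ge0 // addr_ge0.
  exact: hyp_coef_le.
- exact: is_cvg_series_exp_coeff.
Qed.

Lemma cvg_hyp q s : (0 < q)%N -> pseries (hyp_coef q) s @ \oo --> hyp q s.
Proof. by move=> q0; apply: is_cvg_hyp. Qed.

Lemma hyp0 q : (0 < q)%N -> hyp q 0 = 1.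
Proof.
move=> q0; rewrite /hyp; apply: lim_near_cst => //; near=> m.
rewrite /pseries /series /= -[m]prednK; last by near: m; exact: nbhs_infty_gt.
rewrite big_nat_recl //= hyp_coef0 expr0 mul1r big1 ?addr0 // => i _.
by rewrite expr0n mulr0.
Unshelve. all: by end_near. Qed.

(** For modified Bessel functions this is I_(v-1) = I_(v+1) + (2 v / x) I_v with v = q / 2 and s =
    x^2; it holds coefficient by coefficient. *)
Lemma hyp_contiguous q s : (0 < q)%N ->
  hyp q s = hyp q.+2 s + s / (q%:R * q.+2%:R) * hyp q.+4 s.
Proof.
move=> q0.
suff : pseries (hyp_coef q) s @ \oo -->
    hyp q.+2 s + s / (q%:R * q.+2%:R) * hyp q.+4 s.
  by move/(cvg_lim (@norm_hausdorff _ _)).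
(* The factor [s] raises the degree of the last series by one, so its partial sum of length n goes
   with those of length n + 1 of the others. *)
rewrite -(cvg_shiftS (pseries (hyp_coef q) s)).
have h2 : pseries (hyp_coef q.+2) s n.+1 @[n --> \oo] --> hyp q.+2 s.
  by rewrite (cvg_shiftS (pseries (hyp_coef q.+2) s)); exact: cvg_hyp.
have h4 : (s / (q%:R * q.+2%:R)) * pseries (hyp_coef q.+4) s n @[n --> \oo] -->
  s / (q%:R * q.+2%:R) * hyp q.+4 s.
  by apply: cvgMr; exact: cvg_hyp.
rewrite [X in X @ _ --> _](_ : _ = (fun n => pseries (hyp_coef q.+2) s n.+1
   + (s / (q%:R * q.+2%:R)) * pseries (hyp_coef q.+4) s n)); first exact: (cvgD h2 h4).
apply/funext => n; rewrite /= /pseries /series /= big_nat_recl // [in RHS]big_nat_recl //.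
rewrite !hyp_coef0 -addrA; congr (_ + _).
rewrite mulr_sumr -big_split /=; apply: eq_bigr => i _.
rewrite (hyp_coef_contiguous _ q0) exprS.
by ring.
Qed.

Lemma hyp_ge1 q s : (0 < q)%N -> 0 <= s -> 1 <= hyp q s.
Proof.
move=> q0 s0; apply: limr_ge; first exact: is_cvg_hyp.
near=> m; rewrite /pseries /series /= -[m]prednK; last by near: m; exact: nbhs_infty_gt.
rewrite big_nat_recl //= hyp_coef0 expr0 mul1r lerDl sumr_ge0 // => i _.
by rewrite mulr_ge0 ?exprn_ge0 // ltW // hyp_coef_gt0.
Unshelve. all: by end_near. Qed.

Lemma hyp_gt0 q s : (0 < q)%N -> 0 <= s -> 0 < hyp q s.
Proof. by move=> q0 s0; apply: lt_le_trans (hyp_ge1 q0 s0). Qed.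

Lemma pseries_diffs_hyp q : (0 < q)%N ->
  pseries_diffs (hyp_coef q) = (2 * q)%:R^-1 *: (hyp_coef q.+2 : R^nat).
Proof.
move=> q0; apply/funext => k; rewrite /pseries_diffs hyp_coefS_shift // fctE.
have h1 : q%:R != 0 :> R by rewrite pnatr_eq0 -lt0n.
have h3 : k.+1%:R != 0 :> R by rewrite pnatr_eq0.
rewrite !natrM /GRing.scale /=.
by field; rewrite h1 addrC natr1 h3.
Qed.

Lemma is_derive_hyp q s : (0 < q)%N ->
  is_derive s 1 (hyp q) ((2 * q)%:R^-1 * hyp q.+2 s).
Proof.
move=> q0.
have E c r x : (0 < r)%N ->
    pseries (c *: (hyp_coef r : R^nat)) x @ \oo --> c * hyp r x.
  move=> r0; rewrite (_ : pseries _ _ = (fun n => c * pseries (hyp_coef r) x n)).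
    by apply: cvgMr; exact: cvg_hyp.
  apply/funext => n; rewrite /pseries /series /GRing.scale /= /GRing.scale /=.
  by rewrite mulr_sumr; apply: eq_bigr => i _; rewrite mulrA.
have Hd x : pseries (pseries_diffs (hyp_coef q)) x @ \oo -->
    (2 * q)%:R^-1 * hyp q.+2 x.
  by rewrite pseries_diffs_hyp //; exact: E.
rewrite -(cvg_lim (@norm_hausdorff _ _) (Hd s)).
(* Termwise differentiation asks for convergence of the series and of its first two formal
   derivatives at a point beyond |s|. *)
apply: (@pseries_snd_diffs _ _ (`|s| + 1)).
- exact: is_cvg_hyp.
- by apply/cvg_ex; eexists; exact: Hd.
- rewrite pseries_diffs_hyp //.
  have -> : pseries_diffs ((2 * q)%:R^-1 *: (hyp_coef q.+2 : R^nat)) =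
     ((2 * q)%:R^-1 * (2 * q.+2)%:R^-1) *: (hyp_coef q.+4 : R^nat).
    rewrite -scalerA -(@pseries_diffs_hyp q.+2) //; apply/funext => n.
    by rewrite /pseries_diffs /GRing.scale /= /GRing.scale /= mulrCA.
  by apply/cvg_ex; eexists; exact: E.
by rewrite [ltRHS]ger0_norm ?addr_ge0 // ltrDl.
Qed.

Lemma hyp_anti q s : (0 < q)%N -> 0 <= s -> hyp q.+2 s <= hyp q s.
Proof.
move=> q0 s0; rewrite (hyp_contiguous s q0) lerDl mulr_ge0 //.
  by rewrite divr_ge0 // mulr_ge0.
exact/ltW/hyp_gt0.
Qed.

(** The coefficients satisfy c_(q+2)^2 <= c_q c_(q+4). The weighted arithmetic-geometric form with a
    free [l] is linear in them, so it can be summed over [k]. *)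
Lemma hyp_coef_logconvex q k (l : R) : (0 < q)%N -> 0 < l ->
  2 * hyp_coef q.+2 k <= l * hyp_coef q k + l^-1 * hyp_coef q.+4 k.
Proof.
move=> q0 l0; have c00 := hyp_coef_gt0 k q0.
have c10 : 0 < hyp_coef q.+2 k by exact: hyp_coef_gt0.
have c2c0 : hyp_coef q.+2 k ^+ 2 / hyp_coef q k <= hyp_coef q.+4 k.
  rewrite (@hyp_coef_shift q.+2) // expr2 -!mulrA; apply: ler_wpM2l; first exact: ltW.
  rewrite (@hyp_coef_shift q) // [hyp_coef q k * _]mulrC mulrAC mulfK ?gt_eqF //.
  have -> : (q.+2 + 2 * k)%:R = q%:R + 2 + 2 * k%:R :> R.
    by rewrite natrD natrM -addn2 natrD.
  have -> : q.+2%:R = q%:R + 2 :> R by rewrite -addn2 natrD.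
  rewrite natrD natrM; have : 0 < q%:R :> R by rewrite ltr0n.
  have : 0 <= k%:R :> R by [].
  move: (q%:R) (k%:R) => x y y0 x0.
  rewrite ler_pdivrMr; last by lra.
  rewrite mulrAC ler_pdivlMr; last by lra.
  by lra.
set c0 := hyp_coef q k in c00 c2c0 *; set c1 := hyp_coef q.+2 k in c10 c2c0 *.
apply: (@le_trans _ _ (l * c0 + l^-1 * (c1 ^+ 2 / c0))); last first.
  by rewrite lerD2l ler_wpM2l // invr_ge0 ltW.
rewrite -subr_ge0 (_ : _ - _ = (l * c0 - c1) ^+ 2 / (l * c0)).
  by rewrite divr_ge0 ?sqr_ge0 // mulr_ge0 // ltW.
by field; rewrite !gt_eqF.
Qed.

(** The summed linear inequality is used at the optimal weight [l], the ratio of the two functions,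
    where it becomes the product inequality. *)
Lemma hyp_logconvex q s : (0 < q)%N -> 0 <= s ->
  hyp q.+2 s ^+ 2 <= hyp q s * hyp q.+4 s.
Proof.
move=> q0 s0; have A0 := hyp_gt0 q0 s0.
have B0 : 0 < hyp q.+2 s by exact: hyp_gt0.
pose l := hyp q.+2 s / hyp q s; have l0 : 0 < l by exact: divr_gt0.
have : 2 * hyp q.+2 s <= l * hyp q s + l^-1 * hyp q.+4 s.
  have h0 : (fun n => l * pseries (hyp_coef q) s n) @ \oo --> l * hyp q s.
    by apply: cvgMr; exact: cvg_hyp.
  have h2 : (fun n => 2 * pseries (hyp_coef q.+2) s n) @ \oo --> 2 * hyp q.+2 s.
    by apply: cvgMr; exact: cvg_hyp.
  have h4 : (fun n => l^-1 * pseries (hyp_coef q.+4) s n) @ \oo --> l^-1 * hyp q.+4 s.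
    by apply: cvgMr; exact: cvg_hyp.
  have h : (fun n => l * pseries (hyp_coef q) s n + l^-1 * pseries (hyp_coef q.+4) s n)
      @ \oo --> l * hyp q s + l^-1 * hyp q.+4 s by exact: (cvgD h0 h4).
  refine (ler_cvg_to h2 h _); near=> n.
  rewrite /pseries /series /= !mulr_sumr -big_split /=; apply: ler_sum => i _.
  rewrite !mulrA -mulrDl ler_wpM2r ?exprn_ge0 //; exact: hyp_coef_logconvex.
rewrite /l divfK ?gt_eqF // mulr_natl mulr2n lerD2l invf_div.
by rewrite mulrAC ler_pdivlMr // expr2.
Unshelve. all: by end_near. Qed.

(** Contiguity is applied to the first factor on the left and to one factor of the square on the
    right. Since (1 + 4/q) / (q + 4) = 1/q, the constant makes the remaining terms comparable with
    equal coefficients, and they are ordered by log-convexity at [q.+2]. *)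
Lemma hyp_turan q s : (0 < q)%N -> 0 <= s ->
  hyp q s * hyp q.+4 s <= (1 + 4 / q%:R) * hyp q.+2 s ^+ 2.
Proof.
move=> q0 s0; have q0' : 0 < q%:R :> R by rewrite ltr0n.
have lc : hyp q.+4 s ^+ 2 <= hyp q.+2 s * hyp q.+4.+2 s by exact: hyp_logconvex.
have E2 := @hyp_contiguous q.+2 s isT.
rewrite (hyp_contiguous s q0) expr2 {3}E2.
have B0 : 0 < hyp q.+2 s by exact: hyp_gt0.
have C0 : 0 < hyp q.+4 s by exact: hyp_gt0.
have -> : q.+4%:R = q%:R + 4 :> R by rewrite -addn4 natrD.
have -> : q.+2%:R = q%:R + 2 :> R by rewrite -addn2 natrD.
move: (hyp q.+2 s) (hyp q.+4 s) (hyp q.+4.+2 s) (q%:R) q0' lc B0 C0 => B C D x x0 lc B0 C0.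
have -> : (1 + 4 / x) * (B * (C + s / ((x + 2) * (x + 4)) * D)) =
  (1 + 4 / x) * B * C + s / (x * (x + 2)) * (B * D).
  by field; rewrite !gt_eqF //; lra.
rewrite mulrDl -mulrA -expr2; apply: lerD.
  by rewrite -mulrA mulrDl mul1r lerDl !mulr_ge0 ?invr_ge0 // ltW.
by apply: ler_wpM2l => //; rewrite divr_ge0 // mulr_ge0 //; lra.
Qed.

(** By contiguity the ratio is 1 / (1 + x r') with r' the ratio at [q.+2]. From r' <= 1 comes the
    lower bound; the lower bound for r' itself, with x only decreased by the shift, gives the upper
    one. *)
Lemma hyp_ratio_bounds q s (x := s / (q%:R * q.+2%:R)) : (0 < q)%N -> 0 <= s ->
  1 - x <= hyp q.+2 s / hyp q s <= 1 - x + 2 * x ^+ 2.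
Proof.
have lower r : (0 < r)%N -> 0 <= s ->
    1 - s / (r%:R * r.+2%:R) <= hyp r.+2 s / hyp r s.
  move=> r0 s0; have A0 := hyp_gt0 r0 s0.
  rewrite ler_pdivlMr // {1}(hyp_contiguous s r0).
  have y0 : 0 <= s / (r%:R * r.+2%:R) by rewrite divr_ge0 ?mulr_ge0.
  have CB : hyp r.+4 s <= hyp r.+2 s by exact: hyp_anti.
  have C0 : 0 < hyp r.+4 s by exact: hyp_gt0.
  have B0 : 0 < hyp r.+2 s by exact: hyp_gt0.
  move: (s / _) (hyp r.+4 s) (hyp r.+2 s) y0 CB C0 B0 => y C B y0 CB C0 B0.
  have := mulr_ge0 (mulr_ge0 y0 y0) (ltW C0); nra.
move=> q0 s0; rewrite lower //=.
have A0 := hyp_gt0 q0 s0; have B0 : 0 < hyp q.+2 s by exact: hyp_gt0.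
have x0 : 0 <= x by rewrite divr_ge0 ?mulr_ge0.
have r'1 : hyp q.+4 s / hyp q.+2 s <= 1.
  by rewrite ler_pdivrMr // mul1r; exact: hyp_anti.
have r'x : 1 - x <= hyp q.+4 s / hyp q.+2 s.
  apply: le_trans (lower q.+2 isT s0); rewrite lerD2l lerN2 ler_wpM2l //.
  by rewrite lef_pV2 ?posrE ?mulr_gt0 ?ltr0n // -!natrM ler_nat leq_mul //; lia.
rewrite ler_pdivrMr // (hyp_contiguous s q0) -/x.
have r'0 : 0 < hyp q.+4 s / hyp q.+2 s by rewrite divr_gt0 //; exact: hyp_gt0.
have -> : hyp q.+4 s = hyp q.+4 s / hyp q.+2 s * hyp q.+2 s.
  by rewrite divfK // gt_eqF.
move: (x) (hyp q.+2 s) (hyp q.+4 s / _) r'0 r'x r'1 B0 x0 => y B r r0 rx r1 B0 y0.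
rewrite -subr_ge0 [X in _ <= X](_ : _ = B * ((1 - y + 2 * y ^+ 2) * (1 + y * r) - 1)); last by ring.
apply: mulr_ge0; first exact: ltW.
(* For y > 1 the claimed upper bound already exceeds 1; the inequality r >= 1 - y is informative
   only for y <= 1. *)
have [y1|y1] := leP y 1.
  have : (1 - y + 2 * y ^+ 2) * (1 + y * (1 - y)) <= (1 - y + 2 * y ^+ 2) * (1 + y * r).
    by apply: ler_wpM2l; nra.
  have : 0 <= y ^+ 2 * (y * (3 - 2 * y)) by rewrite !mulr_ge0 ?sqr_ge0 //; lra.
  nra.
have : 0 <= (1 - y + 2 * y ^+ 2 - 1) by nra.
have : 0 <= (1 - y + 2 * y ^+ 2) * (y * r) by rewrite !mulr_ge0 //; [nra|exact: ltW].
nra.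
Qed.

(** The derivative of ln (hyp q) is the ratio above divided by 2 q, so the ratio bounds are
    integrated from 0, where [hyp q] is 1. The error 2 x^2 / (2 q) with x = t / (q (q + 2))
    integrates to the cubic term. *)
Lemma ln_hyp_bounds q s : (0 < q)%N -> 0 <= s ->
  0 <= ln (hyp q s) - (s / (2 * q%:R) - s ^+ 2 / (4 * q%:R ^+ 2 * q.+2%:R))
    <= s ^+ 3 / (3 * q%:R ^+ 3 * q.+2%:R ^+ 2).
Proof.
move=> q0 s0; have q0' : 0 < q%:R :> R by rewrite ltr0n.
have q20' : 0 < q.+2%:R :> R by rewrite ltr0n.
pose h1 (t : R) := ln (hyp q t) - (t / (2 * q%:R) - t ^+ 2 / (4 * q%:R ^+ 2 * q.+2%:R)).
pose h2 (t : R) := t ^+ 3 / (3 * q%:R ^+ 3 * q.+2%:R ^+ 2) - h1 t.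
have d1 (t : R) : 0 <= t -> is_derive t 1 h1
    ((hyp q t)^-1 * ((2 * q)%:R^-1 * hyp q.+2 t)
       - ((2 * q%:R)^-1 - 2 * t / (4 * q%:R ^+ 2 * q.+2%:R))).
  move=> t0; have H := is_derive_hyp t q0; have G0 := hyp_gt0 q0 t0.
  have H' : is_derive t 1 (fun t => ln (hyp q t)) ((hyp q t)^-1 * ((2 * q)%:R^-1 * hyp q.+2 t)).
    have L := is_derive1_ln G0.
    exact: (@is_derive1_comp _ (@ln R) (hyp q) t _ _ L H).
  rewrite /h1; apply: is_deriveB.
  apply: trigger_derive; rewrite /GRing.scale /=; ring.
have d2 (t : R) : 0 <= t -> is_derive t 1 h2 (3 * t ^+ 2 / (3 * q%:R ^+ 3 * q.+2%:R ^+ 2)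
   - ((hyp q t)^-1 * ((2 * q)%:R^-1 * hyp q.+2 t)
       - ((2 * q%:R)^-1 - 2 * t / (4 * q%:R ^+ 2 * q.+2%:R)))).
  move=> t0; have H := d1 t t0.
  rewrite /h2; apply: is_deriveB.
  apply: trigger_derive; rewrite /GRing.scale /=; ring.
have mono (h : R -> R) (h' : R -> R) : (forall t : R, 0 <= t -> is_derive t 1 h (h' t)) ->
    (forall t : R, 0 <= t -> 0 <= h' t) -> h 0 <= h s.
  move=> dh h'0; apply: (@ger0_derive1_le_cc _ h 0 s) => //.
  - by move=> t; rewrite in_itv /= => /andP[/ltW t0 _]; have := dh t t0; case.
  - move=> t; rewrite in_itv /= => /andP[/ltW t0 _]; have := dh t t0 => H.
    by rewrite derive1E derive_val h'0.
  - apply: derivable_within_continuous => t; rewrite in_itv /= => /andP[t0 _].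
    by have := dh t t0; case.
  - by rewrite in_itv /= lexx.
  - by rewrite in_itv /= lexx andbT.
have h10 : h1 0 = 0.
  by rewrite /h1 hyp0 // ln1 !expr0n /= !mul0r subrr subrr.
have h20 : h2 0 = 0 by rewrite /h2 h10 expr0n /= mul0r subr0.
have E1 t : (hyp q t)^-1 * ((2 * q)%:R^-1 * hyp q.+2 t)
       - ((2 * q%:R)^-1 - 2 * t / (4 * q%:R ^+ 2 * q.+2%:R)) =
   (2 * q%:R)^-1 * (hyp q.+2 t / hyp q t - (1 - t / (q%:R * q.+2%:R))).
  rewrite natrM; move: (hyp q t)^-1 (hyp q.+2 t) (q%:R) (q.+2%:R) q0' q20' => g h x y x0 y0.
  by field; rewrite !gt_eqF.
apply/andP; split.
  rewrite -[X in X <= _]h10 -/(h1 s).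
  apply: (mono _ _ d1) => t t0; rewrite E1 mulr_ge0 ?invr_ge0 ?mulr_ge0 //.
  by rewrite subr_ge0; have /andP[] := hyp_ratio_bounds q0 t0.
rewrite -subr_ge0 -[X in X <= _]h20 -/(h1 s) -/(h2 s).
apply: (mono _ _ d2) => t t0; rewrite E1 subr_ge0.
have /andP[_] := hyp_ratio_bounds q0 t0.
rewrite -lerBlDl => /(ler_wpM2l (x := (2 * q%:R)^-1)) H.
apply: le_trans (H _) _; first by rewrite invr_ge0 mulr_ge0.
by rewrite le_eqVlt; apply/orP; left; apply/eqP; field; rewrite !gt_eqF.
Qed.

End Hypergeometric.

(** * Bounded measurable functions on a set of finite measure *)

Section Transfer.
Context d1 d2 d3 (T1 : measurableType d1) (T2 : measurableType d2)
  (S : measurableType d3) (R : realType).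
Variables (m1 : {measure set T1 -> \bar R}) (m2 : {measure set T2 -> \bar R}).
Variables (X1 : T1 -> S) (X2 : T2 -> S) (F1 : T1 -> R) (F2 : T2 -> R).
Hypotheses (mX1 : measurable_fun setT X1) (mX2 : measurable_fun setT X2).
Hypotheses (mF1 : measurable_fun setT F1) (mF2 : measurable_fun setT F2).
Hypotheses (F1_ge0 : forall x, 0 <= F1 x) (F2_ge0 : forall x, 0 <= F2 x).

Let lin d (T : measurableType d) (m : {measure set T -> \bar R}) (X : T -> S)
    (F : T -> R) (h : {nnsfun S >-> R}) :
  measurable_fun setT X -> measurable_fun setT F -> (forall x, 0 <= F x) ->
  (\int[m]_x ((h (X x))%:E * (F x)%:E) =
   \sum_(r \in range h) (r%:E * \int[m]_x ((\1_(h @^-1` [set r]) (X x))%:E * (F x)%:E)))%E.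
Proof.
move=> mX /measurable_EFinP mF F0.
have mI r : measurable_fun setT (fun x => (\1_(h @^-1` [set r]) (X x) : R)).
  by apply: measurableT_comp => //; exact: measurable_indic.
have E x : ((h (X x))%:E * (F x)%:E = \sum_(r \in range h)
   (r%:E * ((\1_(h @^-1` [set r]) (X x))%:E * (F x)%:E)))%E.
  rewrite (fimfunE h) -fsumEFin // ge0_mule_fsuml; last first.
    by move=> r; exact: nnfun_muleindic_ge0.
  by apply: eq_fsbigr => r _; rewrite EFinM muleA.
(* A negative level has an empty preimage, so every summand is nonnegative and the sum may be
   exchanged with the integral. *)
have r0 r : (\1_(h @^-1` [set r]) : S -> R) = cst 0 \/ 0 <= r.
  have [r0|r0] := leP 0 r; [by right | left].
  by rewrite preimage_nnfun0 // indic0.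
have t0 r x : (0 <= r%:E * ((\1_(h @^-1` [set r]) (X x))%:E * (F x)%:E))%E.
  have [->|h0] := r0 r; first by rewrite /cst mul0e mule0.
  by rewrite !mule_ge0 ?lee_fin.
under eq_integral do rewrite E.
rewrite ge0_integral_fsum //; last first.
  move=> r; apply: emeasurable_funM => //; apply: emeasurable_funM => //.
  exact/measurable_EFinP.
apply: eq_fsbigr => r _.
have [h0|h0] := r0 r.
  rewrite h0 /cst; under eq_integral do rewrite mul0e mule0.
  by under [in RHS]eq_integral do rewrite mul0e; rewrite !integral0 mule0.
rewrite ge0_integralZl //.
- by apply: emeasurable_funM => //; exact/measurable_EFinP.
- by move=> x _; rewrite mule_ge0 ?lee_fin.
Qed.

Let lim d (T : measurableType d) (m : {measure set T -> \bar R}) (X : T -> S)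
    (F : T -> R) (h : S -> \bar R) (mh : measurable_fun setT h) :
  measurable_fun setT X -> measurable_fun setT F -> (forall x, 0 <= F x) ->
  (forall y, 0 <= h y)%E ->
  (fun n => \int[m]_x ((nnsfun_approx measurableT mh n (X x))%:E * (F x)%:E))%E @ \oo -->
   (\int[m]_x (h (X x) * (F x)%:E))%E.
Proof.
move=> mX /measurable_EFinP mF F0 h0.
pose g n x := ((nnsfun_approx measurableT mh n (X x))%:E * (F x)%:E)%E.
have -> : (\int[m]_x (h (X x) * (F x)%:E) = \int[m]_x limn (g^~ x))%E.
  apply: eq_integral => x _; apply/esym/cvg_lim => //.
  apply: cvgeZr => //.
  exact: (@cvg_nnsfun_approx _ _ _ _ measurableT _ mh (fun y _ => h0 y) (X x) I).
apply: (@cvg_monotone_convergence _ _ _ m setT measurableT g).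
- move=> n; apply: emeasurable_funM => //; apply/measurable_EFinP.
  by apply: measurableT_comp => //; exact: measurable_funP.
- by move=> n x _; rewrite mule_ge0 ?lee_fin.
- move=> x _ n k nk; apply: lee_wpmul2r; rewrite lee_fin //.
  by have /lefP := nd_nnsfun_approx measurableT mh nk; exact.
Qed.

(** The weights let one statement serve three purposes: change of variables (both weights 1),
    passage to a density ([F2] is the density), and factorisation under independence ([F1] is the
    product of the other factors and [F2] its mean). *)
Lemma integral_transfer_ge0 :
  (forall B, measurable B -> (\int[m1]_x ((\1_B (X1 x))%:E * (F1 x)%:E) =
                             \int[m2]_x ((\1_B (X2 x))%:E * (F2 x)%:E))%E) ->
  forall h : S -> \bar R, measurable_fun setT h -> (forall y, 0 <= h y)%E ->
  (\int[m1]_x (h (X1 x) * (F1 x)%:E) = \int[m2]_x (h (X2 x) * (F2 x)%:E))%E.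
Proof.
move=> H h mh h0.
have L1 := @lim _ _ m1 _ _ _ mh mX1 mF1 F1_ge0 h0.
have L2 := @lim _ _ m2 _ _ _ mh mX2 mF2 F2_ge0 h0.
rewrite -(cvg_lim (@ereal_hausdorff _) L1) -(cvg_lim (@ereal_hausdorff _) L2).
congr (limn _).
apply/funext => n; rewrite !lin //; apply: eq_fsbigr => r _; rewrite H //.
Qed.

End Transfer.

Section TransferSigned.
Context d1 d2 d3 (T1 : measurableType d1) (T2 : measurableType d2)
  (S : measurableType d3) (R : realType).
Variables (m1 : {measure set T1 -> \bar R}) (m2 : {measure set T2 -> \bar R}).
Variables (X1 : T1 -> S) (X2 : T2 -> S).
Hypotheses (mX1 : measurable_fun setT X1) (mX2 : measurable_fun setT X2).

Lemma integral_transfer (h : S -> \bar R) :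
  (forall B, measurable B -> m1 (X1 @^-1` B) = m2 (X2 @^-1` B)) ->
  measurable_fun setT h ->
  (\int[m1]_x h (X1 x) = \int[m2]_x h (X2 x))%E.
Proof.
move=> H mh.
have HB B : measurable B -> (\int[m1]_x ((\1_B (X1 x))%:E * (cst 1 x)%:E) =
                             \int[m2]_x ((\1_B (X2 x))%:E * (cst 1 x)%:E))%E.
  move=> mB.
  under eq_integral do rewrite /cst mule1.
  under [in RHS]eq_integral do rewrite /cst mule1.
  rewrite (@integral_indic _ _ _ m1 setT measurableT (X1 @^-1` B)).
    rewrite (@integral_indic _ _ _ m2 setT measurableT (X2 @^-1` B)).
      by rewrite !setIT; exact: H.
    by rewrite -[X in measurable X]setTI; exact: mX2.
  by rewrite -[X in measurable X]setTI; exact: mX1.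
have P (g : S -> \bar R) : measurable_fun setT g -> (forall y, 0 <= g y)%E ->
    (\int[m1]_x g (X1 x) = \int[m2]_x g (X2 x))%E.
  move=> mg g0.
  have := @integral_transfer_ge0 _ _ _ _ _ _ _ m1 m2 X1 X2 (cst 1) (cst 1) mX1 mX2
    (@measurable_cst _ _ _ _ _ _) (@measurable_cst _ _ _ _ _ _)
    (fun _ => ler01) (fun _ => ler01) HB g mg g0.
  by under eq_integral do rewrite /cst mule1; move=> ->; under eq_integral do rewrite /cst mule1.
rewrite integralE [in RHS]integralE; congr (_ - _)%E.
  transitivity (\int[m1]_x (h^\+ (X1 x)))%E.
    by apply: eq_integral => x _; rewrite !funeposE.
  rewrite (P h^\+%E) //; last exact: measurable_funepos.
  by apply: eq_integral => x _; rewrite !funeposE.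
transitivity (\int[m1]_x (h^\- (X1 x)))%E.
  by apply: eq_integral => x _; rewrite !funenegE.
rewrite (P h^\-%E) //; last exact: measurable_funeneg.
by apply: eq_integral => x _; rewrite !funenegE.
Qed.

Lemma Rintegral_transfer (h : S -> R) :
  (forall B, measurable B -> m1 (X1 @^-1` B) = m2 (X2 @^-1` B)) ->
  measurable_fun setT h ->
  Rintegral m1 setT (h \o X1) = Rintegral m2 setT (h \o X2).
Proof.
move=> H /measurable_EFinP mh.
by rewrite /Rintegral (integral_transfer H mh).
Qed.

End TransferSigned.

Section BoundedMeasurable.
Context d (T : measurableType d) (R : realType).
Variables (mu : {measure set T -> \bar R}) (D : set T).
Hypotheses (mD : measurable D) (muD : (mu D < +oo)%E).
Implicit Types f g h : T -> R.

(** Over a finite measure this implies integrability, and the class is stable under ring operations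
    and the exponential. Integrability is thus checked by following the shape of the integrand. *)
Definition bddmeas f :=
  measurable_fun D f /\ exists M : R, forall x, D x -> `|f x| <= M.

Lemma bddmeas_cst (c : R) : bddmeas (cst c).
Proof. by split; [exact: measurable_cst | exists `|c|]. Qed.

Lemma bddmeasD f g : bddmeas f -> bddmeas g -> bddmeas (fun x => f x + g x).
Proof.
move=> [mf [M Mf]] [mg [N Ng]]; split; first exact: measurable_funD.
exists (M + N) => x Dx; apply: le_trans (ler_normD _ _) _.
by apply: lerD; [exact: Mf | exact: Ng].
Qed.

Lemma bddmeasM f g : bddmeas f -> bddmeas g -> bddmeas (fun x => f x * g x).
Proof.
move=> [mf [M Mf]] [mg [N Ng]]; split; first exact: measurable_funM.
by exists (M * N) => x Dx; rewrite normrM ler_pM // ?Mf ?Ng.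
Qed.

Lemma bddmeasZ c f : bddmeas f -> bddmeas (fun x => c * f x).
Proof. by move=> bf; apply: (bddmeasM (bddmeas_cst c)). Qed.

Lemma bddmeasB f g : bddmeas f -> bddmeas g -> bddmeas (fun x => f x - g x).
Proof.
move=> bf bg; rewrite (_ : (fun x => _) = (fun x => f x + (-1) * g x)).
  by apply: bddmeasD => //; exact: bddmeasZ.
by apply/funext => x; rewrite mulN1r.
Qed.

Lemma bddmeasX f n : bddmeas f -> bddmeas (fun x => f x ^+ n).
Proof.
move=> bf; elim: n => [|n IH]; first exact: (bddmeas_cst 1).
rewrite (_ : (fun x => _) = (fun x => f x * f x ^+ n)); first exact: bddmeasM.
by apply/funext => x; rewrite exprS.
Qed.

Lemma bddmeas_sum I (s : seq I) (P : pred I) (F : I -> T -> R) :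
  (forall i, bddmeas (F i)) -> bddmeas (fun x => \sum_(i <- s | P i) F i x).
Proof.
move=> bF; elim: s => [|i s IH].
  rewrite (_ : (fun x => _) = cst 0); first exact: bddmeas_cst.
  by apply/funext => x; rewrite big_nil.
case Pi : (P i); last first.
  by rewrite (_ : (fun x => _) = (fun x => \sum_(j <- s | P j) F j x)) //;
    apply/funext => x; rewrite big_cons Pi.
rewrite (_ : (fun x => _) = (fun x => F i x + \sum_(j <- s | P j) F j x)).
  exact: bddmeasD.
by apply/funext => x; rewrite big_cons Pi.
Qed.

Lemma bddmeas_prod I (s : seq I) (P : pred I) (F : I -> T -> R) :
  (forall i, bddmeas (F i)) -> bddmeas (fun x => \prod_(i <- s | P i) F i x).
Proof.
move=> bF; elim: s => [|i s IH].
  rewrite (_ : (fun x => _) = cst 1); first exact: bddmeas_cst.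
  by apply/funext => x; rewrite big_nil.
case Pi : (P i); last first.
  by rewrite (_ : (fun x => _) = (fun x => \prod_(j <- s | P j) F j x)) //;
    apply/funext => x; rewrite big_cons Pi.
rewrite (_ : (fun x => _) = (fun x => F i x * \prod_(j <- s | P j) F j x)).
  exact: bddmeasM.
by apply/funext => x; rewrite big_cons Pi.
Qed.

Lemma bddmeas_expR f : bddmeas f -> bddmeas (fun x => expR (f x)).
Proof.
move=> [mf [M Mf]]; split; first exact: measurableT_comp.
exists (expR M) => x Dx; rewrite ger0_norm ?expR_ge0 // ler_expR.
by apply: le_trans (ler_norm _) _; exact: Mf.
Qed.

Lemma bddmeas_integrable f : bddmeas f -> mu.-integrable D (EFin \o f).
Proof.
move=> [mf [M Mf]]; apply: measurable_bounded_integrable => //.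
exists M; split; first exact: num_real.
by move=> y My x Dx; apply: le_trans (Mf x Dx) (ltW My).
Qed.

Lemma bddmeas_RintegralD f g : bddmeas f -> bddmeas g ->
  Rintegral mu D (fun x => f x + g x) = Rintegral mu D f + Rintegral mu D g.
Proof. by move=> bf bg; apply: RintegralD => //; exact: bddmeas_integrable. Qed.

Lemma bddmeas_RintegralZ c f : bddmeas f ->
  Rintegral mu D (fun x => c * f x) = c * Rintegral mu D f.
Proof. by move=> bf; apply: RintegralZl => //; exact: bddmeas_integrable. Qed.

Lemma bddmeas_RintegralB f g : bddmeas f -> bddmeas g ->
  Rintegral mu D (fun x => f x - g x) = Rintegral mu D f - Rintegral mu D g.
Proof. by move=> bf bg; apply: RintegralB => //; exact: bddmeas_integrable. Qed.

Lemma bddmeas_Rintegral_sum I (s : seq I) (P : pred I) (F : I -> T -> R) :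
  (forall i, bddmeas (F i)) ->
  Rintegral mu D (fun x => \sum_(i <- s | P i) F i x) =
  \sum_(i <- s | P i) Rintegral mu D (F i).
Proof.
move=> bF; elim: s => [|i s IH].
  rewrite big_nil -[RHS](mul0r (fine (mu D))) -Rintegral_cst //.
  by congr Rintegral; apply/funext => x; rewrite big_nil.
rewrite big_cons; case: ifPn => Pi.
  rewrite -IH -bddmeas_RintegralD //; last exact: bddmeas_sum.
  by congr Rintegral; apply/funext => x; rewrite big_cons Pi.
rewrite -IH; congr Rintegral; apply/funext => x.
by rewrite big_cons (negbTE Pi).
Qed.

Lemma bddmeas_le_Rintegral f g : bddmeas f -> bddmeas g ->
  (forall x, D x -> f x <= g x) -> Rintegral mu D f <= Rintegral mu D g.
Proof. by move=> bf bg; apply: le_Rintegral => //; exact: bddmeas_integrable. Qed.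

Lemma exp_series_norm_le (x : R) n : `|series (exp_coeff x) n| <= expR `|x|.
Proof.
apply: le_trans (ler_norm_sum _ _ _) _.
rewrite (_ : \sum_(_ <= i < _) _ = series (exp_coeff `|x|) n).
  apply: nondecreasing_cvgn_le; last exact: is_cvg_series_exp_coeff.
  apply/nondecreasing_series => i _ _; exact: exp_coeff_ge0.
by rewrite /series /=; apply: eq_bigr => i _; rewrite /exp_coeff /= normrM normrX normfV normr_nat.
Qed.

(** Dominated convergence with the constant bound [M * expR N]. It reduces exponential integrals to
    moments. *)
Lemma Rintegral_expR_series h g : bddmeas h -> bddmeas g ->
  series (fun j => Rintegral mu D (fun x => h x * g x ^+ j) / j`!%:R) @ \oo -->
  Rintegral mu D (fun x => h x * expR (g x)).
Proof.
move=> bh bg; have [_ [M Mh]] := bh; have [_ [N Ng]] := bg.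
pose F n x := h x * series (exp_coeff (g x)) n.
have FE n : F n = (fun x => \sum_(j <- index_iota 0 n) j`!%:R^-1 * (h x * g x ^+ j)).
  apply/funext => x; rewrite /F /series /= mulr_sumr; apply: eq_bigr => j _.
  by rewrite /exp_coeff /= mulrA mulrC.
have bt j : bddmeas (fun x => j`!%:R^-1 * (h x * g x ^+ j)).
  by apply: bddmeasZ; apply: bddmeasM => //; exact: bddmeasX.
have bF n : bddmeas (F n) by rewrite FE; exact: bddmeas_sum.
have be : bddmeas (fun x => h x * expR (g x)).
  by apply: bddmeasM => //; exact: bddmeas_expR.
rewrite (_ : series _ = (fun n => Rintegral mu D (F n))); last first.
  apply/funext => n; rewrite FE bddmeas_Rintegral_sum //.
  rewrite /series /=; apply: eq_bigr => j _; rewrite bddmeas_RintegralZ 1?mulrC //.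
  by apply: bddmeasM => //; exact: bddmeasX.
have cM x : D x -> (fun n => F n x) @ \oo --> h x * expR (g x).
  by move=> Dx; apply: cvgMr; exact: is_cvg_series_exp_coeff.
have := @dominated_cvg _ _ _ mu D mD (fun n => EFin \o F n)
  (EFin \o (fun x => h x * expR (g x))) (cst (M * expR N)%:E).
have H0 n : measurable_fun D (EFin \o F n) by apply/measurable_EFinP; case: (bF n).
move=> /(_ H0).
have i1 : mu.-integrable D (cst (M * expR N)%:E).
  exact: (bddmeas_integrable (bddmeas_cst (M * expR N))).
have H1 : forall x, D x ->
   (EFin \o F n) x @[n --> \oo] --> (EFin \o (fun x => h x * expR (g x))) x.
  by move=> x Dx; apply: cvg_EFin; [near=> n | exact: cM].
have H2 : forall n x, D x -> (`|(EFin \o F n) x| <= cst (M * expR N)%:E x)%E.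
  move=> n x Dx; rewrite /= lee_fin normrM; apply: ler_pM => //; first exact: Mh.
  by apply: le_trans (exp_series_norm_le _ _) _; rewrite ler_expR; exact: Ng.
move=> /(_ H1 (fun _ _ => isT) i1 H2) H.
have fin f : bddmeas f -> (\int[mu]_(x in D) (EFin \o f) x)%E \is a fin_num.
  by move=> bf; apply: integrable_fin_num => //; exact: bddmeas_integrable.
apply: (@fine_cvg _ _ _ _ (fun n => \int[mu]_(x in D) (EFin \o F n) x)%E).
by rewrite /Rintegral fineK //; exact: (fin _ be).
Unshelve. all: by end_near. Qed.

End BoundedMeasurable.

(** The surface and Haar measures live on whole vector and matrix spaces, whereas boundedness holds
    only on the sphere and on the group; this restricts the domain. *)
Lemma Rintegral_conull d (T : measurableType d) (R : realType)
    (mu : {measure set T -> \bar R}) (D : set T) (f : T -> R) :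
  measurable D -> mu (~` D) = 0%E -> measurable_fun setT f ->
  Rintegral mu setT f = Rintegral mu D f.
Proof.
move=> mD D0 /measurable_EFinP mf; rewrite /Rintegral; congr fine.
have mC : measurable (~` D) by exact: measurableC.
rewrite integralE [in RHS]integralE; congr (_ - _)%E.
  rewrite (ge0_negligible_integral (N := ~` D)) ?setDE ?setCK ?setTI //.
  exact: measurable_funepos.
rewrite (ge0_negligible_integral (N := ~` D)) ?setDE ?setCK ?setTI //.
exact: measurable_funeneg.
Qed.

(** * Independence *)

Section Independence.
Context d d' (Omega : measurableType d) (S : measurableType d') (R : realType).
Variables (P : probability Omega R) (n : nat) (X : 'I_n -> Omega -> S).
Hypothesis mX : forall i, measurable_fun setT (X i).
Hypothesis indX : forall B : 'I_n -> set S, (forall i, measurable (B i)) ->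
  P (\bigcap_i (X i @^-1` B i)) = (\prod_i P (X i @^-1` B i))%E.
Implicit Types (h : 'I_n -> S -> R) (g : S -> R) (i : 'I_n).

Let E (f : Omega -> R) := Rintegral P setT f.
Let upd h i0 g i := if i == i0 then g else h i.
Let product_rule h :=
  E (fun w => \prod_i h i (X i w)) = \prod_i E (h i \o X i).
Let bm (g : S -> R) := bddmeas setT g.

Let PT : (P setT < +oo)%E. Proof. by rewrite probability_setT ltry. Qed.

Let bmX g i : bm g -> bddmeas setT (g \o X i).
Proof.
move=> [mg [M Mg]]; split; first exact: measurableT_comp.
by exists M => w _; exact: Mg.
Qed.

Let bm_upd h i0 g : (forall i, bm (h i)) -> bm g -> forall i, bm (upd h i0 g i).
Proof. by move=> bh bg i; rewrite /upd; case: ifP. Qed.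

(** Isolating one factor turns the product rule into an equality of two integrals of [g] against
    different weights, so it can be extended in [g] alone. *)
Let product_rule_upd h i0 g : product_rule (upd h i0 g) <->
  E (fun w => g (X i0 w) * \prod_(i | i != i0) h i (X i w)) =
  E (g \o X i0) * \prod_(i | i != i0) E (h i \o X i).
Proof.
rewrite /product_rule.
rewrite (_ : (fun w => \prod_i _) =
    (fun w => g (X i0 w) * \prod_(i | i != i0) h i (X i w))).
  rewrite (bigD1 i0) //= {1}/upd eqxx.
  by rewrite (eq_bigr (fun i => E (h i \o X i))) // => i ii0; rewrite /upd (negbTE ii0).
apply/funext => w; rewrite (bigD1 i0) //= {1}/upd eqxx; congr (_ * _).
by apply: eq_bigr => i ii0; rewrite /upd (negbTE ii0).
Qed.

Let updK h i0 : upd h i0 (h i0) = h.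
Proof. by apply/funext => i; rewrite /upd; case: eqP => [->|]. Qed.

Let brest h i0 : (forall i, bm (h i)) ->
  bddmeas setT (fun w => \prod_(i | i != i0) h i (X i w)).
Proof. by move=> bh; apply: bddmeas_prod => i; exact: bmX. Qed.

Let EZr f c : bddmeas setT f -> E f * c = E (fun w => f w * c).
Proof.
move=> bf; rewrite mulrC -(bddmeas_RintegralZ measurableT PT) //.
by congr Rintegral; apply/funext => w; rewrite mulrC.
Qed.

Let bm_indic (B : set S) : measurable B -> bm (\1_B).
Proof.
move=> mB; split; first exact: measurable_indic.
by exists 1 => x _; rewrite indicE; case: (_ \in _); rewrite ?normr1 ?normr0.
Qed.

Let product_rule_indic h :
  (forall i, exists2 B, measurable B & h i = \1_B) -> product_rule h.
Proof.
move=> hB; have [B BP] : {B : 'I_n -> set S & forall i, measurable (B i) /\ h i = \1_(B i)}.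
  apply: (@choice _ _ (fun i B => measurable B /\ h i = \1_B)) => i.
  by have [B mB hE] := hB i; exists B.
have mXB i : measurable (X i @^-1` B i).
  by rewrite -[X in measurable X]setTI; apply: mX => //; exact: (BP i).1.
have EI i : E (h i \o X i) = fine (P (X i @^-1` B i)).
  rewrite /E /Rintegral (BP i).2.
  by rewrite (@integral_indic _ _ _ P setT measurableT (X i @^-1` B i)) // setIT.
rewrite /product_rule; under [in RHS]eq_bigr do rewrite EI.
rewrite (_ : (fun w => _) = \1_(\bigcap_i (X i @^-1` B i))).
  have mI : measurable (\bigcap_i (X i @^-1` B i)).
    exact: fin_bigcap_measurable.
  rewrite /E /Rintegral integral_indic // setIT.
  have mB i : measurable (B i) by case: (BP i).
  rewrite -[RHS]/(fine (\prod_i fine (P (X i @^-1` B i)))%:E); congr fine.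
  apply: etrans (indX mB) _; elim/big_rec2: _ => // i y x _ ->.
  by rewrite EFinM fineK ?fin_num_measure.
apply/funext => w; rewrite indicE.
case: (boolP (w \in _)) => [/set_mem wB|wB].
  rewrite big1 // => i _; rewrite (BP i).2 indicE.
  by rewrite mem_set //; exact: (wB i I).
have [i wi] : exists i, ~ B i (X i w).
  apply/existsNP => H; move/negP: wB; apply; apply/mem_set => i _; exact: H.
rewrite (bigD1 i) //= (BP i).2 indicE memNset // mul0r //.
Qed.

(** Induction on the number [m] of coordinates freed from being indicators. Freeing one more keeps
    the other factors fixed; both sides then agree on indicators by induction, hence on nonnegative
    functions by transfer. *)
Let product_rule_ge0 m h : (forall i, bm (h i)) -> (forall i x, 0 <= h i x) ->
  (forall i, (m <= i)%N -> exists2 B, measurable B & h i = \1_B) -> product_rule h.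
Proof.
elim: m h => [|m IH] h bh h0 hB; first by apply: product_rule_indic => i; exact: hB.
have [nm|mn] := leqP n m.
  by apply: IH => // i mi; have := ltn_ord i; rewrite ltnNge (leq_trans nm mi).
pose i0 := Ordinal mn.
rewrite -(updK h i0); apply/product_rule_upd.
set F1 := fun w => \prod_(i | i != i0) h i (X i w).
set c := \prod_(i | i != i0) E (h i \o X i).
have bF1 : bddmeas setT F1 by exact: brest.
have F10 w : 0 <= F1 w by apply: prodr_ge0.
have c0 : 0 <= c by apply: prodr_ge0 => i _; apply: Rintegral_ge0 => w _; exact: h0.
have fin f : bddmeas setT f -> (\int[P]_x (f x)%:E)%E \is a fin_num.
  by move=> bf; apply: integrable_fin_num => //; exact: bddmeas_integrable.
have := @integral_transfer_ge0 _ _ _ _ _ _ _ P P (X i0) (X i0) F1 (cst c) (mX i0) (mX i0)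
   bF1.1 (measurable_cst _) F10 (fun _ => c0) _ (EFin \o h i0) _ _.
move=> H.
have -> : E (h i0 \o X i0) * c = E (fun w => h i0 (X i0 w) * c).
  by rewrite EZr //; exact: bmX.
rewrite /E /Rintegral; congr fine; apply: H.
- move=> B mB.
  have bB : bm (\1_B) by exact: bm_indic.
  have /product_rule_upd : product_rule (upd h i0 (\1_B)).
    apply: IH.
    + exact: bm_upd.
    + by move=> i x; rewrite /upd; case: ifP => // _; rewrite indicE.
    + move=> i mi; rewrite /upd; case: eqP => [_|ii0]; first by exists B.
      apply: hB; rewrite ltn_neqAle mi andbT; apply/eqP => mi'; apply: ii0.
      exact/val_inj.
  rewrite -/F1 -/c.
  have -> : E (\1_B \o X i0) * c = E (fun w => \1_B (X i0 w) * c).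
    by rewrite EZr //; exact/bmX/bm_indic.
  rewrite /E /Rintegral => Hf.
  have b1 : bddmeas setT (fun w => \1_B (X i0 w) * F1 w) by apply: bddmeasM => //; exact: bmX.
  have b2 : bddmeas setT (fun w => \1_B (X i0 w) * c).
    by apply: bddmeasM; [exact: bmX | exact: bddmeas_cst].
  have := congr1 EFin Hf; rewrite !fineK ?(fin _ b1) ?(fin _ b2) //.
- by apply/measurable_EFinP; exact: (bh i0).1.
- by move=> y; rewrite lee_fin.
Qed.

(** A second induction of the same kind frees the coordinates from nonnegativity. *)
Lemma expectation_prod h : (forall i, bm (h i)) -> product_rule h.
Proof.
suff T m k : (forall i, bm (k i)) -> (forall i, (m <= i)%N -> forall x, 0 <= k i x) ->
    product_rule k.
  by move=> bh; apply: (T n) => // i ni; have := ltn_ord i; rewrite ltnNge ni.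
elim: m k => {h} [|m IH] h bh h0.
  apply: (@product_rule_ge0 n) => // [i x|i ni]; first exact: h0.
  by have := ltn_ord i; rewrite ltnNge ni.
have [nm|mn] := leqP n m.
  by apply: IH => // i mi; have := ltn_ord i; rewrite ltnNge (leq_trans nm mi).
pose i0 := Ordinal mn.
rewrite -(updK h i0); apply/product_rule_upd.
set F1 := fun w => \prod_(i | i != i0) h i (X i w).
set c := \prod_(i | i != i0) E (h i \o X i).
have bF1 : bddmeas setT F1 by exact: brest.
have step g : bm g -> (forall x, 0 <= g x) -> E (fun w => g (X i0 w) * F1 w) = E (g \o X i0) * c.
  move=> bg g0; apply/product_rule_upd; apply: IH.
    exact: bm_upd.
  move=> i mi x; rewrite /upd; case: eqP => [_|ii0]; first exact: g0.
  apply: h0; rewrite ltn_neqAle mi andbT; apply/eqP => mi'; apply: ii0.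
  exact/val_inj.
(* Positive and negative parts of the factor being freed; the rule holds for each by induction and
   is linear in that factor. *)
pose gp (x : S) := Num.max (h i0 x) 0; pose gn (x : S) := Num.max (- h i0 x) 0.
have [mh [M Mh]] := bh i0.
have bgp : bm gp.
  split; first by apply: measurable_maxr.
  exists M => x _; rewrite ger0_norm ?le_max ?lexx ?orbT // ge_max.
  by rewrite (le_trans (ler_norm _) (Mh x I)) (le_trans _ (Mh x I)).
have bgn : bm gn.
  split; first by apply: measurable_maxr => //; exact: measurableT_comp.
  exists M => x _; rewrite ger0_norm ?le_max ?lexx ?orbT // ge_max.
  apply/andP; split; last exact: le_trans (normr_ge0 _) (Mh x I).
  by apply: le_trans (ler_norm _) _; rewrite normrN; exact: Mh.
have hE x : h i0 x = gp x - gn x.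
  by rewrite /gp /gn; case: (leP (h i0 x) 0); case: (leP (- h i0 x) 0); lra.
have -> : (fun w => h i0 (X i0 w) * F1 w) =
   (fun w => gp (X i0 w) * F1 w - gn (X i0 w) * F1 w).
  by apply/funext => w; rewrite hE mulrBl.
have -> : h i0 \o X i0 = (fun w => gp (X i0 w) - gn (X i0 w)).
  by apply/funext => w /=; rewrite hE.
have bp := bmX i0 bgp; have bn := bmX i0 bgn.
rewrite /E (bddmeas_RintegralB measurableT PT (bddmeasM bp bF1) (bddmeasM bn bF1)).
rewrite (bddmeas_RintegralB measurableT PT bp bn) mulrBl.
by congr (_ - _); apply: step => // x; rewrite le_max lexx orbT.
Qed.

End Independence.

(** * Inner products, reflections and rotations *)

Section Vectors.
Variable R : realType.

Lemma dotvE p (x y : 'cV[R]_p) : dotv x y = \sum_i x i 0 * y i 0.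
Proof. by rewrite /dotv mxE; apply: eq_bigr => i _; rewrite mxE. Qed.

Lemma dotvC p (x y : 'cV[R]_p) : dotv x y = dotv y x.
Proof. by rewrite !dotvE; apply: eq_bigr => i _; rewrite mulrC. Qed.

Lemma dotvDr p (x y z : 'cV[R]_p) : dotv x (y + z) = dotv x y + dotv x z.
Proof. by rewrite /dotv mulmxDr mxE. Qed.

Lemma dotvDl p (x y z : 'cV[R]_p) : dotv (x + y) z = dotv x z + dotv y z.
Proof. by rewrite dotvC dotvDr !(dotvC z). Qed.

Lemma dotvZr p c (x y : 'cV[R]_p) : dotv x (c *: y) = c * dotv x y.
Proof. by rewrite /dotv -scalemxAr mxE. Qed.

Lemma dotvZl p c (x y : 'cV[R]_p) : dotv (c *: x) y = c * dotv x y.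
Proof. by rewrite dotvC dotvZr dotvC. Qed.

Lemma dotvNr p (x y : 'cV[R]_p) : dotv x (- y) = - dotv x y.
Proof. by rewrite -scaleN1r dotvZr mulN1r. Qed.

Lemma dotvNl p (x y : 'cV[R]_p) : dotv (- x) y = - dotv x y.
Proof. by rewrite dotvC dotvNr dotvC. Qed.

Lemma dotvBr p (x y z : 'cV[R]_p) : dotv x (y - z) = dotv x y - dotv x z.
Proof. by rewrite dotvDr dotvNr. Qed.

Lemma dotvBl p (x y z : 'cV[R]_p) : dotv (x - y) z = dotv x z - dotv y z.
Proof. by rewrite dotvDl dotvNl. Qed.

Lemma dotv_suml p I (s : seq I) (P : pred I) (F : I -> 'cV[R]_p) y :
  dotv (\sum_(i <- s | P i) F i) y = \sum_(i <- s | P i) dotv (F i) y.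
Proof.
elim/big_rec2: _ => [|i a b _ <-]; last by rewrite dotvDl.
by rewrite -(scale0r 0) dotvZl mul0r.
Qed.

Lemma dotv_mulmx p (A : 'M[R]_p) x y : dotv (A *m x) y = dotv x (A^T *m y).
Proof. by rewrite /dotv trmx_mul mulmxA. Qed.

Lemma dotv_ge0 p (x : 'cV[R]_p) : 0 <= dotv x x.
Proof. by rewrite dotvE sumr_ge0 // => i _; rewrite -expr2 sqr_ge0. Qed.

Lemma dotv_eq0 p (x : 'cV[R]_p) : (dotv x x == 0) = (x == 0).
Proof.
apply/idP/eqP => [|->]; last by rewrite -(scale0r 0) dotvZl mul0r.
rewrite dotvE psumr_eq0 => [/allP H|i _]; last by rewrite -expr2 sqr_ge0.
apply/colP => i; rewrite mxE; apply/eqP.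
by have := H i (mem_index_enum i); rewrite -expr2 sqrf_eq0.
Qed.

Lemma sqr_enorm p (x : 'cV[R]_p) : enorm x ^+ 2 = dotv x x.
Proof. by rewrite /enorm sqr_sqrtr // dotv_ge0. Qed.

Lemma sphereP p (x : 'cV[R]_p) : sphere x <-> dotv x x = 1.
Proof.
rewrite /sphere /= -sqr_enorm; split => [->|/eqP]; first by rewrite expr1n.
by rewrite sqrp_eq1 ?sqrtr_ge0 // => /eqP.
Qed.

Lemma sum_sqr_dotv_delta p (x : 'cV[R]_p) :
  \sum_i dotv x (delta_mx i 0) ^+ 2 = dotv x x.
Proof.
rewrite [RHS]dotvE; apply: eq_bigr => i _; rewrite -expr2; congr (_ ^+ 2).
rewrite dotvE (bigD1 i) //= big1 => [|j ji]; last by rewrite mxE (negbTE ji) mulr0.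
by rewrite addr0 mxE !eqxx mulr1.
Qed.

Definition reflection p (u : 'cV[R]_p) : 'M[R]_p :=
  1%:M - (2 / dotv u u) *: (u *m u^T).

Lemma reflection_mul p (u x : 'cV[R]_p) :
  reflection u *m x = x - (2 * dotv u x / dotv u u) *: u.
Proof.
rewrite /reflection mulmxBl mul1mx -scalemxAl -mulmxA; congr (_ - _).
have -> : u^T *m x = (dotv u x)%:M by rewrite /dotv [LHS]mx11_scalar.
by rewrite mul_mx_scalar scalerA mulrAC.
Qed.

Lemma tr_reflection p (u : 'cV[R]_p) : (reflection u)^T = reflection u.
Proof. by rewrite /reflection linearB /= trmx1 linearZ /= trmx_mul trmxK. Qed.

Lemma reflectionK p (u : 'cV[R]_p) : u != 0 -> reflection u *m reflection u = 1%:M.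
Proof.
rewrite -dotv_eq0 => u0.
have H (x : 'cV[R]_p) : reflection u *m (reflection u *m x) = x.
  rewrite !reflection_mul dotvBr dotvZr divfK //.
  have -> : 2 * (dotv u x - 2 * dotv u x) / dotv u u = - (2 * dotv u x / dotv u u).
    by field.
  by rewrite scaleNr opprK subrK.
apply/matrixP => i j; have := H (delta_mx j 0).
rewrite mulmxA -colE => /colP/(_ i); rewrite [LHS]mxE => ->.
by rewrite !mxE eqxx andbT.
Qed.

(** One block matrix is factored in two ways, which gives det (1 - u v) = 1 - v u for a column [u]
    and a row [v]. *)
Lemma det_reflection p (u : 'cV[R]_p) : u != 0 -> \det (reflection u) = -1.
Proof.
rewrite -dotv_eq0 => u0.
pose v := (2 / dotv u u) *: u^T.
have E1 : block_mx (1%:M : 'M[R]_1) v u 1%:M =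
    block_mx 1%:M 0 u 1%:M *m block_mx 1%:M v 0 (reflection u).
  rewrite mulmx_block !mul1mx !mulmx1 ?mul0mx ?mulmx0 !addr0; congr block_mx.
  by rewrite /reflection /v -scalemxAr addrC subrK.
have E2 : block_mx (1%:M : 'M[R]_1) v u 1%:M =
    block_mx (1%:M - v *m u) v 0 1%:M *m block_mx 1%:M 0 u 1%:M.
  by rewrite mulmx_block !mulmx1 ?mul1mx ?mul0mx ?mulmx0 !add0r subrK.
have : \det (block_mx (1%:M : 'M[R]_1) v u 1%:M) = \det (reflection u).
  by rewrite E1 det_mulmx det_lblock det_ublock !det1 !mul1r.
rewrite E2 det_mulmx det_lblock det_ublock !det1 !mulr1 => <-.
rewrite det_mx11 /v -scalemxAl.
have -> : u^T *m u = (dotv u u)%:M by rewrite /dotv [LHS]mx11_scalar.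
rewrite !mxE /= divfK //; ring.
Qed.

Lemma reflection_swap p (a b : 'cV[R]_p) : a != b -> dotv a a = dotv b b ->
  reflection (a - b) *m a = b.
Proof.
move=> ab eab.
have u0 : dotv (a - b) (a - b) != 0 by rewrite dotv_eq0 subr_eq0.
have E : dotv (a - b) (a - b) = 2 * dotv (a - b) a.
  rewrite !dotvBl !dotvBr -eab (dotvC b a); ring.
by rewrite reflection_mul -E divff // scale1r opprB addrC subrK.
Qed.

Lemma reflection_fix p (u x : 'cV[R]_p) : dotv u x = 0 -> reflection u *m x = x.
Proof. by move=> ux; rewrite reflection_mul ux mulr0 mul0r scale0r subr0. Qed.

(** The [p] by 2 matrix with columns [a] and [b] has rank at most 2, so its left kernel is not
    zero. *)
Lemma exists_orthogonal p (a b : 'cV[R]_p) : (2 < p)%N ->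
  exists w : 'cV[R]_p, [/\ w != 0, dotv w a = 0 & dotv w b = 0].
Proof.
move=> p2; pose A := row_mx a b.
have : kermx A != 0.
  rewrite -mxrank_eq0 mxrank_ker subn_eq0 -ltnNge.
  exact: leq_ltn_trans (rank_leq_col A) p2.
move=> /rowV0Pn [v /sub_kermxP vA v0]; exists v^T.
move: vA; rewrite mul_mx_row => /(congr1 (fun M => (lsubmx M, rsubmx M))).
rewrite row_mxKl row_mxKr !linear0 => -[va vb].
by split; [rewrite trmx_eq0 | rewrite /dotv trmxK va mxE | rewrite /dotv trmxK vb mxE].
Qed.

(** For the surface measure, which is invariant under all orthogonal maps, a single reflection is
    enough. *)
Lemma exists_swap p (a b : 'cV[R]_p) : dotv a a = dotv b b ->
  exists O : 'M[R]_p, [/\ O *m O^T = 1%:M, O^T *m a = b &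
    forall x, dotv x a = 0 -> dotv x b = 0 -> O^T *m x = x].
Proof.
move=> eab; have [->|ab] := eqVneq a b.
  by exists 1%:M; rewrite trmx1 !mul1mx; split => // x _ _; rewrite mul1mx.
exists (reflection (a - b)); rewrite tr_reflection reflectionK ?subr_eq0 //.
split => //; first exact: reflection_swap.
by move=> x xa xb; rewrite reflection_fix // dotvC dotvBr xa xb subr0.
Qed.

(** The reflection that sends [a] to [b] has determinant -1. A second one, along a vector orthogonal
    to [t] and [b], restores determinant 1 and disturbs neither; this is where [2 < p] enters. *)
Lemma exists_rotation p (t a b : 'cV[R]_p) : (2 < p)%N ->
  dotv t a = 0 -> dotv t b = 0 -> dotv a a = dotv b b ->
  exists2 U : 'M[R]_p, SOfix t U & U^T *m a = b.
Proof.
move=> p2 ta tb eab; have [->|ab] := eqVneq a b.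
  by exists 1%:M; [split; rewrite ?trmx1 ?mulmx1 ?mul1mx ?det1 | rewrite trmx1 mul1mx].
have [w [w0 wt wb]] := exists_orthogonal t b p2.
have u0 : a - b != 0 by rewrite subr_eq0.
exists (reflection (a - b) *m reflection w).
  split; first by rewrite trmx_mul !tr_reflection -mulmxA (mulmxA (reflection w))
    reflectionK // mul1mx reflectionK.
  split; first by rewrite det_mulmx !det_reflection // mulrNN mulr1.
  by rewrite -mulmxA !reflection_fix // dotvC dotvBr ta tb subr0.
by rewrite trmx_mul !tr_reflection -mulmxA reflection_swap // reflection_fix.
Qed.

Lemma SOfix_trmx p (t : 'cV[R]_p) O : SOfix t O -> O^T *m t = t.
Proof.
move=> [OO [_ Ot]]; have OTO : O^T *m O = 1%:M by apply: mulmx1C.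
by rewrite -{1}Ot mulmxA OTO mul1mx.
Qed.

Definition perp_proj p (t : 'cV[R]_p) : 'M[R]_p := 1%:M - t *m t^T.

Lemma perp_proj_mul p (t x : 'cV[R]_p) : perp_proj t *m x = x - dotv t x *: t.
Proof.
rewrite /perp_proj mulmxBl mul1mx -mulmxA; congr (_ - _).
have -> : t^T *m x = (dotv t x)%:M by rewrite /dotv [LHS]mx11_scalar.
by rewrite mul_mx_scalar.
Qed.

Lemma tr_perp_proj p (t : 'cV[R]_p) : (perp_proj t)^T = perp_proj t.
Proof. by rewrite /perp_proj linearB /= trmx1 trmx_mul trmxK. Qed.

Lemma trace_perp_proj p (t : 'cV[R]_p) : dotv t t = 1 -> \tr (perp_proj t) = p%:R - 1.
Proof.
move=> t1; rewrite /perp_proj linearB /= mxtrace1 mxtrace_mulC; congr (_ - _).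
by rewrite trace_mx11 -[LHS]/(dotv t t).
Qed.

Lemma perp_proj_id p (t x : 'cV[R]_p) : dotv t x = 0 -> perp_proj t *m x = x.
Proof. by move=> tx; rewrite perp_proj_mul tx scale0r subr0. Qed.

Lemma dotv_perp_proj p (t x : 'cV[R]_p) : dotv t t = 1 ->
  dotv t (perp_proj t *m x) = 0.
Proof. by move=> t1; rewrite perp_proj_mul dotvBr dotvZr t1 mulr1 subrr. Qed.

Lemma perp_projK p (t : 'cV[R]_p) : dotv t t = 1 ->
  perp_proj t *m perp_proj t = perp_proj t.
Proof.
move=> t1; rewrite {1}/perp_proj mulmxBl mul1mx -mulmxA.
rewrite (_ : t^T *m perp_proj t = 0) ?mulmx0 ?subr0 //.
rewrite /perp_proj mulmxBr mulmx1 mulmxA.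
have -> : t^T *m t = (dotv t t)%:M by rewrite /dotv [LHS]mx11_scalar.
by rewrite t1 mul1mx subrr.
Qed.

Lemma sqr_perp_proj p (t x : 'cV[R]_p) : dotv t t = 1 ->
  dotv (perp_proj t *m x) (perp_proj t *m x) = dotv x x - dotv t x ^+ 2.
Proof.
move=> t1; rewrite perp_proj_mul !dotvBr !dotvBl !dotvZr !dotvZl t1 (dotvC x t); ring.
Qed.

End Vectors.

(** * Moments of rotationally invariant measures *)

Section MomentSeries.
Context d (T : measurableType d) (R : realType).
Variables (mu : {measure set T -> \bar R}) (D : set T).
Hypotheses (mD : measurable D) (muD : (mu D < +oo)%E).
Variable (U : T -> R).
Hypothesis bU : bddmeas D U.

(* The moment recursion satisfied, for [s = 1], by the first coordinate of a
   uniform point of the unit sphere of dimension [p], with weight [h]. *)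
Definition sphere_moments p (s : R) (h : T -> R) :=
  Rintegral mu D (fun x => h x * U x) = 0 /\
  forall j, Rintegral mu D (fun x => h x * U x ^+ j.+2) * (p + j)%:R =
    j.+1%:R * s * Rintegral mu D (fun x => h x * U x ^+ j).

Let M h j := Rintegral mu D (fun x => h x * U x ^+ j).

Let bhU h j : bddmeas D h -> bddmeas D (fun x => h x * U x ^+ j).
Proof. by move=> bh; apply: bddmeasM => //; exact: bddmeasX. Qed.

Lemma moment_complement h s j : bddmeas D h ->
  Rintegral mu D (fun x => h x * (s - U x ^+ 2) * U x ^+ j) =
  s * Rintegral mu D (fun x => h x * U x ^+ j)
   - Rintegral mu D (fun x => h x * U x ^+ j.+2).
Proof.
move=> bh.
rewrite -(bddmeas_RintegralZ mD muD _ (bhU j bh)).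
rewrite -(bddmeas_RintegralB mD muD (bddmeasZ s (bhU j bh)) (bhU j.+2 bh)).
by congr Rintegral; apply/funext => x; rewrite !exprS expr0; ring.
Qed.

Lemma sphere_moments_complement_eq p s h j : (0 < p)%N -> bddmeas D h ->
  sphere_moments p s h ->
  Rintegral mu D (fun x => h x * (s - U x ^+ 2) * U x ^+ j) =
  s * (p%:R - 1) / (p + j)%:R * Rintegral mu D (fun x => h x * U x ^+ j).
Proof.
move=> p0 bh [_ H]; rewrite moment_complement //.
have pj : (p + j)%:R != 0 :> R by rewrite pnatr_eq0 addn_eq0; case: p p0 {H}.
apply: (mulIf pj); rewrite mulrBl H [in RHS]mulrAC divfK // natrD -natr1; ring.
Qed.

(** Multiplying the density (1 - u^2)^((p-3)/2) by 1 - u^2 gives the density of dimension p + 2; the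
    recursion sees the same shift. *)
Lemma sphere_moments_complement p s h : (0 < p)%N -> bddmeas D h ->
  sphere_moments p s h -> sphere_moments p.+2 s (fun x => h x * (s - U x ^+ 2)).
Proof.
move=> p0 bh Hh; have [H0 H] := Hh.
split=> [|j].
  have := sphere_moments_complement_eq 1 p0 bh Hh.
  under eq_Rintegral do rewrite expr1; move=> ->.
  by under eq_Rintegral do rewrite expr1; rewrite H0 mulr0.
rewrite !(sphere_moments_complement_eq _ p0 bh Hh).
have -> : (p.+2 + j)%:R = (p + j.+2)%:R :> R by congr (_%:R); lia.
have pj : (p + j.+2)%:R != 0 :> R by rewrite pnatr_eq0 addn_eq0; case: p p0 {H Hh}.
have pj' : (p + j)%:R != 0 :> R by rewrite pnatr_eq0 addn_eq0; case: p p0 {H Hh pj}.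
rewrite mulrAC divfK // -mulrA; apply: (mulIf pj').
rewrite -!mulrA [_^-1 * _]mulrC -!mulrA mulfV // mulr1.
rewrite [M h _ * _]H; ring.
Qed.

(** The coefficients of [hyp] solve this recursion: its step multiplies by (2k+1) s / (p + 2k). *)
Lemma sphere_moments_even p s h k : (0 < p)%N -> sphere_moments p s h ->
  M h (2 * k) = (2 * k)`!%:R * hyp_coef R p k * s ^+ k * M h 0.
Proof.
move=> p0 [_ H]; elim: k => [|k IH]; first by rewrite muln0 hyp_coef0 !mul1r.
have pj : (p + 2 * k)%:R != 0 :> R by rewrite pnatr_eq0 addn_eq0; case: p p0 {H IH}.
have -> : (2 * k.+1)%N = (2 * k).+2 by lia.
apply: (mulIf pj); rewrite /M H -/(M h _) IH hyp_coefS !factS !natrM exprS.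
have -> : ((2 * k).+2)%:R = 2 * k.+1%:R :> R by rewrite -natrM; congr (_%:R); lia.
rewrite -/(M h 0); have k0 : k.+1%:R != 0 :> R by rewrite pnatr_eq0.
move: (M h 0) (k.+1%:R) ((p + 2 * k)%:R) ((2 * k).+1%:R) (_`!%:R) k0 pj => *.
by field; apply/andP.
Qed.

Lemma sphere_moments_odd p s h k : (0 < p)%N -> sphere_moments p s h ->
  M h (2 * k).+1 = 0.
Proof.
move=> p0 [H0 H]; elim: k => [|k IH].
  by rewrite /M -[RHS]H0; congr Rintegral; apply/funext => x; rewrite expr1.
have pj : (p + (2 * k).+1)%:R != 0 :> R by rewrite pnatr_eq0 addn_eq0; case: p p0 {H IH}.
have -> : (2 * k.+1).+1 = (2 * k).+3 by lia.
by apply: (mulIf pj); rewrite /M H -/(M h _) IH mulr0 mul0r.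
Qed.

Lemma sphere_moments_exp p s h (k : R) : (0 < p)%N -> bddmeas D h ->
  sphere_moments p s h ->
  Rintegral mu D (fun x => h x * expR (k * U x)) =
  Rintegral mu D h * hyp p (s * k ^+ 2).
Proof.
move=> p0 bh Hh.
have M0 : M h 0 = Rintegral mu D h.
  by congr Rintegral; apply/funext => x; rewrite expr0 mulr1.
have := Rintegral_expR_series mD muD bh (bddmeasZ k bU).
set u := (fun j => _) => cu.
have uE j : u j = k ^+ j / j`!%:R * M h j.
  rewrite /u (_ : (fun x => _) = (fun x => k ^+ j * (h x * U x ^+ j))).
    by rewrite (bddmeas_RintegralZ mD muD _ (bhU j bh)) mulrAC.
  by apply/funext => x; rewrite exprMn; ring.
(* Along even partial sums each step adds one term of the [hyp] series and one vanishing odd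
   moment. *)
have cu2 : (fun n => series u (2 * n)%N) @ \oo -->
    Rintegral mu D (fun x => h x * expR (k * U x)).
  have := cvg_comp _ _ (@cvg_mulnl 2 isT) cu.
  by [].
rewrite -(cvg_lim (@norm_hausdorff _ _) cu2).
have -> : (fun n => series u (2 * n)%N) =
    (fun n => Rintegral mu D h * pseries (hyp_coef R p) (s * k ^+ 2) n).
  apply/funext => n; elim: n => [|n IH].
    by rewrite muln0 /pseries /series /= ![\sum_(0 <= _ < 0) _]big_geq // mulr0.
  have -> : (2 * n.+1)%N = (2 * n).+2 by lia.
  rewrite !seriesSr IH /pseries [in RHS]seriesSr mulrDr -addrA; congr (_ + _).
  rewrite !uE (sphere_moments_odd _ p0 Hh) mulr0 addr0 (sphere_moments_even _ p0 Hh).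
  rewrite M0 /= exprMn exprM; have : ((2 * n)`!)%:R != 0 :> R by rewrite pnatr_eq0 -lt0n fact_gt0.
  by move=> f0; field.
apply: cvg_lim; first exact: norm_hausdorff.
by apply: cvgMr; exact: cvg_hyp.
Qed.

(* Integration by parts, read off the recursion term by term. *)
Lemma sphere_moments_ibp p h (k : R) : (0 < p)%N -> bddmeas D h ->
  sphere_moments p 1 h ->
  (p%:R - 1) * Rintegral mu D (fun x => h x * U x * expR (k * U x)) =
  k * Rintegral mu D (fun x => h x * (1 - U x ^+ 2) * expR (k * U x)).
Proof.
move=> p0 bh Hh; have [H0 H] := Hh.
have bU2 : bddmeas D (fun x => 1 - U x ^+ 2).
  by apply: bddmeasB; [exact: bddmeas_cst | exact: bddmeasX].
have bkU := bddmeasZ k bU.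
have c1 := Rintegral_expR_series mD muD (bddmeasM bh bU) bkU.
have c2 := Rintegral_expR_series mD muD (bddmeasM bh bU2) bkU.
set u1 := (fun j => _) in c1; set u2 := (fun j => _) in c2.
have u1E j : u1 j = k ^+ j / j`!%:R * M h j.+1.
  rewrite /u1 (_ : (fun x => _) = (fun x => k ^+ j * (h x * U x ^+ j.+1))).
    by rewrite (bddmeas_RintegralZ mD muD _ (bhU _ bh)) mulrAC.
  by apply/funext => x; rewrite exprMn exprS; ring.
have u2E j : u2 j = k ^+ j / j`!%:R * ((p%:R - 1) / (p + j)%:R * M h j).
  rewrite /u2 (_ : (fun x => _) = (fun x => k ^+ j * (h x * (1 - U x ^+ 2) * U x ^+ j))).
    rewrite (bddmeas_RintegralZ mD muD _ (bhU _ (bddmeasM bh bU2))) mulrAC.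
    by rewrite (sphere_moments_complement_eq _ p0 bh Hh) mul1r.
  by apply/funext => x; rewrite exprMn; ring.
have {}c1 : (fun n => (p%:R - 1) * series u1 n.+1) @ \oo -->
   (p%:R - 1) * Rintegral mu D (fun x => h x * U x * expR (k * U x)).
  by apply: cvgMr; rewrite (cvg_shiftS (series u1)).
rewrite -(cvg_lim (@norm_hausdorff _ _) c1).
(* The zeroth term of [u1] is the vanishing first moment, and (p - 1) u1_(n+1) = k u2_n by the
   recursion; hence the shift by one. *)
have -> : (fun n => (p%:R - 1) * series u1 n.+1) = (fun n => k * series u2 n).
  apply/funext => n; elim: n => [|n IH].
    rewrite seriesSr /series /= !big_geq // add0r u1E mulr0.
    have -> : M h 1 = 0.
      by rewrite -H0; congr Rintegral; apply/funext => x; rewrite expr1.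
    by rewrite !mulr0.
  rewrite seriesSr mulrDr IH [in RHS]seriesSr mulrDr; congr (_ + _).
  have pj : (p + n)%:R != 0 :> R by rewrite pnatr_eq0 addn_eq0; case: p p0 {Hh H H0 u2E c1 IH}.
  rewrite u1E u2E (_ : M h n.+2 = n.+1%:R * M h n / (p + n)%:R); last first.
    by apply: (mulIf pj); rewrite divfK // /M H mulr1.
  rewrite factS natrM exprS.
  have f0 : n`!%:R != 0 :> R by rewrite pnatr_eq0 -lt0n fact_gt0.
  have n0 : n.+1%:R != 0 :> R by rewrite pnatr_eq0.
  move: (M h n) (n.+1%:R) ((p + n)%:R) (n`!%:R) (p%:R) (k ^+ n) n0 pj f0 => *.
  by field; apply/and3P.
by apply: cvg_lim; [exact: norm_hausdorff | exact: cvgMr].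
Qed.

End MomentSeries.

Section Polynomials.
Variable R : realType.

Lemma poly_ext (f g : {poly R}) : (forall x, f.[x] = g.[x]) -> f = g.
Proof.
move=> H; apply/eqP; rewrite -subr_eq0; apply/eqP.
apply: (@roots_geq_poly_eq0 _ _ [seq (i%:R : R) | i <- iota 0 (size (f - g))]).
- by apply/allP => x _; rewrite rootE !hornerE H subrr.
- by rewrite map_inj_uniq ?iota_uniq // => i j /eqP; rewrite eqr_nat => /eqP ->.
- by rewrite size_map size_iota.
Qed.

Lemma coef2_quadratic_exp (b c : R) n :
  let f := 1 + b%:P * 'X + c%:P * 'X ^+ 2 in
  [/\ (f ^+ n)`_0 = 1, (f ^+ n)`_1 = n%:R * b &
      (f ^+ n)`_2 = n%:R * c + n%:R * (n%:R - 1) / 2 * b ^+ 2].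
Proof.
move=> f; elim: n => [|n [H0 H1 H2]].
  by rewrite expr0 !coef1 /= !mul0r addr0.
have -> : f ^+ n.+1 = f ^+ n + b *: (f ^+ n * 'X) + c *: (f ^+ n * 'X * 'X).
  by rewrite exprS /f -!mul_polyC; ring.
rewrite !coefD !coefZ !coefMX /= H0 H1 H2 -natr1.
by split; [ring | ring | field].
Qed.

End Polynomials.

(** * The moment recursion from rotation invariance *)

Section RotationMoments.
Context d (T : measurableType d) (R : realType) (p q : nat).
Variables (mu : {measure set T -> \bar R}) (D : set T).
Hypotheses (mD : measurable D) (muD : (mu D < +oo)%E).
Variables (Y : T -> 'cV[R]_p) (Q : 'M[R]_p) (rho : R).
Hypotheses (QT : Q^T = Q) (QQ : Q *m Q = Q) (trQ : \tr Q = q%:R).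
Hypothesis bY : forall a, bddmeas D (fun x => dotv (Y x) a).
Hypothesis YQ : forall x, D x -> Q *m Y x = Y x.
Hypothesis Yrho : forall x, D x -> dotv (Y x) (Y x) = rho.
Hypothesis Yinv : forall a b, Q *m a = a -> Q *m b = b -> dotv a a = dotv b b ->
  forall j, Rintegral mu D (fun x => dotv (Y x) a ^+ j) =
            Rintegral mu D (fun x => dotv (Y x) b ^+ j).

Let I j a := Rintegral mu D (fun x => dotv (Y x) a ^+ j).

Let I_scale j c a : I j (c *: a) = c ^+ j * I j a.
Proof.
rewrite /I -(bddmeas_RintegralZ mD muD _ (bddmeasX j (bY a))).
by congr Rintegral; apply/funext => x; rewrite dotvZr exprMn.
Qed.

Let I_odd j a : odd j -> Q *m a = a -> I j a = 0.
Proof.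
move=> oj Qa; have : I j (- a) = I j a.
  by apply: Yinv => //; rewrite ?mulmxN ?Qa // dotvNl dotvNr opprK.
by rewrite -scaleN1r I_scale -signr_odd oj expr1; lra.
Qed.

(** By invariance and homogeneity, the moment of order 2k + 2 in the direction a + s b is (|a + s
    b|^2 / |a|^2)^(k+1) times the one in direction [a]. Both sides are polynomials in s, and the
    coefficients of s^2 are compared. *)
Let mixed k a b : Q *m a = a -> Q *m b = b -> a != 0 ->
  (2 * k).+1%:R * Rintegral mu D (fun x => dotv (Y x) a ^+ (2 * k) * dotv (Y x) b ^+ 2) =
  I (2 * k).+2 a * (dotv b b / dotv a a + 2 * k%:R * (dotv a b / dotv a a) ^+ 2).
Proof.
move=> Qa Qb; rewrite -dotv_eq0 => a0.
have a1 : 0 < dotv a a by rewrite lt_neqAle eq_sym a0 dotv_ge0.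
set n := (2 * k).+2; set beta := dotv a b / dotv a a; set gamma := dotv b b / dotv a a.
pose J i := Rintegral mu D (fun x => dotv (Y x) a ^+ (n - i) * dotv (Y x) b ^+ i).
pose f1 := \poly_(i < n.+1) (J i *+ 'C(n, i)).
pose f2 := I n a *: (1 + (2 * beta)%:P * 'X + gamma%:P * 'X ^+ 2) ^+ k.+1.
have bm i s : bddmeas D (fun x => dotv (Y x) a ^+ (n - i) * (s * dotv (Y x) b) ^+ i).
  by apply: bddmeasM; apply: bddmeasX => //; exact: bddmeasZ.
have E : f1 = f2.
  apply: poly_ext => s; rewrite /f1 horner_poly /f2 hornerZ horner_exp !(hornerD, hornerM, hornerC, hornerXn, hornerX).
  have cE : 1 + 2 * beta * s + gamma * s ^+ 2 = dotv (a + s *: b) (a + s *: b) / dotv a a.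
    rewrite !dotvDl !dotvDr !dotvZl !dotvZr (dotvC b a) /beta /gamma.
    by field.
  rewrite -[s * s]expr2.
  set c := 1 + _ + _ in cE *.
  have c0 : 0 <= c by rewrite cE divr_ge0 // dotv_ge0.
  (* The order [n] is even, so a power of the norm ratio is a polynomial in s; scaling [a] by that
     ratio gives it the length of a + s b. *)
  have -> : I n a * c ^+ k.+1 = I n (Num.sqrt c *: a).
    rewrite I_scale mulrC; congr (_ * _).
    by rewrite (_ : n = (2 * k.+1)%N) ?exprM ?sqr_sqrtr // /n; lia.
  have -> : I n (Num.sqrt c *: a) = I n (a + s *: b).
    apply: Yinv; rewrite ?mulmxDr -?scalemxAr ?Qa ?Qb //.
    by rewrite dotvZl dotvZr mulrA -expr2 sqr_sqrtr // cE divfK.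
  rewrite /I.
  have -> : (fun x => dotv (Y x) (a + s *: b) ^+ n) =
    (fun x => \sum_(i < n.+1) ('C(n, i))%:R * (dotv (Y x) a ^+ (n - i) * (s * dotv (Y x) b) ^+ i)).
    apply/funext => x; rewrite dotvDr dotvZr exprDn; apply: eq_bigr => i _.
    by rewrite -mulr_natl.
  rewrite (bddmeas_Rintegral_sum mD muD); last by move=> i; exact/bddmeasZ.
  apply: eq_bigr => i _; rewrite (bddmeas_RintegralZ mD muD _ (bm i s)) -[J i *+ _]mulr_natl -mulrA.
  congr (_ * _); rewrite mulrC /J -(bddmeas_RintegralZ mD muD); last first.
    by apply: bddmeasM; apply: bddmeasX.
  by congr Rintegral; apply/funext => x; rewrite exprMn; ring.
have := congr1 (fun f : {poly R} => f`_2) E.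
rewrite coef_poly ltnS (_ : (2 <= n)%N) ; last by rewrite /n; lia.
rewrite coefZ; have [_ _ ->] := coef2_quadratic_exp (2 * beta) gamma k.+1.
have C2 : ('C(n, 2))%:R = k.+1%:R * (2 * k).+1%:R :> R.
  have : ('C(n, 2) * 2 = n * n.-1)%N by have := bin_ffact n 2; rewrite !ffactnS ffactn0 muln1.
  move=> /(congr1 (fun m => m%:R : R)); rewrite !natrM.
  have -> : n%:R = 2 * k.+1%:R :> R by rewrite -natrM; congr (_%:R); rewrite /n; lia.
  by rewrite /n /=; lra.
have -> : J 2 = Rintegral mu D (fun x => dotv (Y x) a ^+ (2 * k) * dotv (Y x) b ^+ 2).
  by rewrite /J (_ : (n - 2 = 2 * k)%N) // /n; lia.
rewrite -[_ *+ 'C(n, 2)]mulr_natl C2 => H.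
have k0 : k.+1%:R != 0 :> R by rewrite pnatr_eq0.
by apply: (mulfI k0); rewrite mulrA H -natr1; field.
Qed.

(** The mixed moments are summed over [b] in the projected standard basis. On the left the squares
    add up to [rho]; on the right the trace gives [q] and Parseval's identity adds 2k, hence the
    factor q + 2k of the recursion. *)
Lemma rotation_sphere_moments a : Q *m a = a ->
  sphere_moments mu D (fun x => dotv (Y x) a) q (dotv a a * rho) (cst 1).
Proof.
move=> Qa; have E j : Rintegral mu D (fun x => cst 1 x * dotv (Y x) a ^+ j) = I j a.
  by congr Rintegral; apply/funext => x; rewrite mul1r.
split=> [|j].
  rewrite -[RHS](@I_odd 1 a) // /I; congr Rintegral; apply/funext => x.
  by rewrite mul1r expr1.
rewrite !E; have [oj|ej] := boolP (odd j).
  by rewrite !I_odd //= ?negbK // mul0r mulr0.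
have [->|a0] := eqVneq a 0.
  have -> : (0 : 'cV[R]_p) = 0 *: 0 by rewrite scale0r.
  by rewrite I_scale dotvZl exprS !(mul0r, mulr0).
have -> : j = (2 * j./2)%N by rewrite mul2n -[LHS](odd_double_half j) (negbTE ej).
set k := j./2.
have QQi i : Q *m (Q *m delta_mx i 0) = Q *m (delta_mx i 0 : 'cV[R]_p) by rewrite mulmxA QQ.
(* The projected basis is a Parseval frame of the range of [Q], so no orthonormal basis of the range
   has to be chosen. *)
pose e i : 'cV[R]_p := Q *m delta_mx i 0.
have : \sum_(i < p) (2 * k).+1%:R * Rintegral mu D
      (fun x => dotv (Y x) a ^+ (2 * k) * dotv (Y x) (e i) ^+ 2) =
    \sum_(i < p) I (2 * k).+2 a * (dotv (e i) (e i) / dotv a a +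
       2 * k%:R * (dotv a (e i) / dotv a a) ^+ 2).
  by apply: eq_bigr => i _; apply: mixed => //; exact: QQi.
rewrite -!mulr_sumr.
rewrite -(bddmeas_Rintegral_sum mD muD); last first.
  by move=> i; apply: bddmeasM; exact: bddmeasX.
have -> : Rintegral mu D (fun x => \sum_(i < p) dotv (Y x) a ^+ (2 * k) *
      dotv (Y x) (e i) ^+ 2) = rho * I (2 * k) a.
  rewrite /I -(bddmeas_RintegralZ mD muD _ (bddmeasX _ (bY a))).
  apply: eq_Rintegral => x; rewrite inE => Dx.
  rewrite -mulr_sumr mulrC; congr (_ * _).
  rewrite -(Yrho Dx) -sum_sqr_dotv_delta; apply: eq_bigr => i _.
  by rewrite /e -{1}QT -dotv_mulmx YQ.
rewrite big_split /= -mulr_suml -mulr_sumr.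
have -> : \sum_(i < p) dotv (e i) (e i) = q%:R.
  rewrite -trQ /mxtrace; apply: eq_bigr => i _.
  rewrite /e dotv_mulmx QT mulmxA QQ -colE dotvE (bigD1 i) //= big1 => [|j' ji].
    by rewrite !mxE !eqxx mul1r addr0.
  by rewrite mxE (negbTE ji) mul0r.
have -> : \sum_(i < p) (dotv a (e i) / dotv a a) ^+ 2 = (dotv a a)^-1.
  rewrite (eq_bigr (fun i => (dotv a a)^-1 ^+ 2 * dotv a (delta_mx i 0) ^+ 2)).
    rewrite -mulr_sumr sum_sqr_dotv_delta expr2 -mulrA mulVf ?mulr1 //.
    by rewrite dotv_eq0.
  move=> i _; rewrite exprMn mulrC; congr (_ * _ ^+ 2).
  by rewrite -{2}Qa dotv_mulmx QT /e.
have aa0 : dotv a a != 0 by rewrite dotv_eq0.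
move=> H; apply: (mulIf (invr_neq0 aa0)).
transitivity ((2 * k).+1%:R * (rho * I (2 * k) a)).
  by rewrite H natrD natrM; field.
by field.
Qed.

End RotationMoments.

(** * Measurability, Haar averages and the invariant log-likelihood ratio *)

Section Measurability.
Variable R : realType.

Lemma dotv_norm_le p (x y : 'cV[R]_p) : `|dotv x y| <= (dotv x x + dotv y y) / 2.
Proof.
have h1 := dotv_ge0 (x - y); have h2 := dotv_ge0 (x + y).
rewrite !(dotvBl, dotvBr) in h1; rewrite !(dotvDl, dotvDr) in h2.
rewrite (dotvC y x) in h1 h2; rewrite ler_norml; apply/andP; split; lra.
Qed.

Lemma measurable_coord m n (i : 'I_m) (j : 'I_n) :
  measurable_fun setT (fun M : g_sigma_algebraType (@open 'M[R]_(m, n)) => M i j).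
Proof.
apply: (measurability (@RGenOpens.G R)); first exact: RGenOpens.measurableE.
move=> _ [_ [x [y ->]] <-]; rewrite setTI.
apply: sub_sigma_algebra.
have : open ((fun M : 'M[R]_(m, n) => M i j) @^-1` `]x, y[).
  apply: open_comp; last exact: itv_open.
  by move=> M _; exact: coord_continuous.
by [].
Qed.

Lemma measurable_coordv p i :
  measurable_fun setT (fun x : vecT R p => (x : 'cV[R]_p) i 0).
Proof. exact: measurable_coord. Qed.

Lemma measurable_dotv p d (T : measurableType d) (X : T -> vecT R p) (a : 'cV[R]_p) :
  measurable_fun setT X -> measurable_fun setT (fun w => dotv (X w : 'cV[R]_p) a).
Proof.
move=> mX; rewrite (_ : (fun w => _) = (fun w => \sum_i (X w : 'cV[R]_p) i 0 * a i 0)).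
  apply: measurable_sum => i; apply: measurable_funM => //.
  by apply: (measurableT_comp (measurable_coordv i)).
by apply/funext => w; rewrite dotvE.
Qed.

Lemma measurable_level d (T : measurableType d) (f : T -> R) (c : R) :
  measurable_fun setT f -> measurable [set x | f x = c].
Proof.
by move=> mf; have := mf measurableT [set c] (measurable_set1 c); rewrite setTI.
Qed.

Lemma measurable_dotvv p : measurable_fun setT (fun x : vecT R p => dotv (x : 'cV[R]_p) x).
Proof.
rewrite (_ : (fun w => _) = (fun w : vecT R p => \sum_i (w : 'cV[R]_p) i 0 * (w : 'cV[R]_p) i 0)).
  by apply: measurable_sum => i; apply: measurable_funM => //; exact: measurable_coordv.
by apply/funext => w; rewrite dotvE.
Qed.

Lemma measurable_sphere p : measurable (@sphere R p : set (vecT R p)).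
Proof.
rewrite (_ : @sphere R p = [set x : vecT R p | dotv (x : 'cV[R]_p) x = 1]).
  by apply: measurable_level; exact: measurable_dotvv.
by apply/seteqP; split => x /sphereP.
Qed.

Lemma measurable_bilinear p (x a : 'cV[R]_p) :
  measurable_fun setT (fun O : matT R p => dotv ((O : 'M[R]_p) *m x) a).
Proof.
rewrite (_ : (fun w => _) = (fun O : matT R p =>
  \sum_i (\sum_j (O : 'M[R]_p) i j * x j 0) * a i 0)).
  apply: measurable_sum => i; apply: measurable_funM => //.
  apply: measurable_sum => j; apply: measurable_funM => //.
  exact: measurable_coord.
by apply/funext => O; rewrite dotvE; apply: eq_bigr => i _; rewrite mxE.
Qed.

(** The group is cut out by finitely many polynomial equations in the entries. *)
Lemma measurable_SOfix p (t : 'cV[R]_p) : measurable (SOfix t : set (matT R p)).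
Proof.
rewrite (_ : SOfix t =
  (\bigcap_(i in setT) \bigcap_(j in setT) [set O : matT R p |
      \sum_k (O : 'M[R]_p) i k * (O : 'M[R]_p) j k = (1%:M : 'M[R]_p) i j]) `&`
  ([set O : matT R p | \det (O : 'M[R]_p) = 1] `&`
   \bigcap_(i in setT) [set O : matT R p | \sum_k (O : 'M[R]_p) i k * t k 0 = t i 0])).
  apply: measurableI; last apply: measurableI.
  - apply: fin_bigcap_measurable => // i _; apply: fin_bigcap_measurable => // j _.
    apply: measurable_level; apply: measurable_sum => k.
    by apply: measurable_funM; exact: measurable_coord.
  - apply: measurable_level; rewrite /determinant.
    apply: measurable_sum => s; apply: measurable_funM => //.
    by apply: measurable_prod => i _; exact: measurable_coord.
  - apply: fin_bigcap_measurable => // i _.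
    apply: measurable_level; apply: measurable_sum => k.
    by apply: measurable_funM => //; exact: measurable_coord.
apply/seteqP; split => O.
  move=> [OO [dO Ot]]; split; last split => //.
    move=> i _ j _ /=; rewrite -OO mxE; apply: eq_bigr => k _; by rewrite mxE.
  by move=> i _ /=; rewrite -[RHS](congr1 (fun M : 'cV[R]_p => M i 0) Ot) mxE.
move=> [OO [dO Ot]]; split; last split => //.
  apply/matrixP => i j; rewrite -(OO i I j I) mxE; apply: eq_bigr => k _; by rewrite mxE.
by apply/colP => i; rewrite -(Ot i I) mxE.
Qed.

End Measurability.

(** * Haar averages over the rotations fixing an axis *)

Section Haar.
Variables (R : realType) (p : nat) (t : 'cV[R]_p) (H : probability (matT R p) R).
Hypotheses (p2 : (2 < p)%N) (tt1 : dotv t t = 1) (HH : is_haar t H).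

(** The vector O x runs over a sphere of the hyperplane orthogonal to [t], of dimension p - 1. The
    recursion applies with the projection onto that hyperplane. *)
Lemma haar_exp (x a : 'cV[R]_p) : dotv t x = 0 -> dotv t a = 0 ->
  Rintegral H (SOfix t : set (matT R p)) (fun O => expR (dotv ((O : 'M[R]_p) *m x) a)) =
  hyp p.-1 (dotv a a * dotv x x).
Proof.
move=> tx ta; have [H0 Hinv] := HH.
have mD := measurable_SOfix t.
have HD : H (SOfix t : set (matT R p)) = 1%E.
  by rewrite -[SOfix t]setCK probability_setC ?H0 ?sube0 //; exact: measurableC.
have HD' : (H (SOfix t : set (matT R p)) < +oo)%E by rewrite HD ltry.
have OO (O : matT R p) (y : 'cV[R]_p) : SOfix t O ->
    dotv ((O : 'M[R]_p) *m y) ((O : 'M[R]_p) *m y) = dotv y y.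
  by move=> [/mulmx1C O1 _]; rewrite dotv_mulmx mulmxA O1 mul1mx.
have bY b : bddmeas (SOfix t : set (matT R p)) (fun O : matT R p => dotv ((O : 'M[R]_p) *m x) b).
  split; first exact: measurable_funS (measurable_bilinear x b).
  exists ((dotv x x + dotv b b) / 2) => O DO.
  by rewrite -(OO O x DO); exact: dotv_norm_le.
have sm := @rotation_sphere_moments _ _ _ p p.-1 H (SOfix t : set (matT R p)) mD HD'
  (fun O : matT R p => (O : 'M[R]_p) *m x) (perp_proj t) (dotv x x) (tr_perp_proj t)
  (perp_projK tt1) _ bY _ (fun O DO => OO O x DO) _ a (perp_proj_id ta).
have -> : (fun O : matT R p => expR (dotv ((O : 'M[R]_p) *m x) a)) =
   (fun O : matT R p => cst 1 O * expR (1 * dotv ((O : 'M[R]_p) *m x) a)).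
  by apply/funext => O; rewrite !mul1r.
rewrite (sphere_moments_exp mD HD' (bY a) 1 _ (bddmeas_cst _ 1) (sm _ _ _)).
- by rewrite Rintegral_cst // mul1r [fine _](congr1 fine HD) mul1r expr1n mulr1.
- by case: p p2 => [|[]].
- by rewrite trace_perp_proj // -subn1 natrB //; exact: ltnW (ltnW p2).
- move=> O DO; apply: perp_proj_id.
  by rewrite dotvC dotv_mulmx (SOfix_trmx DO) dotvC.
- move=> b c Qb Qc bc j.
  have tb : dotv t b = 0 by rewrite -Qb dotv_perp_proj.
  have tc : dotv t c = 0 by rewrite -Qc dotv_perp_proj.
  have [U SU Ub] := exists_rotation p2 tb tc bc.
  have mb := measurable_bilinear x b; have mc := measurable_bilinear x c.
  have mX (y : 'cV[R]_p) : measurable_fun setT (fun O : matT R p => dotv ((O : 'M[R]_p) *m x) y ^+ j).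
    by apply: measurable_funX; exact: measurable_bilinear.
  rewrite -!(Rintegral_conull mD H0) //.
  apply: (@Rintegral_transfer _ _ _ _ _ R R H H _ _ mb mc (fun s => s ^+ j)); last first.
    by apply: measurable_funX.
  move=> B mB.
  have mS : measurable ((fun O : matT R p => dotv ((O : 'M[R]_p) *m x) b) @^-1` B).
    by rewrite -[X in measurable X]setTI; exact: mb.
  (* Left translation by [U] turns the coordinate of O x along [b] into that along U^T b, which is
     [c]. *)
  apply: etrans (esym (Hinv U SU _ mS)) _; congr (H _); apply/seteqP.
  have E (O : 'M[R]_p) : dotv (U *m O *m x) b = dotv (O *m x) c.
    by rewrite -mulmxA dotv_mulmx Ub.
  by split => O; rewrite /preimage /= E.
Qed.

(* On [SOfix t] the component of [theta] along [t] contributes a constant factor,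
   and only the two components orthogonal to [t] are averaged over. *)
Lemma Lambda_inv1E n (theta : 'cV[R]_p) (k : R) (x : 'I_n -> 'cV[R]_p) :
  Lambda_inv1 H theta t k x =
    - n%:R * k * (1 - dotv t theta) * dotv (Xbar x) t +
    ln (hyp p.-1 ((n%:R * k) ^+ 2 * (dotv theta theta - dotv t theta ^+ 2) *
      dotv (perp_proj t *m Xbar x) (perp_proj t *m Xbar x))).
Proof.
rewrite /Lambda_inv1 /Lambda_inv.
(* With equal concentrations the quotient is 1; if the constant were 0 it would be 0, and [ln 0] is
   0 by convention. *)
have -> : ln (cpk p k / cpk p k) = 0 :> R.
  by have [->|c0] := eqVneq (cpk p k) 0; [rewrite mul0r ln0 | rewrite divff // ln1].
set y := Xbar x; pose z := perp_proj t *m y; pose a := perp_proj t *m theta.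
have tz : dotv t z = 0 by exact: dotv_perp_proj.
have ta : dotv t a = 0 by exact: dotv_perp_proj.
have yE : y = dotv t y *: t + z by rewrite /z perp_proj_mul addrC subrK.
have aE : theta = dotv t theta *: t + a by rewrite /a perp_proj_mul addrC subrK.
have [H0 _] := HH; have mD := measurable_SOfix t.
have mb (v w : 'cV[R]_p) := measurable_bilinear v w.
have mf : measurable_fun setT (fun O : matT R p =>
    expR (n%:R * k * dotv ((O : 'M[R]_p) *m y) theta)).
  by apply: measurableT_comp => //; apply: measurable_funM => //; exact: mb.
have -> : Rintegral H setT (fun O : matT R p =>
      expR (n%:R * k * dotv y ((O : 'M[R]_p)^T *m theta))) =
    expR (n%:R * k * (dotv t y * dotv t theta)) *
    Rintegral H (SOfix t : set (matT R p))
      (fun O => expR (dotv ((O : 'M[R]_p) *m ((n%:R * k) *: z)) a)).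
  rewrite (_ : (fun O => _) = (fun O : matT R p =>
      expR (n%:R * k * dotv ((O : 'M[R]_p) *m y) theta))); last first.
    by apply/funext => O; rewrite dotv_mulmx.
  rewrite (Rintegral_conull mD H0) //.
  have bY : bddmeas (SOfix t : set (matT R p))
      (fun O => expR (dotv ((O : 'M[R]_p) *m ((n%:R * k) *: z)) a)).
    apply: bddmeas_expR; split; first exact: measurable_funS (mb _ _).
    exists ((dotv ((n%:R * k) *: z) ((n%:R * k) *: z) + dotv a a) / 2).
    move=> O [h1 _].
    apply: le_trans (dotv_norm_le _ _) _.
    by rewrite dotv_mulmx mulmxA (mulmx1C h1) mul1mx.
  rewrite -(bddmeas_RintegralZ mD _ _ bY); last first.
    by rewrite (le_lt_trans (probability_le1 _ mD)) // ltry.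
  apply: eq_Rintegral => O; rewrite inE => DO.
  rewrite -expRD; congr (expR _).
  have -> : dotv ((O : 'M[R]_p) *m ((n%:R * k) *: z)) a = n%:R * k * dotv ((O : 'M[R]_p) *m z) a.
    by rewrite -scalemxAr dotvZl.
  rewrite -mulrDr; congr (_ * _).
  have [h1 [_ Ot]] := DO; have OTt := SOfix_trmx DO.
  rewrite {1}yE mulmxDr -scalemxAr Ot dotvDl dotvZl; congr (_ + _).
  have Oz : dotv ((O : 'M[R]_p) *m z) t = 0 by rewrite dotv_mulmx OTt dotvC.
  by rewrite {1}aE dotvDr dotvZr Oz mulr0 add0r.
rewrite haar_exp //; last by rewrite dotvZr tz mulr0.
rewrite lnM ?posrE ?expR_gt0 //; last first.
  by apply: hyp_gt0; [rewrite -subn1 subn_gt0 (ltn_trans _ p2) | rewrite mulr_ge0 ?dotv_ge0].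
rewrite expRK mulr0 add0r -/y (dotvC y t).
have -> : dotv a a * dotv ((n%:R * k) *: z) ((n%:R * k) *: z) =
   (n%:R * k) ^+ 2 * (dotv theta theta - dotv t theta ^+ 2) * dotv z z.
  by rewrite dotvZl dotvZr /a sqr_perp_proj //; ring.
ring.
Qed.

End Haar.

(** * The projected density on [-1, 1] *)

Section Projected.
Variables (R : realType) (m : nat).
Let p := m.+3.
Notation leb := (@lebesgue_measure R).
Notation J := (`[(-1 : R), 1]%classic).
Let w (u : R) := (1 - u ^+ 2) `^ ((p%:R - 3) / 2).
Let r (u : R) := Num.sqrt (1 - u ^+ 2).

Let mJ : measurable J. Proof. exact: measurable_itv. Qed.

Let lebJ : (leb J < +oo)%E.
Proof. by rewrite lebesgue_measure_itv /=; case: ifP => _; rewrite -?EFinB ltry. Qed.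

Let JP (u : R) : J u -> 0 <= 1 - u ^+ 2.
Proof. by rewrite /= in_itv /= => /andP[? ?]; nra. Qed.

(** Writing p = m + 3 turns the real exponent (p - 3)/2 into the natural power [m] of r = sqrt (1 -
    u^2), continuous up to the endpoints. *)
Let wE u : J u -> w u = r u ^+ m.
Proof.
move=> Ju; rewrite /w /r (_ : (p%:R - 3) / 2 = 2^-1 * m%:R); last first.
  by rewrite /p -addn3 natrD; ring.
by rewrite powRrM powR12_sqrt ?JP // powR_mulrn // sqrtr_ge0.
Qed.

Let r2 u : J u -> r u ^+ 2 = 1 - u ^+ 2.
Proof. by move=> Ju; rewrite sqr_sqrtr // JP. Qed.

Let cvg_r (u : R) : r z @[z --> u] --> r u.
Proof.
apply: (@cvg_comp _ _ _ (fun z : R => 1 - z ^+ 2) (@Num.sqrt R)); last exact: sqrt_continuous.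
by apply: cvgB; [exact: cvg_cst | apply: exprn_continuous].
Qed.

Let continuous_rX n : continuous (fun u => r u ^+ n : R).
Proof.
move=> u; apply: (@cvg_comp _ _ _ r (fun z : R => z ^+ n) _ _ _ (cvg_r (u := u))).
exact: exprn_continuous.
Qed.

Let is_derive_r (u : R) : u \in `]-1, 1[ -> is_derive u 1 r (- u / r u).
Proof.
rewrite in_itv /= => /andP[u1 u2].
have u0 : 0 < 1 - u ^+ 2 by nra.
have D1 : is_derive u 1 (fun z : R => 1 - z ^+ 2) (- (2 * u)).
  by apply: trigger_derive; rewrite /GRing.scale /=; ring.
have := @is_derive1_comp _ (@Num.sqrt R) (fun z : R => 1 - z ^+ 2) u _ _ (is_derive1_sqrt u0) D1.
have r0 : Num.sqrt (1 - u ^+ 2) != 0 by rewrite gt_eqF // sqrtr_gt0.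
by rewrite (_ : _ * _ = - u / r u) // /r; field.
Qed.

(** The exponent m + 2 makes the primitive vanish at -1 and 1 and cancels the 1 / r from the
    derivative of [r], so the result extends continuously to the closed interval. *)
Let primitive_derive j (u : R) : u \in `]-1, 1[ ->
  is_derive u 1 (fun z => z ^+ j * r z ^+ m.+2)
    (j%:R * u ^+ j.-1 * r u ^+ m.+2 - m.+2%:R * (u ^+ j.+1 * r u ^+ m)).
Proof.
move=> uJ; have D := is_derive_r uJ.
have r0 : r u != 0.
  by move: uJ; rewrite in_itv /= => /andP[u1 u2]; rewrite gt_eqF // sqrtr_gt0; nra.
have DX n (z : R) : is_derive z 1 (@GRing.exp R ^~ n) (n%:R * z ^+ n.-1).
  apply: DeriveDef; first exact: exprn_derivable.
  by rewrite exp_derive /GRing.scale /= mulr1.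
have D2 := is_derive1_comp (DX m.+2 (r u)) D.
apply: (@is_derive_eq _ _ _ _ _ _ _ _ (is_deriveM (DX j u) D2)).
by rewrite /GRing.scale /= !exprS; field.
Qed.

Let bounded_continuous (f : R -> R) : continuous f -> bddmeas J f.
Proof.
move=> cf; split.
  by apply: measurable_funS (continuous_measurable_fun cf).
have cJ : {within J, continuous f} by apply: continuous_subspaceT.
have [M [_ HM]] := @compact_bounded _ _ _ (continuous_compact cJ (@segment_compact R (-1) 1)).
exists (M + 1) => x Jx; apply: (HM (M + 1)); first by rewrite ltrDl.
by exists x.
Qed.

Let bdd_id : bddmeas J id.
Proof. by apply: bounded_continuous => x. Qed.

Let bdd_w : bddmeas J w.
Proof.
have [_ [M HM]] := bounded_continuous (@continuous_rX m).
split; last by exists M => x Jx; rewrite wE // HM.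
apply: measurable_funTS; apply: (@measurableT_comp _ _ _ _ _ _ (fun x : R => x `^ _)).
  exact: measurable_powR.
by apply: measurable_funB => //; exact: measurable_funX.
Qed.

Let primitive_integral j :
  Rintegral leb J (fun u => j%:R * u ^+ j.-1 * r u ^+ m.+2 - m.+2%:R * (u ^+ j.+1 * r u ^+ m)) = 0.
Proof.
pose F (z : R) := z ^+ j * r z ^+ m.+2.
have cF : continuous F.
  by move=> z; apply: cvgM; [exact: exprn_continuous | exact: continuous_rX].
pose f (u : R) := j%:R * u ^+ j.-1 * r u ^+ m.+2 - m.+2%:R * (u ^+ j.+1 * r u ^+ m).
have cf : continuous f.
  move=> z; apply: cvgB; apply: cvgM.
  - by apply: cvgM; [exact: cvg_cst | exact: exprn_continuous].
  - exact: continuous_rX.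
  - exact: cvg_cst.
  - by apply: cvgM; [exact: exprn_continuous | exact: continuous_rX].
rewrite /Rintegral (@continuous_FTC2 _ f F).
- have F0 z : z ^+ 2 = 1 -> F z = 0.
    by move=> z1; rewrite /F /r z1 subrr sqrtr0 exprS mul0r mulr0.
  by rewrite !F0 ?sqrrN ?expr1n // sube0.
- by [].
- exact: continuous_subspaceT.
- split.
  + by move=> x xJ; have := primitive_derive j xJ; case.
  + by apply: cvg_at_right_filter; exact: cF.
  + by apply: cvg_at_left_filter; exact: cF.
- by move=> x xJ; have D := primitive_derive j xJ; rewrite derive1E derive_val.
Qed.

Lemma projected_moments : sphere_moments leb J id p 1 w.
Proof.
have bw n j : bddmeas J (fun u => u ^+ j * r u ^+ n).
  by apply: bddmeasM; apply: bounded_continuous; [exact: exprn_continuous | exact: continuous_rX].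
have E j : Rintegral leb J (fun x => w x * x ^+ j) = Rintegral leb J (fun u => u ^+ j * r u ^+ m).
  by apply: eq_Rintegral => u; rewrite inE => Ju; rewrite wE // mulrC.
have P j : j%:R * Rintegral leb J (fun u => u ^+ j.-1 * r u ^+ m.+2) =
    m.+2%:R * Rintegral leb J (fun u => u ^+ j.+1 * r u ^+ m).
  have := primitive_integral j; rewrite (_ : (fun u => _) = (fun u =>
      j%:R * (u ^+ j.-1 * r u ^+ m.+2) - m.+2%:R * (u ^+ j.+1 * r u ^+ m))); last first.
    by apply/funext => u; rewrite -[in LHS]mulrA.
  rewrite (bddmeas_RintegralB (mu := leb) mJ lebJ (bddmeasZ _ (bw _ _)) (bddmeasZ _ (bw _ _))).
  rewrite !(bddmeas_RintegralZ (mu := leb) mJ lebJ _ (bw _ _)).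
  by move=> /eqP; rewrite subr_eq0 => /eqP.
split=> [|j].
  have := P 0; rewrite mul0r => /esym/eqP; rewrite mulf_eq0 pnatr_eq0 /= => /eqP P0.
  by rewrite -[RHS]P0 -E; congr Rintegral; apply/funext => u; rewrite expr1.
have := P j.+1; rewrite /= !E.
have -> : Rintegral leb J (fun u => u ^+ j * r u ^+ m.+2) =
   Rintegral leb J (fun u => u ^+ j * r u ^+ m) - Rintegral leb J (fun u => u ^+ j.+2 * r u ^+ m).
  rewrite -(bddmeas_RintegralB (mu := leb) mJ lebJ (bw m j) (bw m j.+2)).
  apply: eq_Rintegral => u; rewrite inE => Ju.
  by rewrite -addn2 exprD r2 // -(addn2 j) exprD; ring.
rewrite mulr1 mulrBr => H.
have -> : (p + j)%:R = m.+2%:R + j.+1%:R :> R by rewrite -natrD; congr (_%:R); rewrite /p; lia.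
by rewrite mulrC mulrDl -H; ring.
Qed.

Let Rintegral_lower (f : R -> R) (a b c : R) : bddmeas J f -> -1 <= a -> a < b -> b <= 1 ->
  0 <= c -> (forall u, J u -> 0 <= f u) -> (forall u, a <= u <= b -> c <= f u) ->
  c * (b - a) <= Rintegral leb J f.
Proof.
move=> bf a1 ab b1 c0 f0 fc.
have mI : measurable `[a, b]%classic by exact: measurable_itv.
have IJ : `[a, b]%classic `<=` J.
  by move=> u /=; rewrite !in_itv /= => /andP[? ?]; apply/andP; split; lra.
have bI : bddmeas J (fun u => c * \1_(`[a, b]%classic) u).
  apply: bddmeasZ; split; first exact: measurable_indic.
  by exists 1 => x _; rewrite indicE; case: (_ \in _); rewrite ?normr1 ?normr0.
have -> : c * (b - a) = Rintegral leb J (fun u => c * \1_(`[a, b]%classic) u).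
  rewrite (bddmeas_RintegralZ (mu := leb) mJ lebJ); last first.
    split; first exact: measurable_indic.
    by exists 1 => x _; rewrite indicE; case: (_ \in _); rewrite ?normr1 ?normr0.
  have H : leb `[a, b]%classic = (b - a)%:E.
    by rewrite lebesgue_measure_itv /= lte_fin ab -EFinB.
  congr (_ * _); rewrite /Rintegral integral_indic // setIidl //.
  exact: (esym (congr1 fine H)).
apply: (bddmeas_le_Rintegral (mu := leb) mJ lebJ) => // u Ju; rewrite indicE.
have [uI|uI] := boolP (u \in _); last by rewrite mulr0 f0.
by rewrite mulr1; apply: fc; move: uI; rewrite inE /= in_itv.
Qed.

Let w_lower (u : R) : -(1/2) <= u <= 1/2 -> (r (1/2)) ^+ m <= w u.
Proof.
move=> /andP[u1 u2]; rewrite wE; last by rewrite /= in_itv /=; apply/andP; split; lra.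
apply: lerXn2r; rewrite ?nnegrE ?sqrtr_ge0 //; rewrite ler_sqrt; nra.
Qed.

Let r_half : 0 < r (1/2).
Proof. by rewrite /r sqrtr_gt0; nra. Qed.

Let w_ge0 u : 0 <= w u. Proof. exact: powR_ge0. Qed.

Let I0_gt0 : 0 < Rintegral leb J w.
Proof.
apply: lt_le_trans (@Rintegral_lower w 0 (1/2) (r (1/2) ^+ m) bdd_w _ _ _ _ _ _) => //;
  try lra.
- by rewrite mulr_gt0 ?exprn_gt0 //; lra.
- by rewrite exprn_ge0 // ltW.
- by move=> u /andP[u0 u1]; apply: w_lower; lra.
Qed.

Variable k : R.
Hypothesis k0 : 0 < k.

Let Hexp := sphere_moments_exp (mu := leb) mJ lebJ bdd_id k (isT : 0 < p)%N bdd_w projected_moments.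

Lemma cpk_gt0 : 0 < cpk p k.
Proof.
have h0 : 0 < hyp p (k ^+ 2) by apply: hyp_gt0 => //; exact: sqr_ge0.
by rewrite /cpk Hexp mul1r invr_gt0 mulr_gt0.
Qed.

(** Integration by parts gives (p - 1) e1 = k E(1 - U^2), and 1 - U^2 shifts the dimension by two.
    The same ratio comes out of the sphere average, which ties [e1] to the observations. *)
Lemma e1E : (p%:R - 1) * e1 p k / k = (p%:R - 1) / p%:R * (hyp p.+2 (k ^+ 2) / hyp p (k ^+ 2)).
Proof.
have h0 : 0 < hyp p (k ^+ 2) by apply: hyp_gt0 => //; exact: sqr_ge0.
have ibp := sphere_moments_ibp (mu := leb) mJ lebJ bdd_id k (isT : 0 < p)%N bdd_w projected_moments.
have bU2 : bddmeas J (fun u => w u * (1 - u ^+ 2)).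
  by apply: bddmeasM => //; apply: bddmeasB; [exact: bddmeas_cst | exact: (bddmeasX 2 bdd_id)].
have := sphere_moments_exp (mu := leb) mJ lebJ bdd_id k (isT : 0 < p.+2)%N bU2
  (sphere_moments_complement (mu := leb) mJ lebJ bdd_id (isT : 0 < p)%N bdd_w projected_moments).
have := sphere_moments_complement_eq (mu := leb) mJ lebJ bdd_id 0 (isT : 0 < p)%N bdd_w projected_moments.
under eq_Rintegral do rewrite expr0 mulr1.
under [X in _ = _ * X -> _]eq_Rintegral do rewrite expr0 mulr1.
rewrite addn0 !mul1r => -> E2; rewrite E2 in ibp.
have -> : e1 p k = cpk p k * Rintegral leb J (fun x => w x * id x * expR (k * id x)).
  by rewrite /e1 /umom; congr (_ * Rintegral _ _ _); apply/funext => u; rewrite /= [u * _]mulrC.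
have i0 := I0_gt0.
have -> : cpk p k = (Rintegral leb J w * hyp p (k ^+ 2))^-1.
  by rewrite /cpk Hexp mul1r.
rewrite mulrCA ibp; field.
by rewrite !gt_eqF.
Qed.

Lemma e1_gt0 : 0 < e1 p k.
Proof.
have h0 : 0 < hyp p (k ^+ 2) by apply: hyp_gt0 => //; exact: sqr_ge0.
have h2 : 0 < hyp p.+2 (k ^+ 2) by apply: hyp_gt0 => //; exact: sqr_ge0.
have p1 : 0 < p%:R - 1 :> R by rewrite subr_gt0 ltr1n.
have : 0 < (p%:R - 1) * e1 p k / k by rewrite e1E !mulr_gt0 ?invr_gt0.
by rewrite pmulr_lgt0 ?invr_gt0 // pmulr_rgt0.
Qed.

Lemma et2_gt0 : 0 < et2 p k.
Proof.
rewrite /et2 /umom; apply: mulr_gt0; first exact: cpk_gt0.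
have e0 := e1_gt0; set e := e1 p k in e0 *.
have bf : bddmeas J (fun u => (u - e) ^+ 2 * w u * expR (k * u)).
  apply: bddmeasM.
    apply: bddmeasM => //; apply: bddmeasX; apply: bddmeasB => //; exact: bddmeas_cst.
  by apply: bddmeas_expR; exact: bddmeasZ.
have c0 : 0 < (1/4) ^+ 2 * r (1/2) ^+ m * expR (- k).
  by rewrite !mulr_gt0 ?expR_gt0 ?exprn_gt0 //; lra.
(* As [e1] is positive, (u - e)^2 is at least 1/16 on [-1/2, -1/4]; the other factors are bounded
   below by their values at 1/2 and -1. *)
apply: lt_le_trans (@Rintegral_lower _ (-(1/2)) (-(1/4)) _ bf _ _ _ (ltW c0) _ _); try lra.
- move=> u _; apply: mulr_ge0; last exact: expR_ge0.
  by apply: mulr_ge0; [exact: sqr_ge0 | exact: w_ge0].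
- move=> u /andP[u1 u2].
  have rm : 0 <= r (1/2) ^+ m by rewrite exprn_ge0 // ltW.
  apply: ler_pM; [by apply: mulr_ge0 => //; exact: sqr_ge0 | exact: expR_ge0 | | ].
    apply: ler_pM; [exact: sqr_ge0 | by [] | by nra | ].
    by apply: w_lower; apply/andP; split; lra.
  rewrite ler_expR -subr_ge0 (_ : _ - _ = k * (u + 1)); last by ring.
  by rewrite mulr_ge0 //; [exact: ltW | lra].
Qed.

End Projected.

(** * Moments of the Fisher-von Mises-Langevin distribution *)

Section Fvml.
Variables (R : realType) (p : nat) (t : 'cV[R]_p) (k : R).
Variable sigma : {measure set (vecT R p) -> \bar R}.
Hypotheses (p2 : (2 < p)%N) (tt1 : dotv t t = 1) (k0 : 0 < k).
Hypothesis Hsigma : is_surface_measure sigma.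
Context d (Omega : measurableType d) (P : probability Omega R) (n : nat)
  (X : 'I_n -> Omega -> vecT R p).
Hypothesis HX : iid_FvML P X sigma t k.
Implicit Types (h : vecT R p -> R) (i : 'I_n).

Notation S := (@sphere R p : set (vecT R p)).
Let SI (g : vecT R p -> R) := Rintegral sigma S g.
Let U (x : vecT R p) := dotv (x : 'cV[R]_p) t.
Let e (x : vecT R p) := expR (k * U x).
Let c := cpk p k / omega R p.-1.
(** Multiplying by this indicator makes linear forms bounded on the whole space, as the product rule
    for independent variables requires, and changes nothing almost surely. *)
Definition sphere_ind (x : vecT R p) : R := \1_S x.
Let E i h := Rintegral P setT (h \o X i).

Let mS : measurable S. Proof. exact: measurable_sphere. Qed.

Let sigmaS : (sigma S < +oo)%E.
Proof.
have [_ sT _] := Hsigma; apply: le_lt_trans (_ : sigma setT < +oo)%E; last by rewrite sT ltry.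
by apply: le_measure; rewrite ?inE.
Qed.

Let PT : (P setT < +oo)%E. Proof. by rewrite probability_setT ltry. Qed.

Let mX i : measurable_fun setT (X i). Proof. by case: HX. Qed.

Lemma measurable_dotv_id (a : 'cV[R]_p) :
  measurable_fun setT (fun x : vecT R p => dotv (x : 'cV[R]_p) a).
Proof. by apply: (measurable_dotv a) => //; exact: measurable_id. Qed.

Lemma bddmeas_dotv_sphere (a : 'cV[R]_p) : bddmeas S (fun x : vecT R p => dotv (x : 'cV[R]_p) a).
Proof.
split; first exact: measurable_funTS (measurable_dotv_id a).
exists ((1 + dotv a a) / 2) => x /sphereP x1.
by have := dotv_norm_le (x : 'cV[R]_p) a; rewrite x1.
Qed.

Lemma bddmeas_sphere_ind : bddmeas setT sphere_ind.
Proof.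
split; first exact: measurable_indic.
by exists 1 => x _; rewrite /sphere_ind indicE; case: (_ \in _); rewrite ?normr1 ?normr0.
Qed.

Lemma bddmeas_sphere_ind_dotv a : bddmeas setT (fun x : vecT R p => sphere_ind x * dotv (x : 'cV[R]_p) a).
Proof.
split; first by apply: measurable_funM (measurable_dotv_id a); case: bddmeas_sphere_ind.
have [_ [M HM]] := bddmeas_dotv_sphere a.
exists (Num.max 0 M) => x _; rewrite /sphere_ind indicE.
have [|] := boolP (x \in S) => [/set_mem Sx|_].
  by rewrite mul1r le_max HM ?orbT.
by rewrite mul0r normr0 le_max lexx.
Qed.

Let be : bddmeas S e.
Proof. by apply: bddmeas_expR; apply: bddmeasZ; exact: bddmeas_dotv_sphere. Qed.

Lemma fvml_density_ge0 x : 0 <= fvml_density t k x.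
Proof.
rewrite /fvml_density mulr_ge0 ?expR_ge0 // divr_ge0 //.
  rewrite /cpk invr_ge0; apply: Rintegral_ge0 => u _.
  by rewrite mulr_ge0 ?powR_ge0 ?expR_ge0.
rewrite /omega divr_ge0 ?mulr_ge0 ?powR_ge0 //.
by apply: Rintegral_ge0 => u _; rewrite mulr_ge0 ?powR_ge0 ?expR_ge0.
Qed.

Let mdens : measurable_fun setT (fun x : vecT R p => fvml_density t k (x : 'cV[R]_p)).
Proof.
apply: measurable_funM => //; apply: measurableT_comp => //.
by apply: measurable_funM => //; exact: measurable_dotv_id.
Qed.

Let expect_ge0 i h : bddmeas setT h -> (forall x, 0 <= h x) ->
  E i h = c * SI (fun x => h x * e x).
Proof.
move=> [mh [M hM]] h0; have [_ _ law] := HX.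
have mEh : measurable_fun setT (EFin \o h) by exact/measurable_EFinP.
have HB B : measurable B -> (\int[P]_x ((\1_B (X i x))%:E * (cst 1 x)%:E) =
    \int[sigma]_x ((\1_B (id x))%:E * (fvml_density t k (x : 'cV[R]_p))%:E))%E.
  move=> mB; transitivity (P (X i @^-1` B)).
    under eq_integral do rewrite /cst mule1.
    rewrite (@integral_indic _ _ _ P setT measurableT (X i @^-1` B)) ?setIT //.
    by rewrite -[X in measurable X]setTI; exact: mX.
  rewrite (law i B mB) integral_mkcond; apply: eq_integral => x _.
  by rewrite patchE indicE; case: (x \in B); rewrite ?mul1e ?mul0e.
have H := @integral_transfer_ge0 _ _ _ _ _ _ _ P sigma (X i) id (cst 1)
  (fun x : vecT R p => fvml_density t k (x : 'cV[R]_p)) (mX i) (@measurable_id _ _ _)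
  (@measurable_cst _ _ _ _ _ _) mdens (fun _ => ler01) fvml_density_ge0 HB (EFin \o h) mEh
  (fun y => h0 y).
have [s0 _ _] := Hsigma.
have bh : bddmeas S h by split; [exact: measurable_funTS | exists M => x _; exact: hM].
rewrite /SI -(bddmeas_RintegralZ mS sigmaS c (bddmeasM bh be)).
rewrite (_ : (fun x => c * _) = (fun x => h x * fvml_density t k x)); last first.
  by apply/funext => x; rewrite /fvml_density -/c /e mulrCA.
rewrite -(Rintegral_conull mS s0); last exact: measurable_funM.
rewrite /E /Rintegral; congr fine.
transitivity (\int[P]_x ((EFin \o h) (X i x) * (cst 1 x)%:E))%E.
  by apply: eq_integral => w _; rewrite /= mule1.
by rewrite H.
Qed.

Let E_cst i (a : R) : E i (cst a) = a.
Proof.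
rewrite /E (_ : cst a \o X i = cst a) // Rintegral_cst //.
by rewrite [fine _](congr1 fine (@probability_setT _ _ _ P)) mulr1.
Qed.

(** The law of one observation has total mass one. *)
Let cSI i : c * SI e = 1.
Proof.
have := expect_ge0 i (bddmeas_cst setT 1) (fun _ => ler01); rewrite E_cst => ->.
by congr (_ * Rintegral _ _ _); apply/funext => x; rewrite mul1r.
Qed.

(** Adding the bound [M] makes [h] nonnegative; the normalisation removes the same constant from
    both sides. *)
Lemma expect_sphere i h : bddmeas setT h ->
  Rintegral P setT (h \o X i) = c * SI (fun x => h x * e x).
Proof.
move=> bh; have [mh [M hM]] := bh.
have bE : bddmeas setT (h \o X i).
  by split; [exact: measurableT_comp | exists M => x _; exact: hM].
have bS : bddmeas S h by split; [exact: measurable_funTS | exists M => x _; exact: hM].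
have H : E i (fun x => h x + M) = c * SI (fun x => (h x + M) * e x).
  apply: expect_ge0; first by apply: bddmeasD => //; exact: bddmeas_cst.
  by move=> x; have := hM x I; rewrite ler_norml => /andP[]; rewrite -subr_ge0 opprK.
move: H; rewrite (_ : E i _ = E i h + M); last first.
  rewrite -[in RHS](E_cst i M).
  exact: (bddmeas_RintegralD (mu := P) measurableT PT bE (bddmeas_cst _ M)).
rewrite (_ : SI _ = SI (fun x => h x * e x) + M * SI e); last first.
  rewrite -(bddmeas_RintegralZ mS sigmaS M be).
  rewrite -(bddmeas_RintegralD mS sigmaS (bddmeasM bS be) (bddmeasZ M be)).
  by congr Rintegral; apply/funext => x; rewrite mulrDl.
by rewrite mulrDr mulrCA (cSI i) mulr1 => /addIr.
Qed.

Let sigma_inv (O : 'M[R]_p) (g : vecT R p -> R) : O *m O^T = 1%:M ->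
  measurable_fun setT g -> measurable_fun setT (fun x : vecT R p => g (O *m (x : 'cV[R]_p))) ->
  SI (fun x => g (O *m (x : 'cV[R]_p))) = SI g.
Proof.
move=> OO mg mgO; have [s0 _ inv] := Hsigma.
rewrite /SI -!(Rintegral_conull mS s0) //.
apply: (@Rintegral_transfer _ _ _ _ _ R R sigma sigma _ _ mgO mg id) => // B mB.
rewrite -(inv O OO (g @^-1` B)) //.
by rewrite -[X in measurable X]setTI; exact: mg.
Qed.

Let mdot_mul (O : 'M[R]_p) (a : 'cV[R]_p) :
  measurable_fun setT (fun x : vecT R p => dotv (O *m (x : 'cV[R]_p)) a).
Proof.
rewrite (_ : (fun x => _) = (fun x : vecT R p => dotv (x : 'cV[R]_p) (O^T *m a))).
  exact: measurable_dotv_id.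
by apply/funext => x; rewrite dotv_mulmx.
Qed.

Let dot_inv (O : 'M[R]_p) a (f : R -> R -> R) : O *m O^T = 1%:M -> O^T *m t = t ->
  (forall g1 g2 : vecT R p -> R, measurable_fun setT g1 -> measurable_fun setT g2 ->
     measurable_fun setT (fun x => f (g1 x) (g2 x))) ->
  SI (fun x => f (dotv (x : 'cV[R]_p) (O^T *m a)) (U x)) =
  SI (fun x => f (dotv (x : 'cV[R]_p) a) (U x)).
Proof.
move=> OO Ot mf.
rewrite -(@sigma_inv O (fun x => f (dotv (x : 'cV[R]_p) a) (U x))) //.
- by congr Rintegral; apply/funext => x; rewrite /U !dotv_mulmx Ot.
- by apply: mf; exact: measurable_dotv_id.
- by apply: (mf (fun x : vecT R p => dotv (O *m (x : 'cV[R]_p)) a)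
    (fun x : vecT R p => dotv (O *m (x : 'cV[R]_p)) t)); exact: mdot_mul.
Qed.

Let moments1 : sphere_moments sigma S U p 1 (cst 1).
Proof.
have := @rotation_sphere_moments _ _ R p p sigma S mS sigmaS (fun x => (x : 'cV[R]_p))
  1%:M 1 (trmx1 _ _) (mul1mx _) (mxtrace1 _ _) bddmeas_dotv_sphere
  (fun x _ => mul1mx _) (fun x Sx => (sphereP x).1 Sx) _ t (mul1mx _).
rewrite tt1 mulr1; apply=> a b _ _ ab j.
have [V [OO Oa _]] := exists_swap ab.
have [s0 _ inv] := Hsigma; rewrite -Oa.
rewrite -[LHS](@sigma_inv V (fun x => dotv (x : 'cV[R]_p) a ^+ j)) //.
- by congr Rintegral; apply/funext => x; rewrite dotv_mulmx.
- by apply: measurable_funX; exact: measurable_dotv_id.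
- by apply: measurable_funX; exact: mdot_mul.
Qed.

Let bU : bddmeas S U. Proof. exact: bddmeas_dotv_sphere. Qed.

Let bU2 n' : bddmeas S (fun x => (1 - U x ^+ 2) ^+ n').
Proof.
by apply: bddmeasX; apply: bddmeasB; [exact: bddmeas_cst | exact: bddmeasX].
Qed.

Let p0 : (0 < p)%N. Proof. exact: ltn_trans p2. Qed.
Let pR0 : 0 < p%:R :> R. Proof. by rewrite ltr0n. Qed.

Definition proj_ind (x : vecT R p) : R := sphere_ind x * U x.

Let ind1 x : S x -> sphere_ind x = 1.
Proof. by move=> Sx; rewrite /sphere_ind indicE mem_set. Qed.

Let bproj : bddmeas setT (fun x => 1 - proj_ind x ^+ 2).
Proof.
apply: bddmeasB; first exact: bddmeas_cst.
by apply: bddmeasX; exact: bddmeas_sphere_ind_dotv.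
Qed.

Let r2 := hyp p.+2 (k ^+ 2) / hyp p (k ^+ 2).
Let r4 := hyp p.+4 (k ^+ 2) / hyp p (k ^+ 2).
Let S1 := Rintegral sigma S (cst 1).

Let SI_e : SI e = S1 * hyp p (k ^+ 2).
Proof.
have := sphere_moments_exp mS sigmaS bU k p0 (bddmeas_cst S 1) moments1.
by rewrite mul1r => <-; congr Rintegral; apply/funext => x; rewrite mul1r.
Qed.

Let cS1 i : c * S1 = (hyp p (k ^+ 2))^-1.
Proof.
have h0 : hyp p (k ^+ 2) != 0 by rewrite gt_eqF // hyp_gt0 // sqr_ge0.
by apply: (mulIf h0); rewrite mulVf // -mulrA -SI_e (cSI i).
Qed.

Let moments2 : sphere_moments sigma S U p.+2 1 (fun x => (1 - U x ^+ 2) ^+ 1).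
Proof.
have := sphere_moments_complement mS sigmaS bU p0 (bddmeas_cst S 1) moments1.
by congr sphere_moments; apply/funext => x; rewrite mul1r expr1.
Qed.

Let moments4 : sphere_moments sigma S U p.+4 1 (fun x => (1 - U x ^+ 2) ^+ 2).
Proof.
have := sphere_moments_complement mS sigmaS bU (isT : 0 < p.+2)%N (bU2 1) moments2.
by congr sphere_moments; apply/funext => x; rewrite expr1 expr2.
Qed.

Let S2E : SI (fun x => (1 - U x ^+ 2) ^+ 1) = (p%:R - 1) / p%:R * S1.
Proof.
have := sphere_moments_complement_eq mS sigmaS bU 0 p0 (bddmeas_cst S 1) moments1.
rewrite addn0 mul1r => H; rewrite /S1 /SI.
rewrite (_ : (fun x => (1 - U x ^+ 2) ^+ 1) = (fun x => cst 1 x * (1 - U x ^+ 2) * U x ^+ 0)).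
  by rewrite H; congr (_ * Rintegral _ _ _); apply/funext => x; rewrite expr0 mulr1.
by apply/funext => x; rewrite expr0 expr1 mul1r mulr1.
Qed.

Let S4E : SI (fun x => (1 - U x ^+ 2) ^+ 2) = (p.+2%:R - 1) / p.+2%:R * ((p%:R - 1) / p%:R * S1).
Proof.
have := sphere_moments_complement_eq mS sigmaS bU 0 (isT : 0 < p.+2)%N (bU2 1) moments2.
rewrite addn0 mul1r -S2E => H; rewrite /SI.
rewrite (_ : (fun x => (1 - U x ^+ 2) ^+ 2) =
    (fun x => (1 - U x ^+ 2) ^+ 1 * (1 - U x ^+ 2) * U x ^+ 0)).
  by rewrite H; congr (_ * Rintegral _ _ _); apply/funext => x; rewrite expr0 mulr1.
by apply/funext => x; rewrite expr0 expr1 mulr1.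
Qed.

Let E_proj i n' : Rintegral P setT (fun w => (1 - proj_ind (X i w) ^+ 2) ^+ n') =
  c * SI (fun x => (1 - U x ^+ 2) ^+ n' * e x).
Proof.
apply: etrans (expect_sphere i (bddmeasX n' bproj)) _.
congr (_ * _); apply: eq_Rintegral => x; rewrite inE => Sx.
by rewrite /proj_ind ind1 // mul1r.
Qed.

Let f2E i : Rintegral P setT (fun w => 1 - proj_ind (X i w) ^+ 2) = (p%:R - 1) / p%:R * r2.
Proof.
apply: etrans (E_proj i 1) _.
have H := sphere_moments_exp mS sigmaS bU k (isT : 0 < p.+2)%N (bU2 1) moments2.
by rewrite /SI H -/(SI _) S2E mul1r mulrA [_ * S1]mulrC mulrA (cS1 i) /r2; ring.
Qed.

Let f4E i : Rintegral P setT (fun w => (1 - proj_ind (X i w) ^+ 2) ^+ 2) =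
  (p%:R + 1) / (p%:R + 2) * ((p%:R - 1) / p%:R) * r4.
Proof.
rewrite E_proj.
have H := sphere_moments_exp mS sigmaS bU k (isT : 0 < p.+4)%N (bU2 2) moments4.
rewrite /SI H -/(SI _) S4E mul1r /r4.
have -> : p.+2%:R = p%:R + 2 :> R by rewrite -addn2 natrD.
have -> : p%:R + 2 - 1 = p%:R + 1 :> R by ring.
transitivity ((p%:R + 1) / (p%:R + 2) * ((p%:R - 1) / p%:R) * (hyp p.+4 (k ^+ 2) * (c * S1))).
  by ring.
by rewrite (cS1 i).
Qed.

Lemma expect_perp i :
  Rintegral P setT (fun w => 1 - proj_ind (X i w) ^+ 2) = (p%:R - 1) * e1 p k / k.
Proof.
rewrite f2E; have [m pm] : exists m, p = m.+3 by exists (p - 3)%N; lia.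
by rewrite /r2 pm e1E.
Qed.

(** The relative variance of 1 - U^2 is O(1/p) uniformly in [k]. The Turan bound contributes 1 +
    4/p; raising 4 to 8 absorbs the rational prefactors for p >= 3. *)
Lemma expect_perp2 i :
  Rintegral P setT (fun w => (1 - proj_ind (X i w) ^+ 2) ^+ 2) <=
  (1 + 8 / p%:R) * Rintegral P setT (fun w => 1 - proj_ind (X i w) ^+ 2) ^+ 2.
Proof.
rewrite f2E f4E /r2 /r4.
have A0 : 0 < hyp p (k ^+ 2) by apply: hyp_gt0 => //; exact: sqr_ge0.
have tur := hyp_turan p0 (sqr_ge0 k).
have B0 : 0 < hyp p.+2 (k ^+ 2) by apply: hyp_gt0 => //; exact: sqr_ge0.
have p3 : 3 <= p%:R :> R by rewrite ler_nat.
move: (hyp p (k ^+ 2)) (hyp p.+2 (k ^+ 2)) (hyp p.+4 (k ^+ 2)) (p%:R) pR0 A0 B0 tur p3 =>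
  A B C x x0 A0 B0 tur x3.
have -> : (1 + 8 / x) * ((x - 1) / x * (B / A)) ^+ 2 =
  (1 + 8 / x) * ((x - 1) / x) ^+ 2 / A ^+ 2 * B ^+ 2 by field; rewrite !gt_eqF.
have -> : (x + 1) / (x + 2) * ((x - 1) / x) * (C / A) =
  (x + 1) / (x + 2) * ((x - 1) / x) / A ^+ 2 * (A * C).
  by field; rewrite !gt_eqF //; lra.
apply: (@le_trans _ _ ((x + 1) / (x + 2) * ((x - 1) / x) / A ^+ 2 * ((1 + 4 / x) * B ^+ 2))).
  by apply: ler_wpM2l => //; rewrite !mulr_ge0 ?invr_ge0 ?sqr_ge0 //; lra.
rewrite -subr_ge0 [X in 0 <= X](_ : _ =
  (x - 1) * (4 * x ^+ 2 + 2 * x - 16) / (x + 2) / x ^+ 3 / A ^+ 2 * B ^+ 2); last first.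
  by field; rewrite !gt_eqF //; lra.
by rewrite !mulr_ge0 ?invr_ge0 ?sqr_ge0 ?exprn_ge0 //; nra.
Qed.

Definition comp_ind (a : 'cV[R]_p) (x : vecT R p) : R := sphere_ind x * dotv (x : 'cV[R]_p) a.

(** The negated reflection along [t] fixes [t] and reverses its orthogonal complement. *)
Lemma expect_comp i a : dotv t a = 0 -> Rintegral P setT (fun w => comp_ind a (X i w)) = 0.
Proof.
move=> ta; apply: etrans (expect_sphere i (bddmeas_sphere_ind_dotv a)) _.
have -> : SI (fun x => sphere_ind x * dotv (x : 'cV[R]_p) a * e x) =
    SI (fun x => dotv (x : 'cV[R]_p) a * expR (k * U x)).
  by apply: eq_Rintegral => x; rewrite inE => Sx; rewrite ind1 // mul1r.
have t0 : t != 0 by rewrite -dotv_eq0 tt1 oner_eq0.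
have Ot : (- reflection t)^T *m t = t.
  by rewrite linearN /= tr_reflection mulNmx reflection_mul tt1 divr1 mulr1 scaler_nat mulr2n opprB addrK.
have OO : (- reflection t) *m (- reflection t)^T = 1%:M.
  by rewrite linearN /= tr_reflection mulmxN mulNmx opprK reflectionK.
have mf (g1 g2 : vecT R p -> R) : measurable_fun setT g1 -> measurable_fun setT g2 ->
     measurable_fun setT (fun x => g1 x * expR (k * g2 x)).
  move=> m1 m2; apply: measurable_funM => //; apply: measurableT_comp => //.
  exact: measurable_funM.
pose I0 := SI (fun x => dotv (x : 'cV[R]_p) a * expR (k * U x)).
have H : SI (fun x => dotv (x : 'cV[R]_p) (- a) * expR (k * U x)) = I0.
  have := @dot_inv _ a (fun y u => y * expR (k * u)) OO Ot mf.
  by rewrite linearN /= tr_reflection mulNmx reflection_fix.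
have HN : SI (fun x => dotv (x : 'cV[R]_p) (- a) * expR (k * U x)) = - I0.
  rewrite /I0 -mulN1r /SI -(bddmeas_RintegralZ mS sigmaS); last first.
    by apply: bddmeasM be; exact: bddmeas_dotv_sphere.
  by congr Rintegral; apply/funext => x; rewrite dotvNr; ring.
by rewrite -/I0 (_ : I0 = 0) ?mulr0 //; lra.
Qed.

Let Qf a := SI (fun x => dotv (x : 'cV[R]_p) a ^+ 2 * e x).

Let bQ a b : bddmeas S (fun x : vecT R p => dotv (x : 'cV[R]_p) a * dotv (x : 'cV[R]_p) b * e x).
Proof. by do 2 apply: bddmeasM => //; exact: bddmeas_dotv_sphere. Qed.

Let bQ2 a : bddmeas S (fun x : vecT R p => dotv (x : 'cV[R]_p) a ^+ 2 * e x).
Proof. by apply: bddmeasM be; apply: bddmeasX; exact: bddmeas_dotv_sphere. Qed.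

Let Qf_scale s a : Qf (s *: a) = s ^+ 2 * Qf a.
Proof.
rewrite /Qf /SI -(bddmeas_RintegralZ mS sigmaS _ (bQ2 a)).
by congr Rintegral; apply/funext => x; rewrite dotvZr; ring.
Qed.

Let Qf_inv a b : dotv t a = 0 -> dotv t b = 0 -> dotv a a = dotv b b -> Qf a = Qf b.
Proof.
move=> ta tb ab; have [V [OO Oa Ot]] := exists_swap ab.
rewrite /Qf -Oa -(@dot_inv V a (fun y u => y ^+ 2 * expR (k * u))) //; first exact: Ot.
move=> g1 g2 m1 m2; apply: measurable_funM; first exact: measurable_funX.
by apply: measurableT_comp => //; exact: measurable_funM.
Qed.

(** The quadratic form is isotropic on the complement of [t]. Summed over the projected basis it
    gives |x|^2 - U^2, while the squared lengths sum to p - 1. *)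
Let QfE a : dotv t a = 0 -> (p%:R - 1) * Qf a = dotv a a * SI (fun x => (1 - U x ^+ 2) * e x).
Proof.
move=> ta; pose b (i : 'I_p) : 'cV[R]_p := perp_proj t *m delta_mx i 0.
have tb (i : 'I_p) : dotv t (b i) = 0 by exact: dotv_perp_proj.
have H (i : 'I_p) : dotv (b i) (b i) * Qf a = dotv a a * Qf (b i).
  (* Scaling each of the two vectors by the length of the other makes their lengths equal, even if
     one of them is zero. *)
  rewrite -(sqr_enorm (b i)) -(sqr_enorm a) -!Qf_scale; apply: Qf_inv.
  - by rewrite dotvZr ta mulr0.
  - by rewrite dotvZr tb mulr0.
  - by rewrite !dotvZr !dotvZl -!sqr_enorm; ring.
have sb : \sum_(i < p) dotv (b i) (b i) = p%:R - 1.
  rewrite -(trace_perp_proj tt1) /mxtrace; apply: eq_bigr => i _.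
  rewrite /b dotv_mulmx tr_perp_proj mulmxA perp_projK // -colE dotvE (bigD1 i) //= big1 => [|j ji].
    by rewrite !mxE !eqxx mul1r addr0.
  by rewrite mxE (negbTE ji) mul0r.
rewrite -sb mulr_suml (eq_bigr (fun i : 'I_p => dotv a a * Qf (b i))) // -mulr_sumr; congr (_ * _).
rewrite /Qf -(bddmeas_Rintegral_sum mS sigmaS) //.
apply: eq_Rintegral => x; rewrite inE => /sphereP Sx.
rewrite -mulr_suml; congr (_ * _).
rewrite -Sx (_ : dotv _ _ - _ = dotv (perp_proj t *m (x : 'cV[R]_p)) (perp_proj t *m (x : 'cV[R]_p))).
  rewrite -sum_sqr_dotv_delta; apply: eq_bigr => i _.
  by rewrite /b dotv_mulmx tr_perp_proj.
by rewrite sqr_perp_proj // /U dotvC (dotvC t).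
Qed.

(** Polarisation of the isotropic quadratic form. *)
Lemma expect_comp2 i a b : dotv t a = 0 -> dotv t b = 0 ->
  Rintegral P setT (fun w => comp_ind a (X i w) * comp_ind b (X i w)) =
  dotv a b / (p%:R - 1) * Rintegral P setT (fun w => 1 - proj_ind (X i w) ^+ 2).
Proof.
move=> ta tb.
have p1 : 0 < p%:R - 1 :> R by rewrite subr_gt0 ltr1n; exact: ltnW.
rewrite [Rintegral P setT (fun w => 1 - _)](E_proj i 1).
apply: etrans (expect_sphere i (bddmeasM (bddmeas_sphere_ind_dotv a) (bddmeas_sphere_ind_dotv b))) _.
rewrite mulrCA; congr (_ * _).
have -> : SI (fun x => sphere_ind x * dotv (x : 'cV[R]_p) a * (sphere_ind x * dotv (x : 'cV[R]_p) b) * e x) =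
    SI (fun x => dotv (x : 'cV[R]_p) a * dotv (x : 'cV[R]_p) b * e x).
  by apply: eq_Rintegral => x; rewrite inE => Sx; rewrite ind1 // !mul1r.
set N := SI (fun x => (1 - U x ^+ 2) ^+ 1 * e x).
have NE : N = SI (fun x => (1 - U x ^+ 2) * e x).
  by congr (SI _); apply/funext => x; rewrite expr1.
have QN v : dotv t v = 0 -> Qf v = dotv v v / (p%:R - 1) * N.
  move=> tv; have p1' : p%:R - 1 != 0 :> R by rewrite gt_eqF.
  apply: (mulfI p1'); rewrite QfE // -NE; move: (_ - 1) p1' => z z0; by field.
have pol : Qf (a + b) = Qf a + Qf b + 2 * SI (fun x => dotv (x : 'cV[R]_p) a * dotv (x : 'cV[R]_p) b * e x).
  rewrite /Qf /SI -(bddmeas_RintegralZ mS sigmaS _ (bQ a b)).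
  rewrite -(bddmeas_RintegralD mS sigmaS (bQ2 a) (bQ2 b)).
  rewrite -(bddmeas_RintegralD mS sigmaS (bddmeasD (bQ2 a) (bQ2 b)) (bddmeasZ 2 (bQ a b))).
  by congr Rintegral; apply/funext => x; rewrite dotvDr; ring.
move: pol; rewrite !QN ?dotvDr ?ta ?tb ?addr0 // !dotvDl (dotvC b a) => pol.
have {pol} : 2 * SI (fun x => dotv (x : 'cV[R]_p) a * dotv (x : 'cV[R]_p) b * e x) =
  2 * (dotv a b / (p%:R - 1) * N) by lra.
by move=> /(mulfI (_ : 2 != 0 :> R)); apply.
Qed.

End Fvml.

(** * Second moments of sums over an independent sample *)

Section SecondMoments.
Context d d' (Omega : measurableType d) (S : measurableType d') (R : realType).
Variables (P : probability Omega R) (n : nat) (X : 'I_n -> Omega -> S).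
Hypothesis mX : forall i, measurable_fun setT (X i).
Hypothesis indX : forall B : 'I_n -> set S, (forall i, measurable (B i)) ->
  P (\bigcap_i (X i @^-1` B i)) = (\prod_i P (X i @^-1` B i))%E.
Implicit Types (f g : S -> R) (i j : 'I_n).

Let E (f : Omega -> R) := Rintegral P setT f.
Let bm (g : S -> R) := bddmeas setT g.

Let PT : (P setT < +oo)%E. Proof. by rewrite probability_setT ltry. Qed.

Lemma bddmeas_comp g i : bddmeas setT g -> bddmeas setT (fun w => g (X i w)).
Proof.
move=> [mg [M Mg]]; split; first exact: measurableT_comp.
by exists M => w _; exact: Mg.
Qed.

(** A function of one observation is padded by ones to a family indexed by all observations, the
    format of the product rule. *)
Let slot i g (m : 'I_n) (x : S) : R := if m == i then g x else 1.

Let bslot i g m : bm g -> bm (slot i g m).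
Proof.
by move=> bg; rewrite /slot; case: (m == i); [exact: bg | exact: bddmeas_cst].
Qed.

Let prod_slot i g w : \prod_m slot i g m (X m w) = g (X i w).
Proof. by rewrite -big_mkcond /= big_pred1_eq. Qed.

Let E_cst (a : R) : E (cst a) = a.
Proof.
rewrite /E Rintegral_cst //.
by rewrite [fine _](congr1 fine (@probability_setT _ _ _ P)) mulr1.
Qed.

Lemma expectation_pair i j f g : i != j -> bddmeas setT f -> bddmeas setT g ->
  Rintegral P setT (fun w => f (X i w) * g (X j w)) =
  Rintegral P setT (fun w => f (X i w)) * Rintegral P setT (fun w => g (X j w)).
Proof.
move=> ij bf bg.
have := @expectation_prod _ _ _ _ R P n X mX indX (fun m x => slot i f m x * slot j g m x)
  (fun m => bddmeasM (bslot i m bf) (bslot j m bg)).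
rewrite (_ : (fun w => \prod_i0 _) = (fun w => f (X i w) * g (X j w))); last first.
  by apply/funext => w; rewrite big_split /= !prod_slot.
move=> ->; rewrite (bigD1 i) //= (bigD1 j) 1?eq_sym //= big1 ?mulr1; last first.
  move=> m /andP[mi mj]; rewrite -[RHS]E_cst; congr Rintegral; apply/funext => w /=.
  by rewrite /slot (negbTE mi) (negbTE mj) mulr1.
by congr (_ * _); congr Rintegral; apply/funext => w /=;
  rewrite /slot eqxx ?(negbTE ij) ?mulr1 // eq_sym (negbTE ij) mul1r.
Qed.

(** A centred factor whose index occurs only once makes the expectation vanish; the other three
    indices may coincide. *)
Lemma expectation_unmatched i j k l f1 f2 f3 f4 : i != j -> i != k -> i != l ->
  bddmeas setT f1 -> bddmeas setT f2 -> bddmeas setT f3 -> bddmeas setT f4 ->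
  Rintegral P setT (fun w => f1 (X i w)) = 0 ->
  Rintegral P setT (fun w => f1 (X i w) * f2 (X j w) * f3 (X k w) * f4 (X l w)) = 0.
Proof.
move=> ij ik il b1 b2 b3 b4 E0.
have := @expectation_prod _ _ _ _ R P n X mX indX
  (fun m x => slot i f1 m x * slot j f2 m x * slot k f3 m x * slot l f4 m x)
  (fun m => bddmeasM (bddmeasM (bddmeasM (bslot i m b1) (bslot j m b2)) (bslot k m b3)) (bslot l m b4)).
rewrite (_ : (fun w => \prod_i0 _) =
    (fun w => f1 (X i w) * f2 (X j w) * f3 (X k w) * f4 (X l w))); last first.
  by apply/funext => w; rewrite !big_split /= !prod_slot.
move=> ->; rewrite (bigD1 i) //= (_ : Rintegral _ _ _ = 0) ?mul0r //.
rewrite -[RHS]E0; congr Rintegral; apply/funext => w /=.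
by rewrite /slot eqxx (negbTE ij) (negbTE ik) (negbTE il) !mulr1.
Qed.

Lemma expectation_sqr_sum g (v : R) : bddmeas setT g ->
  (forall i, Rintegral P setT (fun w => g (X i w)) = 0) ->
  (forall i, Rintegral P setT (fun w => g (X i w) ^+ 2) <= v) ->
  Rintegral P setT (fun w => (\sum_i g (X i w)) ^+ 2) <= n%:R * v.
Proof.
move=> bg g0 gv.
have bgg i j : bddmeas setT (fun w => g (X i w) * g (X j w)).
  by apply: bddmeasM; exact: bddmeas_comp.
have -> : (fun w => (\sum_i g (X i w)) ^+ 2) =
    (fun w => \sum_i \sum_j g (X i w) * g (X j w)).
  by apply/funext => w; rewrite expr2 mulr_suml; apply: eq_bigr => i _; rewrite mulr_sumr.
rewrite (bddmeas_Rintegral_sum (mu := P) measurableT PT); last first.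
  by move=> i; exact: bddmeas_sum.
have -> : n%:R * v = \sum_(i < n) v by rewrite sumr_const card_ord mulr_natl.
apply: ler_sum => i _; rewrite (bddmeas_Rintegral_sum (mu := P) measurableT PT) //.
rewrite (bigD1 i) //= big1 ?addr0; last first.
  by move=> j ji; rewrite expectation_pair 1?eq_sym // g0 mul0r.
by under eq_Rintegral do rewrite -expr2.
Qed.

(** This is the variance of a degenerate U-statistic: of the pairs (k, l) only (i, j) and (j, i)
    contribute, hence the factor 2, and there are n (n - 1) pairs (i, j). *)
Lemma expectation_sqr_offdiag (I : finType) (s : I -> S -> R) (C : I -> I -> R) :
  (forall a, bddmeas setT (s a)) ->
  (forall a i, Rintegral P setT (fun w => s a (X i w)) = 0) ->
  (forall a b i, Rintegral P setT (fun w => s a (X i w) * s b (X i w)) = C a b) ->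
  Rintegral P setT (fun w =>
    (\sum_i \sum_(j | j != i) \sum_a s a (X i w) * s a (X j w)) ^+ 2) =
  2 * n%:R * (n%:R - 1) * \sum_a \sum_b C a b ^+ 2.
Proof.
move=> bs s0 sC.
pose q4 i j k l a b w := s a (X i w) * s a (X j w) * s b (X k w) * s b (X l w).
have bq i j k l a b : bddmeas setT (q4 i j k l a b).
  by rewrite /q4; apply: bddmeasM; [apply: bddmeasM; [apply: bddmeasM|]|]; exact: bddmeas_comp.
have bss a b : bddmeas setT (fun x => s a x * s b x) by exact: bddmeasM.
have match_ i j a b : i != j -> E (fun w => s a (X i w) * s b (X i w) * (s a (X j w) * s b (X j w))) = C a b ^+ 2.
  by move=> ij; rewrite /E (expectation_pair ij (bss a b) (bss a b)) !sC.
have unm1 i j k l a b : i != j -> i != k -> i != l -> E (q4 i j k l a b) = 0.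
  by move=> ij ik il; exact: expectation_unmatched.
have q4C i j k l a b : q4 i j k l a b = q4 j i k l a b.
  by apply/funext => w; rewrite /q4; ring.
have inner i j a b : j != i ->
    \sum_k \sum_(l | l != k) E (q4 i j k l a b) = 2 * C a b ^+ 2.
  move=> ji; have ij : i != j by rewrite eq_sym.
  rewrite (bigD1 i) //= [X in _ + X](bigD1 j) //= [X in _ + (_ + X)]big1 ?addr0; last first.
    (* For [k] outside {i, j}, one of [i] and [j] occurs only once among the four indices: [j] if l
       = i, and [i] otherwise. *)
    move=> k /andP[ki kj]; apply: big1 => l lk; have [li|li] := eqVneq l i.
      by rewrite q4C unm1 // 1?eq_sym // li.
    by rewrite unm1 // eq_sym.
  rewrite (bigD1 j) //= [X in _ + X + _]big1 ?addr0; last first.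
    by move=> l /andP[li lj]; rewrite q4C unm1 // eq_sym.
  rewrite [X in _ + X](bigD1 i) //= [X in _ + (_ + X)]big1 ?addr0; last first.
    by move=> l /andP[lj li]; rewrite unm1 // eq_sym.
  rewrite mulr_natl mulr2n -{1}(match_ i j a b ij) -(match_ i j a b ij).
  by congr (_ + _); congr Rintegral; apply/funext => w; rewrite /q4; ring.
have -> : (fun w => (\sum_i \sum_(j | j != i) \sum_a s a (X i w) * s a (X j w)) ^+ 2) =
    (fun w => \sum_i \sum_(j | j != i) \sum_a \sum_k \sum_(l | l != k) \sum_b q4 i j k l a b w).
  apply/funext => w; rewrite expr2 mulr_suml; apply: eq_bigr => i _.
  rewrite mulr_suml; apply: eq_bigr => j _; rewrite mulr_suml; apply: eq_bigr => a _.
  rewrite mulr_sumr; apply: eq_bigr => k _.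
  rewrite mulr_sumr; apply: eq_bigr => l _.
  by rewrite mulr_sumr; apply: eq_bigr => b _; rewrite /q4; ring.
have ES J (r : seq J) (Q : pred J) (F : J -> Omega -> R) : (forall x, bddmeas setT (F x)) ->
    E (fun w => \sum_(x <- r | Q x) F x w) = \sum_(x <- r | Q x) E (F x).
  exact: (bddmeas_Rintegral_sum (mu := P) measurableT PT).
rewrite -[LHS]/(E _) ES; last by move=> i; do 5 apply: bddmeas_sum => ?; exact: bq.
transitivity (\sum_(i < n) \sum_(j < n | j != i) 2 * \sum_a \sum_b C a b ^+ 2).
  apply: eq_bigr => i _.
  rewrite ES; last by move=> j; do 4 apply: bddmeas_sum => ?; exact: bq.
  apply: eq_bigr => j ji.
  rewrite ES; last by move=> a; do 3 apply: bddmeas_sum => ?; exact: bq.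
  rewrite mulr_sumr; apply: eq_bigr => a _; rewrite mulr_sumr.
  rewrite ES; last by move=> k; do 2 apply: bddmeas_sum => ?; exact: bq.
  transitivity (\sum_k \sum_(l | l != k) \sum_b E (q4 i j k l a b)).
    apply: eq_bigr => k _.
    rewrite ES; last by move=> l; apply: bddmeas_sum => ?; exact: bq.
    by apply: eq_bigr => l _; rewrite ES.
  under eq_bigr do rewrite exchange_big /=.
  by rewrite exchange_big /=; apply: eq_bigr => b _; exact: inner.
rewrite (eq_bigr (fun=> (n%:R - 1) * (2 * \sum_a \sum_b C a b ^+ 2))).
  by rewrite sumr_const card_ord -[_ *+ n]mulr_natl; ring.
move=> i _; rewrite sumr_const cardC1 card_ord -[_ *+ n.-1]mulr_natl -subn1 natrB //.
exact: leq_ltn_trans (ltn_ord i).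
Qed.

Lemma chebyshev_sqr (f : Omega -> R) (r : R) : bddmeas setT f -> 0 < r ->
  fine (P [set w | r < `|f w|]) <= Rintegral P setT (fun w => f w ^+ 2) / r ^+ 2.
Proof.
move=> bf r0; have [mf _] := bf.
have mA : measurable [set w | r < `|f w|].
  have mn : measurable_fun setT (fun w => `|f w|) by exact: measurableT_comp.
  have := mn measurableT `]r, +oo[%classic (measurable_itv _); rewrite setTI.
  by congr measurable; apply/seteqP; split => w /=; rewrite in_itv /= andbT.
rewrite ler_pdivlMr ?exprn_gt0 //.
have b1 : bddmeas setT (\1_[set w | r < `|f w|] : Omega -> R).
  split; first exact: measurable_indic.
  by exists 1 => x _; rewrite indicE; case: (_ \in _); rewrite ?normr1 ?normr0.
have -> : fine (P [set w | r < `|f w|]) * r ^+ 2 =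
    Rintegral P setT (fun w => r ^+ 2 * \1_[set w | r < `|f w|] w).
  rewrite (bddmeas_RintegralZ (mu := P) measurableT PT _ b1) mulrC; congr (_ * _).
  by rewrite /Rintegral integral_indic // setIT.
apply: (bddmeas_le_Rintegral (mu := P) measurableT PT).
- exact: bddmeasZ.
- exact: bddmeasX.
move=> w _; rewrite indicE.
have [/set_mem /= rf|_] := boolP (w \in _); last by rewrite mulr0 sqr_ge0.
rewrite mulr1 -[leRHS]real_normK ?num_real //.
by rewrite ler_sqr ?nnegrE ?(ltW r0) // ltW.
Qed.

End SecondMoments.

(** * The remainder of the expansion *)

Section Remainder.
Variable R : realType.

Lemma sqrt_sub1_bound (r : R) : 1 <= r -> r - r^-1 <= Num.sqrt (r ^+ 2 - 1) <= r.
Proof.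
move=> r1; have r0 : 0 < r by exact: lt_le_trans r1.
have i1 : r^-1 <= 1 by rewrite invf_le1.
have i0 : 0 < r^-1 by rewrite invr_gt0.
have ri : r * r^-1 = 1 by rewrite divff // gt_eqF.
apply/andP; split.
  rewrite -(@ler_sqr R) ?nnegrE ?sqrtr_ge0 //; last by lra.
  rewrite sqr_sqrtr; last by nra.
  by nra.
rewrite -(@ler_sqr R) ?nnegrE ?sqrtr_ge0 //; last exact: ltW.
by rewrite sqr_sqrtr; nra.
Qed.

(** A deterministic estimate, to be read with r = sqrt p, so that r^2 - 1 and r^2 + 1 are the
    parameters p - 1 and p + 1 of [ln_hyp_bounds]; [L] is the logarithm, and [d], [e] are delta,
    epsilon. Only K eta / 2 does not decay with r, and it is made small through [eta]. *)
Lemma remainder_bound (r a d e L K eta M : R) (s := (r ^+ 2 - 1) * a * (1 + d + e)) :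
  2 <= r -> 0 <= a -> a <= K * r -> `|d| * r <= eta -> `|e| * r <= M ->
  0 <= K -> 0 <= eta -> 0 <= M -> 2 * eta <= r -> eta + M <= r ->
  0 <= L - (s / (2 * (r ^+ 2 - 1)) - s ^+ 2 / (4 * (r ^+ 2 - 1) ^+ 2 * (r ^+ 2 + 1)))
    <= s ^+ 3 / (3 * (r ^+ 2 - 1) ^+ 3 * (r ^+ 2 + 1) ^+ 2) ->
  `|L - a / 2 - a / 2 * (Num.sqrt (r ^+ 2 - 1) / r) * (e / (1 + d)) + a ^+ 2 / (4 * r ^+ 2)|
    <= K * eta / 2 + (K * M * (eta + 1) + K ^+ 2 * (1 + 3 * (eta + M)) + 3 * K ^+ 3) / r.
Proof.
move=> r2 a0 aK dr er K0 eta0 M0 eta_r etaM_r.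
have r0 : 0 < r by lra.
have Q0 : 0 < r ^+ 2 - 1 by nra.
have Q20 : 0 < r ^+ 2 + 1 by nra.
set y := 1 + d + e in s *.
have -> : s / (2 * (r ^+ 2 - 1)) = a * y / 2 by rewrite /s; field; rewrite gt_eqF.
have -> : s ^+ 2 / (4 * (r ^+ 2 - 1) ^+ 2 * (r ^+ 2 + 1)) = a ^+ 2 * y ^+ 2 / (4 * (r ^+ 2 + 1)).
  by rewrite /s; field; rewrite !gt_eqF.
have -> : s ^+ 3 / (3 * (r ^+ 2 - 1) ^+ 3 * (r ^+ 2 + 1) ^+ 2) = a ^+ 3 * y ^+ 3 / (3 * (r ^+ 2 + 1) ^+ 2).
  by rewrite /s; field; rewrite !gt_eqF.
set G := a * y / 2 - _; set B := a ^+ 3 * y ^+ 3 / _ => /andP[L0 LB].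
have d1 : `|d| <= eta / r by rewrite ler_pdivlMr.
have e1 : `|e| <= M / r by rewrite ler_pdivlMr.
have d2 : `|d| <= 1 / 2 by apply: le_trans d1 _; rewrite ler_pdivrMr //; lra.
have de1 : `|d + e| <= (eta + M) / r.
  by apply: le_trans (ler_normD _ _) _; rewrite mulrDl lerD.
have de2 : `|d + e| <= 1 by apply: le_trans de1 _; rewrite ler_pdivrMr //; lra.
have [y0 y2] : 0 <= y /\ y <= 2 by move: de2; rewrite ler_norml /y => /andP[? ?]; split; lra.
have dpos : 1 / 2 <= 1 + d by move: d2; rewrite ler_norml => /andP[? ?]; lra.
have dpos' : 0 < 1 + d by lra.
set sq := Num.sqrt (r ^+ 2 - 1).
have [sq1 sq2] : r - r^-1 <= sq /\ sq <= r by apply/andP; apply: sqrt_sub1_bound; lra.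
have ri0 : 0 < r^-1 by rewrite invr_gt0.
have rK : r * r^-1 = 1 by rewrite divff // gt_eqF.
have ri1 : r^-1 <= 1 by nra.
have aK' : a / r <= K by rewrite ler_pdivrMr.
have a'0 : 0 <= a / r by rewrite divr_ge0 // ltW.
(* the four error terms, each of order [1 / r] except for the first one *)
pose t1 := a * d / 2.
pose t2 := a / 2 * e * (1 - sq / r / (1 + d)).
pose t3 := a ^+ 2 / (4 * r ^+ 2) - a ^+ 2 * y ^+ 2 / (4 * (r ^+ 2 + 1)).
have -> : L - a / 2 - a / 2 * (sq / r) * (e / (1 + d)) + a ^+ 2 / (4 * r ^+ 2) =
    t1 + t2 + t3 + (L - G).
  by rewrite /t1 /t2 /t3 /G /y; field; rewrite !gt_eqF.
have b1 : `|t1| <= K * eta / 2.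
  rewrite /t1 !normrM (ger0_norm a0) [ `|2^-1| ]ger0_norm //.
  apply: ler_wpM2r => //.
  have -> : a * `|d| = (a / r) * (`|d| * r) by field; rewrite gt_eqF.
  by apply: ler_pM => //; rewrite mulr_ge0 // ltW.
(* The Watson statistic carries the factor sqrt (p - 1) / sqrt p and the division by 1 + d; together
   they differ from 1 by O(1 / r). *)
have b2 : `|t2| <= K * M * (eta + 1) / r.
  have h : `|1 - sq / r / (1 + d)| <= 2 * ((eta + 1) / r).
    have -> : 1 - sq / r / (1 + d) = (1 + d - sq / r) / (1 + d) by field; rewrite !gt_eqF.
    rewrite normrM normfV (gtr0_norm dpos') ler_pdivrMr //.
    have h1 : `|1 + d - sq / r| <= (eta + 1) / r.
      have -> : 1 + d - sq / r = d + (1 - sq / r) by ring.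
      apply: le_trans (ler_normD _ _) _; rewrite mulrDl; apply: lerD => //.
      have hs : sq / r <= 1 by rewrite ler_pdivrMr // mul1r.
      rewrite ger0_norm ?subr_ge0 // lerBlDl -lerBlDr ler_pdivlMr // mul1r mulrBl mul1r.
      apply: le_trans sq1; rewrite lerD2l lerN2 mulVf ?gt_eqF //.
    have h2 : 0 <= (eta + 1) / r by rewrite divr_ge0 ?addr_ge0 // ltW.
    by nra.
  have -> : t2 = (a / r) * (e * r) * (1 - sq / r / (1 + d)) / 2.
    by rewrite /t2; field; rewrite !gt_eqF.
  rewrite normrM [ `|2^-1| ]ger0_norm // normrM normrM (ger0_norm a'0).
  rewrite [ `|e * r|]normrM (ger0_norm (ltW r0)) -[X in X <= _]mulrA.
  have -> : K * M * (eta + 1) / r = (K * M) * (2 * ((eta + 1) / r) / 2) by field; rewrite gt_eqF.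
  have er0 : 0 <= `|e| * r by rewrite mulr_ge0 // ltW.
  apply: ler_pM.
  - exact: mulr_ge0.
  - by rewrite mulr_ge0.
  - exact: ler_pM.
  - exact: ler_wpM2r.
(* Replacing r^2 + 1 by r^2 and y^2 by 1 costs a relative O(1 / r), because y - 1 = d + e is O(1 /
   r). *)
have b3 : `|t3| <= K ^+ 2 * (1 + 3 * (eta + M)) / r.
  have h : `|r ^+ 2 + 1 - r ^+ 2 * y ^+ 2| <= (1 + 3 * (eta + M)) * r.
    have -> : r ^+ 2 + 1 - r ^+ 2 * y ^+ 2 = 1 - r ^+ 2 * ((d + e) * (2 + (d + e))).
      by rewrite /y; ring.
    apply: le_trans (ler_normB _ _) _; rewrite normr1 [in leRHS]mulrDl mul1r; apply: lerD; first lra.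
    rewrite normrM [ `|r ^+ 2| ]ger0_norm ?sqr_ge0 // normrM.
    have h3 : `|2 + (d + e)| <= 3.
      by apply: le_trans (ler_normD _ _) _; rewrite (@ger0_norm _ 2) //; lra.
    have -> : 3 * (eta + M) * r = r ^+ 2 * ((eta + M) / r * 3) by field; rewrite gt_eqF.
    by apply: ler_wpM2l; rewrite ?sqr_ge0 //; apply: ler_pM.
  have -> : t3 = (a / r) ^+ 2 * ((r ^+ 2 + 1 - r ^+ 2 * y ^+ 2) / (4 * (r ^+ 2 + 1))).
    by rewrite /t3; field; rewrite !gt_eqF.
  rewrite normrM ger0_norm ?sqr_ge0 // -mulrA; apply: ler_pM; rewrite ?sqr_ge0 //.
    by apply: lerXn2r.
  rewrite normrM normfV (@gtr0_norm _ (4 * _)); last by rewrite mulr_gt0.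
  rewrite ler_pdivrMr ?mulr_gt0 //; apply: le_trans h _.
  rewrite -mulrA; apply: ler_wpM2l; first by lra.
  rewrite mulrC ler_pdivlMr //; nra.
(* The cubic term is at most of order a^3 / r^4 with a <= K r; the bound y <= 2 gives y^3 <= 8. *)
have b4 : `|L - G| <= 3 * K ^+ 3 / r.
  rewrite ger0_norm //; apply: le_trans LB _; rewrite /B.
  have -> : a ^+ 3 * y ^+ 3 / (3 * (r ^+ 2 + 1) ^+ 2) =
    (a / r) ^+ 3 * (r ^+ 3 * y ^+ 3 / (3 * (r ^+ 2 + 1) ^+ 2)).
    by field; rewrite !gt_eqF.
  have -> : 3 * K ^+ 3 / r = K ^+ 3 * (3 / r) by ring.
  apply: ler_pM; first exact: exprn_ge0.
  - apply: divr_ge0; last by rewrite mulr_ge0 // sqr_ge0.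
    by apply: mulr_ge0; apply: exprn_ge0 => //; exact: ltW.
  - by apply: lerXn2r; rewrite ?nnegrE.
  rewrite ler_pdivrMr ?mulr_gt0 ?exprn_gt0 //.
  have y3 : y ^+ 3 <= 8.
    have -> : 8 = 2 ^+ 3 :> R by ring.
    by apply: lerXn2r; rewrite ?nnegrE.
  apply: le_trans (_ : r ^+ 3 * 8 <= _); first by rewrite ler_wpM2l // exprn_ge0 // ltW.
  have -> : 3 / r * (3 * (r ^+ 2 + 1) ^+ 2) = 9 * (r ^+ 4 + 2 * r ^+ 2 + 1) / r by field; rewrite gt_eqF.
  rewrite ler_pdivlMr // -subr_ge0.
  rewrite (_ : _ - _ = r ^+ 4 + 18 * r ^+ 2 + 9); last by ring.
  by rewrite !addr_ge0 ?mulr_ge0 ?exprn_ge0 // ltW.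
apply: le_trans (ler_normD _ _) _; apply: le_trans (lerD (ler_normD _ _) (lexx _)) _.
apply: le_trans (lerD (lerD (ler_normD _ _) (lexx _)) (lexx _)) _.
rewrite mulrDl mulrDl; lra.
Qed.

End Remainder.

(** * The expansion along a sample of fixed size *)

Lemma e1_gt0_of (R : realType) (p : nat) (k : R) : (2 < p)%N -> 0 < k -> 0 < e1 p k.
Proof. by case: p => [|[|[|m]]] // _; exact: e1_gt0. Qed.

Lemma et2_gt0_of (R : realType) (p : nat) (k : R) : (2 < p)%N -> 0 < k -> 0 < et2 p k.
Proof. by case: p => [|[|[|m]]] // _; exact: et2_gt0. Qed.

Section Sample.
Variables (R : realType) (p : nat) (t : 'cV[R]_p) (k : R).
Variable sigma : {measure set (vecT R p) -> \bar R}.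
Hypotheses (p2 : (2 < p)%N) (tt1 : dotv t t = 1) (k0 : 0 < k).
Hypothesis Hsigma : is_surface_measure sigma.
Context d (Omega : measurableType d) (P : probability Omega R) (n : nat)
  (X : 'I_n -> Omega -> vecT R p).
Hypothesis HX : iid_FvML P X sigma t k.
Hypothesis n0 : (0 < n)%N.

Let PT : (P setT < +oo)%E. Proof. by rewrite probability_setT ltry. Qed.
Let mX i : measurable_fun setT (X i). Proof. by case: HX. Qed.
Let indX := let: And3 _ ind _ := HX in ind.

Let nR : 0 < n%:R :> R. Proof. by rewrite ltr0n. Qed.
Let pR : 3 <= p%:R :> R. Proof. by rewrite ler_nat. Qed.
Let p1 : 0 < p%:R - 1 :> R. Proof. by have := pR; lra. Qed.

Let f2 : R := (p%:R - 1) * e1 p k / k.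

Let f2_gt0 : 0 < f2.
Proof. by rewrite /f2 divr_gt0 // mulr_gt0 // e1_gt0_of. Qed.

Let b (a : 'I_p) : 'cV[R]_p := perp_proj t *m delta_mx a 0.

Let tb a : dotv t (b a) = 0. Proof. exact: dotv_perp_proj. Qed.

(** The delta of the overview; [f2] is the mean of 1 - U^2. *)
Definition spread_dev (w : Omega) : R :=
  (n%:R^-1 * \sum_i (1 - proj_ind t (X i w) ^+ 2)) / f2 - 1.

(** The epsilon of the overview; the sum over the projected basis vectors is the scalar product of
    two projected observations. *)
Definition cross_dev (w : Omega) : R :=
  (n%:R^-1 * \sum_i \sum_(j | j != i) \sum_a comp_ind (b a) (X i w) * comp_ind (b a) (X j w)) / f2.

Let bcomp a : bddmeas setT (comp_ind a : vecT R p -> R).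
Proof. exact: bddmeas_sphere_ind_dotv. Qed.

Let bproj : bddmeas setT (fun x => 1 - proj_ind t x ^+ 2).
Proof.
apply: bddmeasB; first exact: bddmeas_cst.
by apply: bddmeasX; exact: bddmeas_sphere_ind_dotv.
Qed.

Lemma bddmeas_spread_dev : bddmeas setT spread_dev.
Proof.
apply: bddmeasB; last exact: bddmeas_cst.
apply: bddmeasM; last exact: bddmeas_cst.
apply: bddmeasZ; apply: bddmeas_sum => i.
exact: (bddmeas_comp mX i bproj).
Qed.

Lemma bddmeas_cross_dev : bddmeas setT cross_dev.
Proof.
apply: bddmeasM; last exact: bddmeas_cst.
apply: bddmeasZ; do 3 apply: bddmeas_sum => ?.
by apply: bddmeasM; exact: bddmeas_comp.
Qed.

Let E_cst (a : R) : Rintegral P setT (cst a) = a.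
Proof.
rewrite Rintegral_cst //.
by rewrite [fine _](congr1 fine (@probability_setT _ _ _ P)) mulr1.
Qed.

(** delta is a sum of independent centred terms, each with second moment at most 8 / (n^2 p) by the
    bound on the relative variance. *)
Lemma spread_dev_moment : Rintegral P setT (fun w => spread_dev w ^+ 2) <= 8 / (n%:R * p%:R).
Proof.
pose g x := (n%:R * f2)^-1 * (1 - proj_ind t x ^+ 2) - n%:R^-1.
have bg : bddmeas setT g by apply: bddmeasB; [exact: bddmeasZ | exact: bddmeas_cst].
have bp i := bddmeas_comp mX i bproj.
have Ep i : Rintegral P setT (fun w => 1 - proj_ind t (X i w) ^+ 2) = f2.
  exact: (expect_perp p2 tt1 k0 Hsigma HX i).
have Eg i : Rintegral P setT (fun w => g (X i w)) = 0.
  rewrite (bddmeas_RintegralB (mu := P) measurableT PT (bddmeasZ _ (bp i)) (bddmeas_cst _ n%:R^-1)).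
  rewrite (bddmeas_RintegralZ (mu := P) measurableT PT _ (bp i)) Ep E_cst.
  by field; rewrite !gt_eqF.
have Eg2 i : Rintegral P setT (fun w => g (X i w) ^+ 2) <= 8 / (n%:R ^+ 2 * p%:R).
  have -> : (fun w => g (X i w) ^+ 2) = (fun w =>
     ((n%:R * f2)^-1 ^+ 2 * (1 - proj_ind t (X i w) ^+ 2) ^+ 2 + n%:R^-1 ^+ 2)
     - 2 * (n%:R * f2)^-1 * n%:R^-1 * (1 - proj_ind t (X i w) ^+ 2)).
    by apply/funext => w; rewrite /g; ring.
  rewrite (bddmeas_RintegralB (mu := P) measurableT PT
    (bddmeasD (bddmeasZ _ (bddmeasX 2 (bp i))) (bddmeas_cst _ (n%:R^-1 ^+ 2))) (bddmeasZ _ (bp i))).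
  rewrite (bddmeas_RintegralD (mu := P) measurableT PT
    (bddmeasZ _ (bddmeasX 2 (bp i))) (bddmeas_cst _ (n%:R^-1 ^+ 2))).
  rewrite (bddmeas_RintegralZ (mu := P) measurableT PT _ (bddmeasX 2 (bp i))).
  rewrite (bddmeas_RintegralZ (mu := P) measurableT PT _ (bp i)) Ep E_cst.
  have := expect_perp2 p2 tt1 Hsigma HX i; rewrite Ep => /(ler_wpM2l (sqr_ge0 (n%:R * f2)^-1)) H.
  apply: le_trans (lerB (lerD H (lexx _)) (lexx _)) _.
  rewrite le_eqVlt; apply/orP; left; apply/eqP.
  by field; rewrite !gt_eqF //; have := pR; lra.
have := @expectation_sqr_sum _ _ _ _ R P n X mX indX g _ bg Eg Eg2.
have -> : (fun w => (\sum_i g (X i w)) ^+ 2) = (fun w => spread_dev w ^+ 2).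
  apply/funext => w; congr (_ ^+ 2); rewrite /g /spread_dev sumrB -mulr_sumr.
  by rewrite sumr_const card_ord -[_ *+ n]mulr_natl; field; rewrite !gt_eqF.
move=> H; apply: le_trans H _; rewrite le_eqVlt; apply/orP; left; apply/eqP.
by field; rewrite !gt_eqF //; have := pR; lra.
Qed.

(** The covariance of a projected observation is f2 / (p - 1) times the projection, whose squared
    Frobenius norm is its trace p - 1. This gives 2 (1 - 1/n) / (p - 1), and 2 / (p - 1) <= 4 /
    p. *)
Lemma cross_dev_moment : Rintegral P setT (fun w => cross_dev w ^+ 2) <= 4 / p%:R.
Proof.
pose C a c := dotv (b a) (b c) / (p%:R - 1) * f2.
have EC a c i : Rintegral P setT (fun w => comp_ind (b a) (X i w) * comp_ind (b c) (X i w)) = C a c.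
  rewrite (expect_comp2 p2 tt1 Hsigma HX i (tb a) (tb c)).
  by rewrite (expect_perp p2 tt1 k0 Hsigma HX i).
have := @expectation_sqr_offdiag _ _ _ _ R P n X mX indX _ (fun a => comp_ind (b a)) C
  (fun a => bcomp (b a)) (fun a i => expect_comp tt1 Hsigma HX i (tb a)) EC.
set S2 := (fun w => _ ^+ 2) => H.
have bS : bddmeas setT S2.
  apply: bddmeasX; do 3 apply: bddmeas_sum => ?.
  by apply: bddmeasM; exact: bddmeas_comp.
have -> : (fun w => cross_dev w ^+ 2) = (fun w => (n%:R * f2)^-1 ^+ 2 * S2 w).
  apply/funext => w; rewrite /cross_dev /S2; move: (\sum_i _) => z.
  by field; rewrite !gt_eqF.
rewrite (bddmeas_RintegralZ (mu := P) measurableT PT _ bS) H.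
have -> : \sum_a \sum_c C a c ^+ 2 = f2 ^+ 2 / (p%:R - 1).
  have -> : \sum_a \sum_c C a c ^+ 2 = (f2 / (p%:R - 1)) ^+ 2 * \sum_a \sum_c dotv (b a) (b c) ^+ 2.
    rewrite mulr_sumr; apply: eq_bigr => a _; rewrite mulr_sumr; apply: eq_bigr => c _.
    by rewrite -exprMn /C; congr (_ ^+ 2); ring.
  have -> : \sum_a \sum_c dotv (b a) (b c) ^+ 2 = p%:R - 1.
    rewrite -(trace_perp_proj tt1) /mxtrace; apply: eq_bigr => a _.
    transitivity (dotv (b a) (b a)).
      rewrite -[RHS]sum_sqr_dotv_delta; apply: eq_bigr => c _.
      by rewrite {2}/b -{1}(tr_perp_proj t) -dotv_mulmx /b mulmxA perp_projK.
    rewrite /b dotv_mulmx tr_perp_proj mulmxA perp_projK // -colE dotvE (bigD1 a) //= big1 => [|j ja].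
      by rewrite !mxE !eqxx mul1r addr0.
    by rewrite mxE (negbTE ja) mul0r.
  by field; rewrite gt_eqF.
have -> : (n%:R * f2)^-1 ^+ 2 * (2 * n%:R * (n%:R - 1) * (f2 ^+ 2 / (p%:R - 1))) =
    2 * (1 - n%:R^-1) / (p%:R - 1).
  by field; rewrite !gt_eqF.
have ni : 0 < n%:R^-1 :> R by rewrite invr_gt0.
rewrite ler_pdivrMr // mulrAC ler_pdivlMr; last by have := pR; lra.
by have := pR; nra.
Qed.

End Sample.

(** The inverse is y times (y^2)^(-1), a real power of a nonnegative number; at 0 both sides are 0
    by convention. *)
Lemma measurable_funV d (T : measurableType d) (R : realType) (f : T -> R) :
  measurable_fun setT f -> measurable_fun setT (fun x => (f x)^-1).
Proof.
move=> mf; rewrite (_ : (fun x => _) = (fun x => f x * (f x ^+ 2) `^ (-1))).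
  apply: measurable_funM => //.
  apply: (@measurableT_comp _ _ _ _ _ _ (fun y : R => y `^ (-1))); first exact: measurable_powR.
  exact: measurable_funX.
apply/funext => x; rewrite powR_inv1 ?sqr_ge0 //.
by have [->|f0] := eqVneq (f x) 0; [rewrite invr0 mul0r | rewrite expr2 invfM mulVKf].
Qed.

Lemma measurable_hyp (R : realType) q : (0 < q)%N -> measurable_fun setT (@hyp R q).
Proof.
move=> q0; apply: continuous_measurable_fun => s.
apply: differentiable_continuous; apply/derivable1_diffP.
by have := is_derive_hyp s q0; case.
Qed.

(** * The exact error of the expansion and its tail *)

Section Expansion.
Variables (R : realType) (p : nat) (t tau : 'cV[R]_p) (k nu : R).
Variable sigma : {measure set (vecT R p) -> \bar R}.
Variable H : probability (matT R p) R.
Hypotheses (p2 : (2 < p)%N) (tt1 : dotv t t = 1) (k0 : 0 < k) (nu0 : 0 < nu).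
Hypothesis th1 : dotv (t + nu *: tau) (t + nu *: tau) = 1.
Hypothesis Hsigma : is_surface_measure sigma.
Hypothesis HH : is_haar t H.
Context d (Omega : measurableType d) (P : probability Omega R) (n : nat)
  (X : 'I_n -> Omega -> vecT R p).
Hypothesis HX : iid_FvML P X sigma t k.
Hypothesis n0 : (0 < n)%N.

Let nR : 0 < n%:R :> R. Proof. by rewrite ltr0n. Qed.
Let pR : 3 <= p%:R :> R. Proof. by rewrite ler_nat. Qed.
Let p1 : 0 < p%:R - 1 :> R. Proof. by have := pR; lra. Qed.
Let mX i : measurable_fun setT (X i). Proof. by case: HX. Qed.
Let PT : (P setT < +oo)%E. Proof. by rewrite probability_setT ltry. Qed.

(** Laid out as the expression in the theorem, so that the tail bound applies there by
    conversion. *)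
Definition expansion_error (x : 'I_n -> 'cV[R]_p) : R :=
  let pn := p%:R in
  let nn := n%:R in
  let t2 := enorm tau ^+ 2 in
  let e := e1 p k in
  Lambda_inv1 H (t + nu *: tau) t k x
    - ( - 2^-1 * Num.sqrt nn * k * nu ^+ 2
          * Num.sqrt (et2 p k) * t2 * Zstat t k x
        + nn * k * nu ^+ 2 * e / (Num.sqrt 2 * Num.sqrt pn) * t2
          * (1 - 4^-1 * nu ^+ 2 * t2) * Wtilde t x
        - 8^-1 * nn * k * nu ^+ 4 * e * t2 ^+ 2
        - nn ^+ 2 * k ^+ 2 * nu ^+ 4 * e ^+ 2 / (4 * pn) * t2 ^+ 2
          * (1 - 4^-1 * nu ^+ 2 * t2) ^+ 2 ).

Let t2 : R := dotv tau tau.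
Let cc : R := 1 - 4^-1 * nu ^+ 2 * t2.
Let r : R := Num.sqrt p%:R.
Definition expansion_scale : R :=
  n%:R * k * nu ^+ 2 * e1 p k * dotv tau tau * (1 - 4^-1 * nu ^+ 2 * dotv tau tau).

Let a := expansion_scale.

(** Both vectors have unit length, which forces t . tau = - nu |tau|^2 / 2. *)
Let ttau : dotv t (t + nu *: tau) = 1 - nu ^+ 2 * t2 / 2.
Proof.
move: th1; rewrite !dotvDr !dotvDl !dotvZr !dotvZl tt1 (dotvC tau t) -/t2 => h; lra.
Qed.

(** This is the origin of the factor 1 - nu^2 |tau|^2 / 4 in the expansion. *)
Let perp_norm : dotv (t + nu *: tau) (t + nu *: tau) - dotv t (t + nu *: tau) ^+ 2 = nu ^+ 2 * t2 * cc.
Proof. by rewrite th1 ttau /cc; field. Qed.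

Lemma expansion_scale_ge0 : 0 <= a.
Proof.
have h : 0 <= nu ^+ 2 * t2 * cc.
  by rewrite -perp_norm -sqr_perp_proj // dotv_ge0.
rewrite /a /expansion_scale -/t2 -/cc.
have -> : n%:R * k * nu ^+ 2 * e1 p k * t2 * cc = n%:R * k * e1 p k * (nu ^+ 2 * t2 * cc) by ring.
have e0 := e1_gt0_of p2 k0; apply: mulr_ge0 => //.
by apply: mulr_ge0 (ltW e0); apply: mulr_ge0 (ltW k0); exact: ltW.
Qed.

Lemma expansion_scale_le : a <= n%:R * k * e1 p k * nu ^+ 2 * dotv tau tau.
Proof.
have e0 := e1_gt0_of p2 k0; have t0 : 0 <= t2 := dotv_ge0 tau.
rewrite /a /expansion_scale -/t2 -/cc.
have -> : n%:R * k * nu ^+ 2 * e1 p k * t2 * cc = (n%:R * k * e1 p k * nu ^+ 2 * t2) * cc by ring.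
apply: ler_piMr.
  apply: mulr_ge0 t0; apply: mulr_ge0 (sqr_ge0 _).
  by apply: mulr_ge0 (ltW e0); apply: mulr_ge0 (ltW k0); exact: ltW.
by rewrite /cc gerBl mulr_ge0 // mulr_ge0 ?sqr_ge0 // invr_ge0.
Qed.

Let sphere_indE (x : 'cV[R]_p) : sphere x -> sphere_ind (x : vecT R p) = 1.
Proof. by move=> Sx; rewrite /sphere_ind indicE mem_set. Qed.

(** The squared norm of the projected sum is split into its diagonal, where |x|^2 = 1 gives 1 - (x .
    t)^2, and its off-diagonal part. The second identity is the denominator of the Watson
    statistic. *)
Let perp_Xbar (w : Omega) : (forall i, sphere (X i w : 'cV[R]_p)) ->
  let x := fun i => (X i w : 'cV[R]_p) in
  let f2 := (p%:R - 1) * e1 p k / k in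
  n%:R * dotv (perp_proj t *m Xbar x) (perp_proj t *m Xbar x) =
    f2 * (1 + spread_dev t k X w + cross_dev t k X w) /\
  1 - n%:R^-1 * \sum_i dotv (x i) t ^+ 2 = f2 * (1 + spread_dev t k X w).
Proof.
move=> Sx x f2.
have f20 : f2 != 0.
  by rewrite gt_eqF // divr_gt0 // mulr_gt0 // (e1_gt0_of p2 k0).
have spE : f2 * (1 + spread_dev t k X w) = n%:R^-1 * \sum_i (1 - dotv (x i) t ^+ 2).
  rewrite /spread_dev -/f2 addrC subrK mulrC divfK //; congr (_ * _).
  by apply: eq_bigr => i _; rewrite /proj_ind sphere_indE // mul1r.
have crE : f2 * cross_dev t k X w = n%:R^-1 * \sum_i \sum_(j | j != i) \sum_c
    dotv (x i) (perp_proj t *m delta_mx c 0) * dotv (x j) (perp_proj t *m delta_mx c 0).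
  rewrite /cross_dev -/f2 mulrC divfK //; congr (_ * _).
  apply: eq_bigr => i _; apply: eq_bigr => j _; apply: eq_bigr => c _.
  by rewrite /comp_ind !sphere_indE // !mul1r.
split; last first.
  rewrite spE sumrB sumr_const card_ord mulrBr -[_ *+ n]mulr_natl mulr1.
  by rewrite mulVf ?gt_eqF.
rewrite mulrDr spE crE -mulrDr.
rewrite -sum_sqr_dotv_delta (eq_bigr (fun c => n%:R^-1 ^+ 2 *
    (\sum_i dotv (x i) (perp_proj t *m delta_mx c 0)) ^+ 2)); last first.
  move=> c _; rewrite dotv_mulmx tr_perp_proj /Xbar dotvZl exprMn; congr (_ * _ ^+ 2).
  by rewrite dotv_suml.
rewrite -mulr_sumr mulrA expr2 mulrA mulfV ?gt_eqF // mul1r; congr (_ * _).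
under eq_bigr do rewrite expr2 mulr_suml.
rewrite exchange_big /= -big_split /=; apply: eq_bigr => i _.
under eq_bigr do rewrite mulr_sumr (bigD1 i) //=.
rewrite big_split /=; congr (_ + _); last by rewrite exchange_big.
have /sphereP := Sx i => <-; rewrite -[X in _ - X]/(dotv (x i) t ^+ 2) (dotvC (x i) t).
rewrite -sqr_perp_proj // -sum_sqr_dotv_delta; apply: eq_bigr => c _.
by rewrite dotv_mulmx tr_perp_proj expr2.
Qed.

(** Subtracting the [Zstat] term replaces Xbar . t by its mean [e1]; with the nu^4 e1 term this
    gives exactly - a / 2. The centred Watson statistic is (p - 1) C / (1 + D). *)
Lemma expansion_errorE (w : Omega) (D := spread_dev t k X w) (C := cross_dev t k X w) :
  (forall i, sphere (X i w : 'cV[R]_p)) -> 0 < 1 + D ->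
  expansion_error (fun i => X i w) =
    ln (hyp p.-1 ((r ^+ 2 - 1) * a * (1 + D + C))) - a / 2
    - a / 2 * (Num.sqrt (r ^+ 2 - 1) / r) * (C / (1 + D)) + a ^+ 2 / (4 * r ^+ 2).
Proof.
move=> Sx D0; have [Eperp Esp] := perp_Xbar Sx; rewrite -/D -/C in Eperp Esp.
have e0 := e1_gt0_of p2 k0; have v0 := et2_gt0_of p2 k0.
have r2 : r ^+ 2 = p%:R by rewrite sqr_sqrtr // ler0n.
have r0 : 0 < r by rewrite sqrtr_gt0; have := pR; lra.
rewrite /expansion_error (Lambda_inv1E p2 tt1 HH) perp_norm ttau r2.
set x := (fun i => _) in Eperp Esp *.
set f2 := (p%:R - 1) * e1 p k / k in Eperp Esp.
have f20 : f2 != 0 by rewrite gt_eqF // divr_gt0 // mulr_gt0.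
set N := dotv (perp_proj t *m Xbar x) (perp_proj t *m Xbar x) in Eperp *.
(* The identity f2 = (p - 1) e1 / k turns n k^2 f2 into (p - 1) n k e1, which produces the scale
   [a]. *)
have -> : (n%:R * k) ^+ 2 * (nu ^+ 2 * t2 * cc) * N = (p%:R - 1) * a * (1 + D + C).
  have -> : (n%:R * k) ^+ 2 * (nu ^+ 2 * t2 * cc) * N = n%:R * k ^+ 2 * (nu ^+ 2 * t2 * cc) * (n%:R * N) by ring.
  by rewrite Eperp /a /expansion_scale -/t2 -/cc /f2; field; rewrite gt_eqF.
have ZE : Num.sqrt n%:R * Num.sqrt (et2 p k) * Zstat t k x = n%:R * (dotv (Xbar x) t - e1 p k).
  rewrite /Zstat -{3}(sqr_sqrtr (ltW nR)) expr2.
  by field; rewrite gt_eqF // sqrtr_gt0.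
have WE : Wstat t x = (p%:R - 1) * (1 + D + C) / (1 + D).
  rewrite /Wstat Esp.
  have -> : ((Xbar x)^T *m (1%:M - t *m t^T) *m Xbar x) 0 0 = N.
    rewrite -mulmxA -[LHS]/(dotv (Xbar x) (perp_proj t *m Xbar x)).
    by rewrite /N dotv_mulmx tr_perp_proj mulmxA perp_projK.
  have -> : n%:R * (p%:R - 1) * N = (p%:R - 1) * (n%:R * N) by ring.
  rewrite Eperp.
  by clearbody f2 => {Esp Eperp}; field; rewrite f20 gt_eqF.
set sq := Num.sqrt (p%:R - 1); set s2 := Num.sqrt 2.
have sqE : sq ^+ 2 = p%:R - 1 by rewrite sqr_sqrtr // ltW.
have s2E : s2 ^+ 2 = 2 by rewrite sqr_sqrtr.
have sq0 : 0 < sq by rewrite sqrtr_gt0.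
have s20 : 0 < s2 by rewrite sqrtr_gt0.
have WtE : Wtilde t x = sq / s2 * (C / (1 + D)).
  rewrite /Wtilde WE sqrtrM // -/sq -/s2 -sqE; field; rewrite !gt_eqF //.
rewrite sqr_enorm -/t2 -/r WtE.
have -> : - 2^-1 * Num.sqrt n%:R * k * nu ^+ 2 * Num.sqrt (et2 p k) * t2 * Zstat t k x =
   - 2^-1 * k * nu ^+ 2 * t2 * (n%:R * (dotv (Xbar x) t - e1 p k)).
  by rewrite -ZE; ring.
rewrite -r2; move: (ln _) => L.
rewrite (_ : n%:R * k * nu ^+ 2 * e1 p k / (s2 * r) * t2 * (1 - 4^-1 * nu ^+ 2 * t2) * (sq / s2 * (C / (1 + D))) =
  a / s2 ^+ 2 * (sq / r) * (C / (1 + D))); last first.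
  by rewrite /a /expansion_scale -/t2; field; rewrite !gt_eqF.
rewrite s2E /a /expansion_scale -/t2.
by field; rewrite !gt_eqF.
Qed.

Let measurable_dot_Xbar (b : 'cV[R]_p) :
  measurable_fun setT (fun w => dotv (Xbar (fun i => (X i w : 'cV[R]_p))) b).
Proof.
rewrite (_ : (fun w => _) = (fun w => n%:R^-1 * \sum_i dotv (X i w : 'cV[R]_p) b)).
  apply: measurable_funM => //; apply: measurable_sum => i.
  exact: measurable_dotv.
by apply/funext => w; rewrite /Xbar dotvZl dotv_suml.
Qed.

Let measurable_perp_Xbar :
  measurable_fun setT (fun w => dotv (perp_proj t *m Xbar (fun i => (X i w : 'cV[R]_p)))
    (perp_proj t *m Xbar (fun i => (X i w : 'cV[R]_p)))).
Proof.
rewrite (_ : (fun w => _) = (fun w => \sum_(c < p)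
    dotv (Xbar (fun i => (X i w : 'cV[R]_p))) (perp_proj t *m delta_mx c 0) ^+ 2)).
  by apply: measurable_sum => c; apply: measurable_funX.
apply/funext => w; rewrite -sum_sqr_dotv_delta; apply: eq_bigr => c _.
by rewrite dotv_mulmx tr_perp_proj.
Qed.

(** The closed form of the Haar average holds for every sample, on the sphere or not, so it gives
    measurability everywhere. *)
Lemma measurable_expansion_error :
  measurable_fun setT (fun w => expansion_error (fun i => X i w)).
Proof.
have q0 : (0 < p.-1)%N by rewrite -subn1 subn_gt0 (ltn_trans _ p2).
have mZ : measurable_fun setT (fun w => Zstat t k (fun i => X i w)).
  by apply: measurable_funM => //; apply: measurable_funM => //; apply: measurable_funB.
have mW : measurable_fun setT (fun w => Wstat t (fun i => X i w)).
  rewrite (_ : (fun w => _) = (fun w => n%:R * (p%:R - 1) *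
      dotv (perp_proj t *m Xbar (fun i => (X i w : 'cV[R]_p)))
       (perp_proj t *m Xbar (fun i => (X i w : 'cV[R]_p))) *
      (1 - n%:R^-1 * \sum_(i < n) dotv (X i w : 'cV[R]_p) t ^+ 2)^-1)).
    apply: measurable_funM; first by apply: measurable_funM.
    apply: measurable_funV; apply: measurable_funB => //; apply: measurable_funM => //.
    by apply: measurable_sum => i; apply: measurable_funX; exact: measurable_dotv.
  apply/funext => w; rewrite /Wstat; congr (_ * _ / _).
  rewrite -mulmxA -[LHS]/(dotv _ (perp_proj t *m _)).
  by rewrite dotv_mulmx tr_perp_proj mulmxA perp_projK.
have mL : measurable_fun setT (fun w => Lambda_inv1 H (t + nu *: tau) t k (fun i => X i w)).
  rewrite (_ : (fun w => _) = (fun w =>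
    - n%:R * k * (1 - dotv t (t + nu *: tau)) * dotv (Xbar (fun i => (X i w : 'cV[R]_p))) t +
    ln (hyp p.-1 ((n%:R * k) ^+ 2 * (dotv (t + nu *: tau) (t + nu *: tau) -
      dotv t (t + nu *: tau) ^+ 2) *
      dotv (perp_proj t *m Xbar (fun i => (X i w : 'cV[R]_p)))
       (perp_proj t *m Xbar (fun i => (X i w : 'cV[R]_p))))))).
    apply: measurable_funD; first by apply: measurable_funM.
    apply: (@measurableT_comp _ _ _ _ _ _ (@ln R)); first exact: measurable_ln.
    apply: (@measurableT_comp _ _ _ _ _ _ (@hyp R p.-1)); first exact: measurable_hyp.
    by apply: measurable_funM.
  by apply/funext => w; exact: Lambda_inv1E.
rewrite /expansion_error; apply: measurable_funB => //.
do 2 apply: measurable_funB => //.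
apply: measurable_funD; first by apply: measurable_funM.
apply: measurable_funM => //; apply: measurable_funM => //; exact: measurable_funB.
Qed.

Let P_sphere : P (\bigcap_i (X i @^-1` (@sphere R p : set (vecT R p)))) = 1%E.
Proof.
have [_ ind law] := HX; have mS := @measurable_sphere R p.
rewrite ind; last by move=> _; exact: mS.
rewrite big1 // => i _.
have mC : measurable (~` (@sphere R p : set (vecT R p))) by exact: measurableC.
have C0 : P (X i @^-1` ~` (@sphere R p : set (vecT R p))) = 0%E.
  have [s0 _ _] := Hsigma; rewrite (law i _ mC) null_set_integral //.
  apply: measurable_funTS; apply/measurable_EFinP.
  apply: measurable_funM => //; apply: measurableT_comp => //.
  by apply: measurable_funM => //; exact: measurable_dotv_id.
have mXS : measurable (X i @^-1` (@sphere R p : set (vecT R p))).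
  by rewrite -[X in measurable X]setTI; exact: mX.
rewrite -[_ @^-1` _]setCK probability_setC; last exact: measurableC.
by rewrite preimage_setC C0 sube0.
Qed.

(** Off a null set and the two events |D| > eta / r and |C| > M / r, the deterministic estimate
    applies. In Chebyshev's inequality the factor r^2 = p cancels the 1 / p of both second
    moments. *)
Lemma expansion_error_tail (K eta M eps : R) :
  2 <= r -> a <= K * r -> 0 <= K -> 0 < eta -> 0 < M -> 2 * eta <= r -> eta + M <= r ->
  K * eta / 2 + (K * M * (eta + 1) + K ^+ 2 * (1 + 3 * (eta + M)) + 3 * K ^+ 3) / r <= eps ->
  fine (P [set w | eps < `|expansion_error (fun i => X i w)|]) <=
    8 / (n%:R * eta ^+ 2) + 4 / M ^+ 2.
Proof.
move=> r2 aK K0 eta0 M0 etar etaMr small.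
have r0 : 0 < r by lra.
have rp : r ^+ 2 = p%:R by rewrite sqr_sqrtr // ler0n.
have q0 : (0 < p.-1)%N by rewrite -subn1 subn_gt0 (ltn_trans _ p2).
have qE : p.-1%:R = r ^+ 2 - 1 :> R by rewrite rp -subn1 natrB // (ltn_trans _ p2).
have q2E : p.-1.+2%:R = r ^+ 2 + 1 :> R.
  by rewrite -addn2 natrD qE; ring.
have bD := bddmeas_spread_dev HX; have bC := bddmeas_cross_dev HX.
set D := spread_dev t k X in bD; set C := cross_dev t k X in bC.
pose A1 := [set w | eta / r < `|D w|]; pose A2 := [set w | M / r < `|C w|].
pose A0 := \bigcap_i (X i @^-1` (@sphere R p : set (vecT R p))).
have mgt (f : Omega -> R) c : measurable_fun setT f -> measurable [set w | c < `|f w|].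
  move=> mf; have mn : measurable_fun setT (fun w => `|f w|) by exact: measurableT_comp.
  have := mn measurableT `]c, +oo[%classic (measurable_itv _); rewrite setTI.
  by congr measurable; apply/seteqP; split => w /=; rewrite in_itv /= andbT.
have mA1 : measurable A1 by apply: mgt; exact: bD.1.
have mA2 : measurable A2 by apply: mgt; exact: bC.1.
have mA0 : measurable A0.
  apply: fin_bigcap_measurable => // i _; rewrite -[X in measurable X]setTI.
  by apply: mX => //; exact: measurable_sphere.
have mA0C : measurable (~` A0) by exact: measurableC.
pose Bad := [set w | eps < `|expansion_error (fun i => X i w)|].
have mBad : measurable Bad.
  by apply: mgt; exact: measurable_expansion_error.
have incl : Bad `<=` ~` A0 `|` (A1 `|` A2).
  move=> w /= Bw; apply: contrapT => /not_orP[/contrapT wA0 /not_orP[wA1 wA2]].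
  have Sx i : sphere (X i w : 'cV[R]_p) by exact: (wA0 i I).
  have d1 : `|D w| <= eta / r by rewrite leNgt; apply/negP.
  have e1 : `|C w| <= M / r by rewrite leNgt; apply/negP.
  have d2 : `|D w| <= 1 / 2 by apply: le_trans d1 _; rewrite ler_pdivrMr //; lra.
  have de : `|D w + C w| <= 1.
    apply: le_trans (ler_normD _ _) _; apply: le_trans (lerD d1 e1) _.
    by rewrite -mulrDl ler_pdivrMr // mul1r.
  have D0 : 0 < 1 + D w by move: d2; rewrite ler_norml => /andP[? ?]; lra.
  have y0 : 0 <= 1 + D w + C w by move: de; rewrite ler_norml => /andP[? ?]; lra.
  have a0 := expansion_scale_ge0.
  have s0 : 0 <= (r ^+ 2 - 1) * a * (1 + D w + C w).
    by apply: mulr_ge0 y0; apply: mulr_ge0 a0; rewrite rp ltW.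
  have := ln_hyp_bounds q0 s0; rewrite qE q2E => Hl.
  have := @remainder_bound R r a (D w) (C w) _ K eta M r2 a0 aK _ _ K0 (ltW eta0) (ltW M0) etar etaMr Hl.
  rewrite -!ler_pdivlMr // => /(_ d1 e1) Hb.
  move: Bw; rewrite /Bad /= (expansion_errorE Sx D0) ltNge => /negP; apply.
  exact: le_trans Hb small.
have fin (A : set Omega) : measurable A -> P A \is a fin_num by move=> mA; exact: fin_num_measure.
have PA0 : P (~` A0) = 0%E.
  by rewrite probability_setC // (_ : P A0 = 1%E) ?subee // P_sphere.
have mU : measurable (A1 `|` A2) by exact: measurableU.
have le1 : (P Bad <= P A1 + P A2)%E.
  apply: le_trans (_ : P (~` A0 `|` (A1 `|` A2)) <= _)%E.
    by apply: le_measure; rewrite ?inE //; exact: measurableU.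
  apply: le_trans (measureU2 _ mA0C mU) _.
  by rewrite [X in (X + _)%E]PA0 add0e; exact: measureU2.
have le2 : fine (P Bad) <=
    fine (P A1) + fine (P A2).
  by rewrite -lee_fin EFinD !fineK ?fin.
apply: le_trans le2 _; apply: lerD.
  apply: le_trans (chebyshev_sqr P bD (divr_gt0 eta0 r0)) _.
  apply: le_trans (ler_wpM2r _ (spread_dev_moment p2 tt1 k0 Hsigma HX n0)) _.
    by rewrite invr_ge0 sqr_ge0.
  rewrite le_eqVlt; apply/orP; left; apply/eqP; rewrite -rp.
  by field; rewrite !gt_eqF.
apply: le_trans (chebyshev_sqr P bC (divr_gt0 M0 r0)) _.
apply: le_trans (ler_wpM2r _ (cross_dev_moment p2 tt1 k0 Hsigma HX n0)) _.
  by rewrite invr_ge0 sqr_ge0.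
rewrite le_eqVlt; apply/orP; left; apply/eqP; rewrite -rp.
by field; rewrite !gt_eqF.
Qed.

End Expansion.

(** * Choice of the constants and conclusion *)

Unset Implicit Arguments.

Theorem theorem1 (R : realType) (p : nat -> nat) (kappa nu : nat -> R)
  (theta0 tau : forall n, 'cV[R]_(p n))
  (d : nat -> measure_display) (Omega : forall n, measurableType (d n))
  (P : forall n, probability (Omega n) R)
  (X : forall n, 'I_n -> Omega n -> vecT R (p n))
  (sigma : forall n, {measure set (vecT R (p n)) -> \bar R})
  (H : forall n, probability (matT R (p n)) R) :
  (* p_n -> oo *)
  (forall M : nat, exists N : nat, forall n, (N <= n)%N -> (M <= p n)%N) ->
  (forall n, 0 < kappa n) ->
  (forall n, @sphere R (p n) (theta0 n)) ->
  (forall n, @sphere R (p n) (theta0 n + nu n *: tau n)) ->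
  (* ||tau_n|| = O(1) *)
  (exists C : R, forall n, enorm (tau n) <= C) ->
  (forall n, 0 < nu n) ->
  (* nu_n^2 = O(sqrt(p_n) / (n kappa_n e_{n1})) *)
  (exists (C : R) (N : nat), forall n, (N <= n)%N ->
     nu n ^+ 2 <= C * (Num.sqrt (p n)%:R / (n%:R * kappa n * e1 (p n) (kappa n)))) ->
  (* sigma n is the surface area measure on S^{p_n - 1} *)
  (forall n, is_surface_measure (sigma n)) ->
  (* H n is the normalized Haar measure on SO_{p_n}(theta_{n0}) *)
  (forall n, is_haar (theta0 n) (H n)) ->
  (* under P^{(n)}_{theta_{n0},kappa_n}: X_{n1},...,X_{nn} i.i.d. FvML *)
  (forall n, iid_FvML (P n) (X n) (sigma n) (theta0 n) (kappa n)) ->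
  forall eps : R, 0 < eps ->
  (fun n =>
     fine (P n [set w |
       let x := fun i : 'I_n => (X n i w : 'cV[R]_(p n)) in
       let k := kappa n in
       let pn := (p n)%:R in
       let nn := n%:R in
       let t2 := enorm (tau n) ^+ 2 in
       let e := e1 (p n) k in
       let thn := theta0 n + nu n *: tau n in
       eps < `| Lambda_inv1 (H n) thn (theta0 n) k x
               - ( - 2^-1 * Num.sqrt nn * k * nu n ^+ 2
                     * Num.sqrt (et2 (p n) k) * t2 * Zstat (theta0 n) k x
                   + nn * k * nu n ^+ 2 * e / (Num.sqrt 2 * Num.sqrt pn) * t2
                     * (1 - 4^-1 * nu n ^+ 2 * t2) * Wtilde (theta0 n) x
                   - 8^-1 * nn * k * nu n ^+ 4 * e * t2 ^+ 2
                   - nn ^+ 2 * k ^+ 2 * nu n ^+ 4 * e ^+ 2 / (4 * pn) * t2 ^+ 2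
                     * (1 - 4^-1 * nu n ^+ 2 * t2) ^+ 2 ) | ]))
  @ \oo --> 0.
Proof.
move=> p_oo k0 t1 th1 [Ct HCt] nu0 [C [N0 HC]] Hs HH HX eps eps0.
apply/cvgrPdist_lt => rho rho0.
(* The rate of [nu] and the bound on [tau] give a <= K sqrt p. *)
pose K := `|C| * Ct ^+ 2.
have K0 : 0 <= K by rewrite mulr_ge0 ?sqr_ge0.
(* [eta] brings the non-decaying error K eta / 2 below eps / 4, and [M] brings the Chebyshev term 4
   / M^2 below rho / 2. *)
pose eta := eps / (2 * (K + 1)); pose M := 8 / rho + 1.
have eta0 : 0 < eta by rewrite divr_gt0 // mulr_gt0 //; lra.
have M1 : 1 <= M by rewrite lerDr divr_ge0 // ltW.
have M0 : 0 < M by exact: lt_le_trans M1.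
pose C0 := K * M * (eta + 1) + K ^+ 2 * (1 + 3 * (eta + M)) + 3 * K ^+ 3.
have C00 : 0 <= C0.
  apply: addr_ge0; last by rewrite mulr_ge0 // exprn_ge0.
  apply: addr_ge0; first by apply: mulr_ge0; [apply: mulr_ge0 K0 (ltW M0) | lra].
  by apply: mulr_ge0; [exact: sqr_ge0 | lra].
have Keta : K * eta / 2 <= eps / 4.
  have -> : K * eta / 2 = eps / 4 * (K / (K + 1)).
    by rewrite /eta; field; rewrite gt_eqF //; lra.
  have h : K / (K + 1) <= 1 by rewrite ler_pdivrMr; lra.
  by apply: ler_piMr h; apply: divr_ge0 => //; exact: ltW.
(* Every lower bound that sqrt p has to satisfy is a summand of [B]; the last one makes C0 / r at
   most eps / 2. *)
pose B := 2 + 2 * eta + (eta + M) + C0 / (eps / 2).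
have CB0 : 0 <= C0 / (eps / 2) by apply: divr_ge0 C00 _; lra.
have B0 : 0 <= B by rewrite /B; lra.
have [N1 HN1] := p_oo (maxn 3 (Num.trunc (B ^+ 2)).+1).
(* Beyond [N2] the term 8 / (n eta^2) is below rho / 2; the successor also makes n positive. *)
pose N2 := (Num.trunc (16 / (rho * eta ^+ 2))).+1.
exists (maxn N0 (maxn N1 N2)) => // n /=; rewrite !geq_max => /and3P[nN0 nN1 nN2].
have := HN1 n nN1; rewrite geq_max => /andP[p3 pB].
have n0 : (0 < n)%N by exact: leq_trans nN2.
have nR : 0 < n%:R :> R by rewrite ltr0n.
have tt1 : dotv (theta0 n) (theta0 n) = 1 by apply/sphereP.
have thth1 : dotv (theta0 n + nu n *: tau n) (theta0 n + nu n *: tau n) = 1 by apply/sphereP.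
have e0 := e1_gt0_of p3 (k0 n).
set r := Num.sqrt (p n)%:R : R.
have Br : B <= r.
  rewrite -(@ler_sqr R) ?nnegrE ?sqrtr_ge0 // sqr_sqrtr ?ler0n //.
  apply: le_trans (ltW (truncnS_gt (B ^+ 2))) _; by rewrite ler_nat.
have r0 : 0 < r by apply: lt_le_trans Br; rewrite /B; lra.
have aK : expansion_scale (tau n) (kappa n) (nu n) n <= K * r.
  apply: le_trans (expansion_scale_le (tau n) (nu n) p3 (k0 n) n0) _.
  have tC : dotv (tau n) (tau n) <= Ct ^+ 2.
    rewrite -sqr_enorm; have h0 : 0 <= enorm (tau n) by exact: sqrtr_ge0.
    have hC := HCt n; have Ct0 := le_trans h0 hC.
    by apply: lerXn2r; rewrite ?nnegrE.
  have -> : K * r = `|C| * r * Ct ^+ 2 by rewrite /K; ring.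
  have nke : 0 < n%:R * kappa n * e1 (p n) (kappa n).
    by apply: mulr_gt0 e0; apply: mulr_gt0 nR (k0 n).
  apply: ler_pM => //; [|exact: dotv_ge0|].
    by rewrite mulr_ge0 ?sqr_ge0 // ltW.
  have := HC n nN0; rewrite mulrA ler_pdivlMr // mulrC => h.
  by apply: le_trans h _; apply: ler_wpM2r; [exact: ltW | exact: ler_norm].
have tail := @expansion_error_tail R (p n) (theta0 n) (tau n) (kappa n) (nu n) (sigma n) (H n)
  p3 tt1 (k0 n) thth1 (Hs n) (HH n) _ _ (P n) n (X n) (HX n) n0 K eta M eps _ aK K0 eta0 M0 _ _ _.
rewrite sub0r normrN ger0_norm; last by rewrite fine_ge0.
apply: le_lt_trans (tail _ _ _ _) _.
- by apply: le_trans Br; rewrite /B; lra.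
- by apply: le_trans Br; rewrite /B; lra.
- by apply: le_trans Br; rewrite /B; lra.
- have h : C0 / r <= eps / 2.
    rewrite ler_pdivrMr // mulrC -ler_pdivrMr; last by rewrite divr_gt0.
    by apply: le_trans Br; rewrite /B; lra.
  by rewrite -/C0; lra.
have h1 : 8 / (n%:R * eta ^+ 2) < rho / 2.
  have e2 : 0 < eta ^+ 2 by rewrite exprn_gt0.
  rewrite ltr_pdivrMr; last exact: mulr_gt0 nR e2.
  have : 16 / (rho * eta ^+ 2) < n%:R.
    by apply: lt_le_trans (truncnS_gt _) _; rewrite ler_nat.
  by rewrite ltr_pdivrMr; [move=> h; lra | exact: mulr_gt0 rho0 e2].
have h2 : 4 / M ^+ 2 < rho / 2.
  rewrite ltr_pdivrMr ?exprn_gt0 //.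
  have rM : rho * M = 8 + rho by rewrite /M; field; rewrite gt_eqF.
  have M2 : M <= M ^+ 2 by rewrite expr2 ler_peMl // ltW.
  have : rho / 2 * M <= rho / 2 * M ^+ 2 by rewrite ler_wpM2l // divr_ge0 // ltW.
  by lra.
by lra.
Qed.
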